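(* Let $k+1\le\ell\le 2k+1$ and $s=\ell-k-1$. Let $E_\ell$, $F_\ell$ be order $\ell$ deformation quantizations of locally free sheaves $E$, $F$ on $M$, let $E_k,E_s,F_k,F_s$ be their reductions modulo $\hbar^{k+1}$ and $\hbar^{s+1}$, let $e_\ell\in Ext^1_{\mathcal{O}_\hbar}(E_k,\hbar^{k+1}\cdot E_s)$ and $f_\ell\in Ext^1_{\mathcal{O}_\hbar}(F_k,\hbar^{k+1}\cdot F_s)$ be the corresponding extension classes, let $\varphi_k:E_k\to F_k$ be a morphism of sheaves of $\mathcal{O}_\hbar$-modules with reduction $\varphi_s:E_s\to F_s$ modulo $\hbar^{s+1}$, and let $$O=(\hbar^{k+1}\cdot\varphi_s)\circ e_\ell-f_\ell\circ\varphi_k\in Ext^1_{\mathcal{O}_\hbar}(E_k,\hbar^{k+1}\cdot F_s).$$ Then the class $O$ belongs to a canonical subgroup of $Ext^1_{\mathcal{O}_\hbar}(E_k,\hbar^{k+1}\cdot F_s)$ isomorphic to $H^1(M,\mathcal{H}om_{\mathcal{O}_\hbar}(E_s,F_s))$. Suppose that for some $a\in H^1(M,End_{\mathcal{O}_\hbar}(E_s))$ and $b\in H^1(M,End_{\mathcal{O}_\hbar}(F_s))$ one has $$O=b\circ\varphi_s-\varphi_s\circ a\quad\text{in } H^1(M,\mathcal{H}om_{\mathcal{O}_\hbar}(E_s,F_s)).$$ Then there exist order $\ell$ quantizations $E'_\ell$, $F'_\ell$ extending $E_k$, $F_k$ respectively, and a morphism $\varphi_\ell:E'_\ell\to F'_\ell$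 of sheaves of $\mathcal{O}_\hbar$-modules lifting $\varphi_k$. In this case $\varphi_\ell$ is determined uniquely up to an element of $H^0(M,\mathcal{H}om_{\mathcal{O}_\hbar}(E_s,F_s))=Hom_{\mathcal{O}_\hbar}(E_s,F_s)$.
   Context: $M$ is either a smooth algebraic variety of dimension $2n$ over a field $\kappa$ of characteristic $0$ with an algebraic symplectic form $\omega$, or a complex manifold of complex dimension $2n$ with a holomorphic symplectic form $\omega$ (then $\kappa=\mathbb{C}$). Sheaves are in the Zariski, resp. analytic, topology. $\mathcal{O}_\hbar$ is a fixed deformation quantization of $\mathcal{O}_M$ compatible with $\omega$: a sheaf of associative $\kappa[[\hbar]]$-algebras, $\hbar$-torsion free, complete and separated in the $\hbar$-adic topology, with an isomorphism $\mathcal{O}_\hbar/\hbar\mathcal{O}_\hbar\simeq\mathcal{O}_M$, such that $f*g-g*f\equiv\hbar\,\omega(\overline f,\overline g) \pmod{\hbar^2}$ for local sections $f,g$ with images $\overline f,\overline g$ in $\mathcal{O}_M$ (here $\omega(\overline f,\overline g)$ is the Poisson bracket defined by $\omega$). An order $k$ deformation quantization of $E$ ($0\le k<\infty$) is a sheaf $E_k$ of locally free $\mathcal{O}_\hbar/\hbar^{k+1}\mathcal{O}_\hbar$-modules with an isomorphism $E_k/\hbar E_k\simeq E$ of $\mathcal{O}_M$-modules. For $\ell>k$, an order $\ell$ quantization $E_\ell$ extends $E_k$ if an isomorphism $E_\ell/\hbar^{k+1}E_\ell\simeq E_k$ is fixed; a morphism $\varphi_\ell:E_\ell'\to F_\ell'$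 of extensions of $E_k,F_k$ lifts $\varphi_k$ if it reduces to $\varphi_k$ modulo $\hbar^{k+1}$. With $s=\ell-k-1$ (so $0\le s\le k$), $E_k=E_\ell/\hbar^{k+1}E_\ell$ and $E_s=E_\ell/\hbar^{s+1}E_\ell$, the submodule $\hbar^{k+1}E_\ell\subset E_\ell$ is isomorphic to $E_s$ and is written $\hbar^{k+1}\cdot E_s$ (the symbol $\hbar^{k+1}\cdot$ is only a placeholder). The class $e_\ell$ is that of the extension $0\to\hbar^{k+1}\cdot E_s\to E_\ell\to E_k\to0$ of sheaves of $\mathcal{O}_\hbar$-modules; similarly for $f_\ell$. The symbol $\circ$ denotes the Yoneda pairing. Since $s\le k$, $\mathcal{H}om_{\mathcal{O}_\hbar}(E_k,F_s)\simeq\mathcal{H}om_{\mathcal{O}_\hbar}(E_s,F_s)$, and the canonical subgroup is the image of the injective edge map $H^1(M,\mathcal{H}om_{\mathcal{O}_\hbar}(E_s,F_s))\to Ext^1_{\mathcal{O}_\hbar}(E_k,F_s)$ of the local-to-global Ext spectral sequence. *)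

(* Defs.v *)
From HB Require Import structures.
From mathcomp Require Import all_boot all_order all_algebra.
From mathcomp Require Import boolp classical_sets reals topology normedtype derive.
From mathcomp Require Import generic_quotient.
From mathcomp Require mpoly.
Import (canonicals) mpoly.
From mathcomp Require Import complex.

Set Implicit Arguments.
Unset Strict Implicit.
Unset Printing Implicit Defensive.
Import GRing.Theory Num.Theory numFieldNormedType.Exports.
Local Open Scope classical_set_scope.
Local Open Scope ring_scope.

Record opens (M : topologicalType) := Opens { oset :> set M; oset_open : open oset }.

Definition oT (M : topologicalType) : opens M := Opens (@openT M).
Definition oI (M : topologicalType) (U V : opens M) : opens M :=
  Opens (openI (oset_open U) (oset_open V)).

Lemma oIl (M : topologicalType) (U V : opens M) : oI U V `<=` U.
Proof. exact: subIsetl. Qed.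

Lemma oIr (M : topologicalType) (U V : opens M) : oI U V `<=` V.
Proof. exact: subIsetr. Qed.

Section SheafCondition.
Variables (M : topologicalType) (S : opens M -> Type).
Variable res : forall U V : opens M, V `<=` U -> S U -> S V.

Record is_sheaf : Prop := IsSheaf {
  sh_id : forall (U : opens M) (h : U `<=` U) (x : S U), res h x = x;
  sh_comp : forall (U V W : opens M) (hVU : V `<=` U) (hWV : W `<=` V)
    (hWU : W `<=` U) (x : S U), res hWV (res hVU x) = res hWU x;
  sh_sep : forall (I : Type) (U : opens M) (V : I -> opens M)
    (h : forall i, V i `<=` U), U `<=` \bigcup_i V i ->
    forall x y : S U, (forall i, res (h i) x = res (h i) y) -> x = y;
  sh_glue : forall (I : Type) (U : opens M) (V : I -> opens M)
    (h : forall i, V i `<=` U), U `<=` \bigcup_i V i ->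
    forall s : forall i, S (V i),
    (forall (i j : I) (W : opens M) (hi : W `<=` V i) (hj : W `<=` V j),
      res hi (s i) = res hj (s j)) ->
    exists x : S U, forall i, res (h i) x = s i }.

End SheafCondition.

(* Possibly zero rings (pz) are needed since sections over the empty set form
   the zero ring. *)
Record ring_sheaf (M : topologicalType) := RingSheaf {
  rsec :> opens M -> pzRingType;
  rres : forall U V : opens M, V `<=` U -> {rmorphism rsec U -> rsec V};
  rsheafP : @is_sheaf M (fun U => rsec U) (fun U V h => rres h) }.

Record ab_sheaf (M : topologicalType) := AbSheaf {
  asec :> opens M -> zmodType;
  ares : forall U V : opens M, V `<=` U -> {additive asec U -> asec V};
  asheafP : @is_sheaf M (fun U => asec U) (fun U V h => ares h) }.

Record mod_sheaf (M : topologicalType) (A : ring_sheaf M) := ModSheaf {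
  msec :> forall U : opens M, lmodType (A U);
  mres : forall U V : opens M, V `<=` U -> {additive msec U -> msec V};
  mresZ : forall (U V : opens M) (h : V `<=` U) (a : A U) (x : msec U),
    mres h (a *: x) = rres A h a *: mres h x;
  msheafP : @is_sheaf M (fun U => msec U) (fun U V h => mres h) }.

Section ModSheafTheory.
Variables (M : topologicalType) (A : ring_sheaf M) (E : mod_sheaf A).

Lemma mres_id (U : opens M) (h : U `<=` U) (x : E U) : mres E h x = x.
Proof. exact: (sh_id (msheafP E)). Qed.

Lemma mres_comp (U V W : opens M) (hVU : V `<=` U) (hWV : W `<=` V) (hWU : W `<=` U)
  (x : E U) : mres E hWV (mres E hVU x) = mres E hWU x.
Proof. exact: (sh_comp (msheafP E)). Qed.

Lemma mres_sep (I : Type) (U : opens M) (V : I -> opens M) (h : forall i, V i `<=` U) :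
  U `<=` \bigcup_i V i -> forall x y : E U,
  (forall i, mres E (h i) x = mres E (h i) y) -> x = y.
Proof. exact: (sh_sep (msheafP E)). Qed.

Lemma mres_glue (I : Type) (U : opens M) (V : I -> opens M) (h : forall i, V i `<=` U) :
  U `<=` \bigcup_i V i -> forall s : forall i, E (V i),
  (forall (i j : I) (W : opens M) (hi : W `<=` V i) (hj : W `<=` V j),
    mres E hi (s i) = mres E hj (s j)) ->
  exists x : E U, forall i, mres E (h i) x = s i.
Proof. exact: (sh_glue (msheafP E)). Qed.

End ModSheafTheory.

Section Hom.
Variables (M : topologicalType) (A : ring_sheaf M).

(* Sections over W of the sheaf Hom_A(E, F). *)
Record hom_on (E F : mod_sheaf A) (W : opens M) := HomOn {
  happ : forall U : opens M, U `<=` W -> E U -> F U;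
  hlin : forall (U : opens M) (h : U `<=` W), linear (happ h);
  hnat : forall (U V : opens M) (hVU : V `<=` U) (hU : U `<=` W) (hV : V `<=` W)
    (x : E U), mres F hVU (happ hU x) = happ hV (mres E hVU x) }.

Lemma hom_ext (E F : mod_sheaf A) (W : opens M) (f g : hom_on E F W) :
  (forall (U : opens M) (h : U `<=` W) (x : E U), happ f h x = happ g h x) -> f = g.
Proof.
case: f => f f1 f2; case: g => g g1 g2 /= fg.
have efg : f = g by apply: functional_extensionality_dep => U;
  apply: functional_extensionality_dep => h; apply: funext => x; exact: fg.
subst g; congr HomOn; exact: Prop_irrelevance.
Qed.

Section HomZmod.
Variables (E F : mod_sheaf A) (W : opens M).

HB.instance Definition _ := gen_eqMixin (hom_on E F W).
HB.instance Definition _ := gen_choiceMixin (hom_on E F W).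

Program Definition hom0 : hom_on E F W := @HomOn E F W (fun U _ _ => 0) _ _.
Next Obligation. by move=> U h a x y; rewrite scaler0 addr0. Qed.
Next Obligation. by move=> *; rewrite raddf0. Qed.

Program Definition hom_opp (f : hom_on E F W) : hom_on E F W :=
  @HomOn E F W (fun U h x => - happ f h x) _ _.
Next Obligation. by move=> f U h a x y; rewrite hlin opprD scalerN. Qed.
Next Obligation. by move=> f U V hVU hU hV x; rewrite raddfN/= (hnat f hVU hU hV). Qed.

Program Definition hom_add (f g : hom_on E F W) : hom_on E F W :=
  @HomOn E F W (fun U h x => happ f h x + happ g h x) _ _.
Next Obligation. by move=> f g U h a x y; rewrite !hlin scalerDr addrACA. Qed.
Next Obligation.
by move=> f g U V hVU hU hV x; rewrite raddfD/= (hnat f hVU hU hV) (hnat g hVU hU hV).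
Qed.

Lemma hom_addA : associative hom_add.
Proof. by move=> f g k; apply: hom_ext => U h x /=; rewrite addrA. Qed.
Lemma hom_addC : commutative hom_add.
Proof. by move=> f g; apply: hom_ext => U h x /=; rewrite addrC. Qed.
Lemma hom_add0 : left_id hom0 hom_add.
Proof. by move=> f; apply: hom_ext => U h x /=; rewrite add0r. Qed.
Lemma hom_addN : left_inverse hom0 hom_opp hom_add.
Proof. by move=> f; apply: hom_ext => U h x /=; rewrite addNr. Qed.

HB.instance Definition _ :=
  GRing.isZmodule.Build (hom_on E F W) hom_addA hom_addC hom_add0 hom_addN.

End HomZmod.

Program Definition hom_res (E F : mod_sheaf A) (W W' : opens M) (h : W' `<=` W)
    (f : hom_on E F W) : hom_on E F W' :=
  @HomOn E F W' (fun U hU x => happ f (subset_trans hU h) x) _ _.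
Next Obligation. by move=> E F W W' h f U hU a x y; rewrite hlin. Qed.
Next Obligation. by move=> E F W W' h f U V hVU hU hV x; apply: hnat. Qed.

Lemma hom_res_is_zmod (E F : mod_sheaf A) (W W' : opens M) (h : W' `<=` W) :
  zmod_morphism (@hom_res E F W W' h).
Proof. by move=> f g; apply: hom_ext. Qed.

HB.instance Definition _ (E F : mod_sheaf A) (W W' : opens M) (h : W' `<=` W) :=
  GRing.isZmodMorphism.Build _ _ (@hom_res E F W W' h) (@hom_res_is_zmod E F W W' h).

Lemma happ_irr (E F : mod_sheaf A) (W : opens M) (f : hom_on E F W)
  (U : opens M) (h h' : U `<=` W) x : happ f h x = happ f h' x.
Proof. by rewrite (Prop_irrelevance h h'). Qed.

Lemma hom_is_sheaf (E F : mod_sheaf A) :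
  is_sheaf (fun (U V : opens M) (h : V `<=` U) => @hom_res E F U V h).
Proof.
split.
- by move=> U h f; apply: hom_ext => V hV x; apply: (happ_irr f).
- by move=> U V W hVU hWV hWU f; apply: hom_ext => X hX x; apply: (happ_irr f).
- move=> I U V h cov f g fg; apply: hom_ext => W hW x.
  apply: (@mres_sep _ _ F I W (fun i => oI W (V i)) (fun i => @oIl _ W (V i))).
    by move=> t Wt; have [i _ Vt] := cov t (hW t Wt); exists i.
  move=> i; have hi : oI W (V i) `<=` V i := @oIr _ _ _.
  rewrite !(hnat _ _ _ (subset_trans hi (h i))).
  have := congr1 (fun k : hom_on E F (V i) => happ k hi (mres E (@oIl _ W (V i)) x)) (fg i).
  by rewrite /= !(happ_irr _ _ (subset_trans hi (h i))).
- move=> I U V h cov s sC.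
  have sP (i j : I) (W : opens M) (hi : W `<=` V i) (hj : W `<=` V j) (x : E W) :
      happ (s i) hi x = happ (s j) hj x.
    have := congr1 (fun k : hom_on E F W => happ k (@subset_refl _ W) x) (sC i j W hi hj).
    by rewrite /= (happ_irr _ _ hi) (happ_irr (s j) _ hj).
  have gl (W : opens M) (hW : W `<=` U) (x : E W) : {y : F W |
      forall i (X : opens M) (hX : X `<=` W) (hi : X `<=` V i),
        mres F hX y = happ (s i) hi (mres E hX x)}.
    apply: cid.
    have [] := @mres_glue _ _ F I W (fun i => oI W (V i))
      (fun i => @oIl _ W (V i)) _
      (fun i => happ (s i) (@oIr _ W (V i))
                  (mres E (@oIl _ W (V i)) x)).
    + by move=> t Wt; have [i _ Vt] := cov t (hW t Wt); exists i.
    + move=> i j X hi hj /=.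
      rewrite (hnat _ _ _ (subset_trans hi (@oIr _ _ _))).
      rewrite (hnat _ _ _ (subset_trans hj (@oIr _ _ _))).
      rewrite !(@mres_comp _ _ E _ _ _ _ _ (subset_trans hi (@oIl _ _ _))).
      exact: sP.
    + move=> y yP; exists y => i X hX hi.
      have hXI : X `<=` oI W (V i) by move=> t Xt; split; [apply: hX|apply: hi].
      rewrite -(@mres_comp _ _ F _ _ _ (@oIl _ _ _) hXI) yP.
      rewrite (hnat _ _ _ hi).
      by rewrite (@mres_comp _ _ E _ _ _ _ _ hX).
  have glU (W : opens M) (hW : W `<=` U) (x : E W) (y : F W) :
      (forall i (X : opens M) (hX : X `<=` W) (hi : X `<=` V i),
        mres F hX y = happ (s i) hi (mres E hX x)) -> sval (gl W hW x) = y.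
    move=> yP.
    apply: (@mres_sep _ _ F I W (fun i => oI W (V i)) (fun i => @oIl _ W (V i))).
      by move=> t Wt; have [i _ Vt] := cov t (hW t Wt); exists i.
    move=> i; rewrite (yP i _ _ (@oIr _ _ _)).
    exact: (svalP (gl W hW x) i _ _ (@oIr _ _ _)).
  have glin (W : opens M) (hW : W `<=` U) : linear (fun x => sval (gl W hW x)).
    move=> a x y; apply: glU => i X hX hi.
    rewrite raddfD mresZ.
    rewrite (svalP (gl W hW x) i X hX hi) (svalP (gl W hW y) i X hX hi).
    by rewrite raddfD/= mresZ hlin.
  have gnat (W X : opens M) (hXW : X `<=` W) (hW : W `<=` U) (hX : X `<=` U) (x : E W) :
      mres F hXW (sval (gl W hW x)) = sval (gl X hX (mres E hXW x)).
    apply/esym/glU => i Y hY hi.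
    rewrite (@mres_comp _ _ F _ _ _ _ _ (subset_trans hY hXW)).
    rewrite (@mres_comp _ _ E _ _ _ _ _ (subset_trans hY hXW)).
    exact: (svalP (gl W hW x)).
  exists (HomOn glin gnat) => i; apply: hom_ext => W hW x /=.
  have := svalP (gl W (subset_trans hW (h i)) x) i W (@subset_refl _ W) hW.
  by rewrite !mres_id.
Qed.

Definition sheafHom (E F : mod_sheaf A) : ab_sheaf M :=
  @AbSheaf M (fun W => hom_on E F W : zmodType)
    (fun U V h => @hom_res E F U V h : {additive _ -> _}) (@hom_is_sheaf E F).

End Hom.

(* First cohomology of an abelian sheaf, as Cech cohomology: the colimit over
   all open coverings, which may be taken to be indexed by the points of M
   (x being a point of the open set of index x), with refinement x |-> x.
   In degree one this is sheaf cohomology on every topological space. *)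
Section Cech.
Variables (M : topologicalType) (G : ab_sheaf M).

Let acomp (U V W : opens M) (hVU : V `<=` U) (hWV : W `<=` V) (hWU : W `<=` U)
  (x : G U) : ares G hWV (ares G hVU x) = ares G hWU x.
Proof. exact: (sh_comp (asheafP G)). Qed.

Record cocycle1 := Cocycle1 {
  nb : M -> opens M;
  nbP : forall x : M, oset (nb x) x;
  cc : forall x y : M, G (oI (nb x) (nb y));
  ccP : forall (x y z : M) (W : opens M) (hxy : W `<=` oI (nb x) (nb y))
    (hyz : W `<=` oI (nb y) (nb z)) (hxz : W `<=` oI (nb x) (nb z)),
    ares G hxy (cc x y) + ares G hyz (cc y z) = ares G hxz (cc x z) }.

HB.instance Definition _ := gen_eqMixin cocycle1.
HB.instance Definition _ := gen_choiceMixin cocycle1.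

Definition cohomologous (c d : cocycle1) : Prop :=
  exists (P : M -> opens M) (b : forall x : M, G (P x)),
    [/\ forall x : M, oset (P x) x,
        forall x : M, P x `<=` oI (nb c x) (nb d x) &
        forall (x y : M) (W : opens M) (hx : W `<=` P x) (hy : W `<=` P y)
          (hc : W `<=` oI (nb c x) (nb c y)) (hd : W `<=` oI (nb d x) (nb d y)),
          ares G hc (cc c x y) - ares G hd (cc d x y) =
          ares G hy (b y) - ares G hx (b x)].

Lemma cohomologous_refl c : cohomologous c c.
Proof.
exists (nb c), (fun=> 0); split; first exact: nbP.
  by move=> x t; split.
by move=> x y W hx hy hc hd; rewrite (Prop_irrelevance hc hd) !raddf0 subrr addr0.
Qed.

Lemma cohomologous_sym c d : cohomologous c d -> cohomologous d c.
Proof.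
move=> [P [b [P1 P2 P3]]]; exists P, (fun x => - b x); split=> //.
  by move=> x t /P2[].
move=> x y W hx hy hc hd; rewrite -opprB (P3 x y W hx hy) opprB.
by rewrite !(raddfN (ares G _))/= opprK addrC.
Qed.

Lemma cohomologous_trans c d e :
  cohomologous c d -> cohomologous d e -> cohomologous c e.
Proof.
move=> [P [b [P1 P2 P3]]] [Q [b' [Q1 Q2 Q3]]].
exists (fun x => oI (P x) (Q x)),
  (fun x => ares G (@oIl _ (P x) (Q x)) (b x) + ares G (@oIr _ (P x) (Q x)) (b' x)).
split; first by move=> x; split.
  by move=> x t [/P2[? _] /Q2[]].
move=> x y W hx hy hc he.
have hxP := subset_trans hx (@oIl _ _ _); have hyP := subset_trans hy (@oIl _ _ _).
have hxQ := subset_trans hx (@oIr _ _ _); have hyQ := subset_trans hy (@oIr _ _ _).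
have hd : W `<=` oI (nb d x) (nb d y).
  by move=> t Wt; split; [have [_] := P2 x t (hxP _ Wt)|have [_] := P2 y t (hyP _ Wt)].
rewrite !raddfD/= !(acomp _ _ hxP) !(acomp _ _ hyP) !(acomp _ _ hxQ) !(acomp _ _ hyQ).
rewrite -[LHS](subrKA (ares G hd (cc d x y))) (P3 x y W hxP hyP) (Q3 x y W hxQ hyQ).
by rewrite addrACA -opprD.
Qed.

Definition coh_rel : rel cocycle1 := fun c d => `[< cohomologous c d >].

Lemma coh_rel_equiv : equiv_class_of coh_rel.
Proof.
split.
- by move=> c; apply/asboolP/cohomologous_refl.
- by move=> c d; apply/asboolP/asboolP; apply: cohomologous_sym.
- move=> d c e /asboolP cd /asboolP de; apply/asboolP.
  exact: cohomologous_trans cd de.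
Qed.

Canonical coh_equiv := EquivRelPack coh_rel_equiv.

Definition H1 : Type := {eq_quot coh_equiv}%qT.
HB.instance Definition _ := Choice.on H1.
HB.instance Definition _ := EqQuotient.on H1.

Definition H1cl (c : cocycle1) : H1 := (\pi c)%qT.

Lemma H1clP c d : H1cl c = H1cl d <-> cohomologous c d.
Proof.
split=> [/(@eqmodP _ coh_equiv)/asboolP //|h].
by apply/(@eqmodP _ coh_equiv)/asboolP.
Qed.

Lemma H1cl_repr (u : H1) : H1cl (repr u) = u.
Proof. exact: reprK. Qed.

Program Definition cc0 : cocycle1 := @Cocycle1 (fun=> oT M) _ (fun _ _ => 0) _.
Next Obligation. by move=> x. Qed.
Next Obligation. by move=> *; rewrite !raddf0 addr0. Qed.

Program Definition cc_opp (c : cocycle1) : cocycle1 :=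
  @Cocycle1 (nb c) (nbP c) (fun x y => - cc c x y) _.
Next Obligation.
by move=> c x y z W hxy hyz hxz; rewrite !raddfN/= -opprD (ccP hxy hyz hxz).
Qed.

Lemma oI_sub4 (U1 U2 V1 V2 : opens M) : oI (oI U1 V1) (oI U2 V2) `<=` oI U1 U2.
Proof. by move=> t [[? ?] [? ?]]. Qed.

Lemma oI_sub4' (U1 U2 V1 V2 : opens M) : oI (oI U1 V1) (oI U2 V2) `<=` oI V1 V2.
Proof. by move=> t [[? ?] [? ?]]. Qed.

Program Definition cc_add (c d : cocycle1) : cocycle1 :=
  @Cocycle1 (fun x => oI (nb c x) (nb d x)) _
    (fun x y => ares G (@oI_sub4 (nb c x) (nb c y) (nb d x) (nb d y)) (cc c x y) +
                ares G (@oI_sub4' (nb c x) (nb c y) (nb d x) (nb d y)) (cc d x y)) _.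
Next Obligation. by move=> c d x; split; apply: nbP. Qed.
Next Obligation.
move=> c d x y z W hxy hyz hxz; rewrite !raddfD/=.
pose h1 u v (h : W `<=` oI (oI (nb c u) (nb d u)) (oI (nb c v) (nb d v))) :=
  subset_trans h (@oI_sub4 _ _ _ _).
pose h2 u v (h : W `<=` oI (oI (nb c u) (nb d u)) (oI (nb c v) (nb d v))) :=
  subset_trans h (@oI_sub4' _ _ _ _).
rewrite (acomp _ _ (h1 _ _ hxy)) (acomp _ _ (h1 _ _ hyz)) (acomp _ _ (h1 _ _ hxz)).
rewrite (acomp _ _ (h2 _ _ hxy)) (acomp _ _ (h2 _ _ hyz)) (acomp _ _ (h2 _ _ hxz)).
by rewrite addrACA (ccP _ _ (h1 _ _ hxz)) (ccP _ _ (h2 _ _ hxz)).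
Qed.

Lemma cc_add_coh c c' d d' : cohomologous c c' -> cohomologous d d' ->
  cohomologous (cc_add c d) (cc_add c' d').
Proof.
move=> [P [b [P1 P2 P3]]] [Q [b' [Q1 Q2 Q3]]].
exists (fun x => oI (P x) (Q x)),
  (fun x => ares G (@oIl _ (P x) (Q x)) (b x) + ares G (@oIr _ (P x) (Q x)) (b' x)).
split; first by move=> x; split.
  by move=> x t [/P2[? ?] /Q2[? ?]].
move=> x y W hx hy hc hd /=.
have hxP := subset_trans hx (@oIl _ _ _); have hyP := subset_trans hy (@oIl _ _ _).
have hxQ := subset_trans hx (@oIr _ _ _); have hyQ := subset_trans hy (@oIr _ _ _).
rewrite !raddfD/= !(acomp _ _ hxP) !(acomp _ _ hyP) !(acomp _ _ hxQ) !(acomp _ _ hyQ).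
have h1 := subset_trans hc (@oI_sub4 _ _ _ _).
have h2 := subset_trans hc (@oI_sub4' _ _ _ _).
have h3 := subset_trans hd (@oI_sub4 _ _ _ _).
have h4 := subset_trans hd (@oI_sub4' _ _ _ _).
rewrite !(acomp _ _ h1) !(acomp _ _ h2) !(acomp _ _ h3) !(acomp _ _ h4).
rewrite addrACA (P3 x y W hxP hyP) (Q3 x y W hxQ hyQ).
by rewrite addrACA.
Qed.

Lemma cc_opp_coh c c' : cohomologous c c' -> cohomologous (cc_opp c) (cc_opp c').
Proof.
move=> [P [b [P1 P2 P3]]]; exists P, (fun x => - b x); split=> //.
move=> x y W hx hy hc hd; rewrite !(raddfN (ares G _))/= -!opprD.
by rewrite (P3 x y W hx hy).
Qed.

Lemma coh_agree c d :
  (forall (x y : M) (W : opens M) (hc : W `<=` oI (nb c x) (nb c y))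
    (hd : W `<=` oI (nb d x) (nb d y)),
    ares G hc (cc c x y) = ares G hd (cc d x y)) -> cohomologous c d.
Proof.
move=> cd; exists (fun x => oI (nb c x) (nb d x)), (fun=> 0); split; last first.
- by move=> x y W hx hy hc hd; rewrite (cd x y W hc hd) !raddf0 subrr addr0.
- by move=> x; apply: subset_refl.
- by move=> x; split; apply: nbP.
Qed.

Definition H1_add (u v : H1) : H1 := H1cl (cc_add (repr u) (repr v)).
Definition H1_opp (u : H1) : H1 := H1cl (cc_opp (repr u)).

Lemma H1_addE c d : H1_add (H1cl c) (H1cl d) = H1cl (cc_add c d).
Proof. by apply/H1clP/cc_add_coh; apply/H1clP; rewrite H1cl_repr. Qed.

Lemma H1_oppE c : H1_opp (H1cl c) = H1cl (cc_opp c).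
Proof. by apply/H1clP/cc_opp_coh; apply/H1clP; rewrite H1cl_repr. Qed.

Lemma H1_addA : associative H1_add.
Proof.
move=> u v w; rewrite -(H1cl_repr u) -(H1cl_repr v) -(H1cl_repr w) !H1_addE.
apply/H1clP/coh_agree => x y W hc hd /=; rewrite !raddfD/=.
have hu : W `<=` oI (nb (repr u) x) (nb (repr u) y) by move=> t /hc[[? [? ?]] [? [? ?]]].
have hv : W `<=` oI (nb (repr v) x) (nb (repr v) y) by move=> t /hc[[? [? ?]] [? [? ?]]].
have hw : W `<=` oI (nb (repr w) x) (nb (repr w) y) by move=> t /hc[[? [? ?]] [? [? ?]]].
have h1 := subset_trans hc (@oI_sub4' _ _ _ _).
have h2 := subset_trans hd (@oI_sub4 _ _ _ _).
by rewrite !(acomp _ _ h1) !(acomp _ _ h2) !(acomp _ _ hu) !(acomp _ _ hv)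
  !(acomp _ _ hw) addrA.
Qed.

Lemma H1_addC : commutative H1_add.
Proof.
move=> u v; rewrite -(H1cl_repr u) -(H1cl_repr v) !H1_addE.
apply/H1clP/coh_agree => x y W hc hd /=; rewrite !raddfD/=.
have hu : W `<=` oI (nb (repr u) x) (nb (repr u) y) by move=> t /hc[[? ?] [? ?]].
have hv : W `<=` oI (nb (repr v) x) (nb (repr v) y) by move=> t /hc[[? ?] [? ?]].
by rewrite !(acomp _ _ hu) !(acomp _ _ hv) addrC.
Qed.

Lemma H1_add0 : left_id (H1cl cc0) H1_add.
Proof.
move=> u; rewrite -(H1cl_repr u) !H1_addE.
apply/H1clP/coh_agree => x y W hc hd /=.
by rewrite !raddfD/= !raddf0 add0r (acomp _ _ hd).
Qed.

Lemma H1_addN : left_inverse (H1cl cc0) H1_opp H1_add.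
Proof.
move=> u; rewrite -(H1cl_repr u) !(H1_addE, H1_oppE).
apply/H1clP/coh_agree => x y W hc hd /=; rewrite !raddf0.
have hu : W `<=` oI (nb (repr u) x) (nb (repr u) y) by move=> t /hc[[? ?] [? ?]].
by rewrite !raddfD/= !raddfN/= !(acomp _ _ hu) addNr.
Qed.

HB.instance Definition _ := GRing.isZmodule.Build H1 H1_addA H1_addC H1_add0 H1_addN.

End Cech.

Record ab_mor (M : topologicalType) (G H : ab_sheaf M) := AbMor {
  amap :> forall U : opens M, {additive G U -> H U};
  amap_nat : forall (U V : opens M) (h : V `<=` U) (x : G U),
    ares H h (amap U x) = amap V (ares G h x) }.

Program Definition cc_map (M : topologicalType) (G H : ab_sheaf M) (f : ab_mor G H)
    (c : cocycle1 G) : cocycle1 H :=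
  @Cocycle1 M H (nb c) (nbP c) (fun x y => f _ (cc c x y)) _.
Next Obligation.
move=> M G H f c x y z W hxy hyz hxz.
by rewrite !amap_nat -raddfD/= (ccP hxy hyz hxz).
Qed.

Definition H1_map (M : topologicalType) (G H : ab_sheaf M) (f : ab_mor G H)
  (u : H1 G) : H1 H := H1cl (cc_map f (repr u)).

Section HomTheory.
Variables (M : topologicalType) (A : ring_sheaf M).

(* Global homomorphisms: Hom(E, F) is H^0(M, Hom(E, F)) by definition. *)
Definition mor (E F : mod_sheaf A) := hom_on E F (oT M).

Definition mapp (E F : mod_sheaf A) (f : mor E F) (U : opens M) (x : E U) : F U :=
  happ f (@subsetT _ U) x.

Definition mor_on (E F : mod_sheaf A) (f : mor E F) (W : opens M) : hom_on E F W :=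
  hom_res (W := oT M) (@subsetT _ W) f.

Lemma mappD (E F : mod_sheaf A) (f : mor E F) (U : opens M) (x y : E U) :
  mapp f (x + y) = mapp f x + mapp f y.
Proof. by rewrite /mapp -[x]scale1r hlin !scale1r. Qed.

Lemma mapp0 (E F : mod_sheaf A) (f : mor E F) (U : opens M) : mapp f (0 : E U) = 0.
Proof. by apply: (addrI (mapp f 0)); rewrite -mappD !addr0. Qed.

Lemma mappZ (E F : mod_sheaf A) (f : mor E F) (U : opens M) (a : A U) (x : E U) :
  mapp f (a *: x) = a *: mapp f x.
Proof. by rewrite -[a *: x]addr0 /mapp hlin -/(mapp f 0) mapp0 addr0. Qed.

Lemma mappB (E F : mod_sheaf A) (f : mor E F) (U : opens M) (x y : E U) :
  mapp f (x - y) = mapp f x - mapp f y.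
Proof. by rewrite mappD -[- y]scaleN1r mappZ scaleN1r. Qed.

Lemma mapp_nat (E F : mod_sheaf A) (f : mor E F) (U V : opens M) (h : V `<=` U)
  (x : E U) : mres F h (mapp f x) = mapp f (mres E h x).
Proof. exact: hnat. Qed.

Lemma mres_sep_pt (E : mod_sheaf A) (U : opens M) (x y : E U) :
  (forall t, oset U t -> exists (V : opens M) (h : V `<=` U),
     oset V t /\ mres E h x = mres E h y) -> x = y.
Proof.
move=> xy.
pose I := {V : opens M | exists h : V `<=` U, mres E h x = mres E h y}.
have hI (i : I) : sval i `<=` U by case: (svalP i).
apply: (@mres_sep _ _ E I U (fun i => sval i) hI).
  by move=> t /xy[V [h [Vt e]]]; exists (exist _ V (ex_intro _ h e)).
by move=> i; case: (svalP i) => h; rewrite (Prop_irrelevance h (hI i)).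
Qed.

Program Definition hom_id (E : mod_sheaf A) (W : opens M) : hom_on E E W :=
  @HomOn M A E E W (fun U _ x => x) _ _.
Next Obligation. by move=> E W U h a x y. Qed.
Next Obligation. by []. Qed.

Program Definition hom_comp (E F G : mod_sheaf A) (W : opens M)
    (g : hom_on F G W) (f : hom_on E F W) : hom_on E G W :=
  @HomOn M A E G W (fun U h x => happ g h (happ f h x)) _ _.
Next Obligation. by move=> E F G W g f U h a x y; rewrite !hlin. Qed.
Next Obligation.
by move=> E F G W g f U V hVU hU hV x; rewrite (hnat g hVU hU hV) (hnat f hVU hU hV).
Qed.

Lemma happD (E F : mod_sheaf A) (W : opens M) (f : hom_on E F W) (U : opens M)
  (h : U `<=` W) (x y : E U) : happ f h (x + y) = happ f h x + happ f h y.
Proof. by rewrite -[x]scale1r hlin !scale1r. Qed.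

Lemma happN (E F : mod_sheaf A) (W : opens M) (f : hom_on E F W) (U : opens M)
  (h : U `<=` W) (x : E U) : happ f h (- x) = - happ f h x.
Proof.
have h0 : happ f h 0 = 0.
  by apply: (addrI (happ f h 0)); rewrite -happD !addr0.
by apply: (addrI (happ f h x)); rewrite -happD !subrr.
Qed.

Definition postcomp_fun (E F G : mod_sheaf A) (g : mor F G) (W : opens M)
  (f : sheafHom E F W) : sheafHom E G W := hom_comp (mor_on g W) f.

Lemma postcomp_is_zmod (E F G : mod_sheaf A) (g : mor F G) (W : opens M) :
  zmod_morphism (@postcomp_fun E F G g W).
Proof. by move=> f f'; apply: hom_ext => U h x /=; rewrite happD happN. Qed.

HB.instance Definition _ (E F G : mod_sheaf A) (g : mor F G) (W : opens M) :=
  GRing.isZmodMorphism.Build _ _ (@postcomp_fun E F G g W) (postcomp_is_zmod g (W := W)).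

Program Definition postcomp (E F G : mod_sheaf A) (g : mor F G) :
    ab_mor (sheafHom E F) (sheafHom E G) :=
  @AbMor M _ _ (fun W => @postcomp_fun E F G g W : {additive _ -> _}) _.
Next Obligation.
by move=> E F G g U V h f; apply: hom_ext => X hX x /=; apply: happ_irr.
Qed.

Definition precomp_fun (E F G : mod_sheaf A) (f : mor E F) (W : opens M)
  (g : sheafHom F G W) : sheafHom E G W := hom_comp g (mor_on f W).

Lemma precomp_is_zmod (E F G : mod_sheaf A) (f : mor E F) (W : opens M) :
  zmod_morphism (@precomp_fun E F G f W).
Proof. by move=> g g'; apply: hom_ext. Qed.

HB.instance Definition _ (E F G : mod_sheaf A) (f : mor E F) (W : opens M) :=
  GRing.isZmodMorphism.Build _ _ (@precomp_fun E F G f W) (precomp_is_zmod f (W := W)).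

Program Definition precomp (E F G : mod_sheaf A) (f : mor E F) :
    ab_mor (sheafHom F G) (sheafHom E G) :=
  @AbMor M _ _ (fun W => @precomp_fun E F G f W : {additive _ -> _}) _.
Next Obligation.
move=> E F G f U V h g; apply: hom_ext => X hX x /=.
by rewrite (happ_irr f _ (subset_trans hX (@subsetT _ V))).
Qed.

(* Epimorphisms of sheaves. *)
Definition loc_surj (E F : mod_sheaf A) (p : mor E F) : Prop :=
  forall (U : opens M) (y : F U) (t : M), oset U t ->
    exists (V : opens M) (h : V `<=` U) (x : E V), oset V t /\ mapp p x = mres F h y.

Record extension (E F : mod_sheaf A) := Extension {
  xmid : mod_sheaf A;
  xin : mor F xmid;
  xout : mor xmid E;
  xin_inj : forall U : opens M, injective (@mapp _ _ xin U);
  x_exact : forall (U : opens M) (z : xmid U),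
    mapp xout z = 0 <-> exists y : F U, z = mapp xin y;
  xout_surj : loc_surj xout }.

(* Elements of Ext^1(E, F) are isomorphism classes of extensions of E by F,
   represented by predicates on extensions.  The middle map in ext_iso is
   automatically an isomorphism. *)
Definition ext_class (E F : mod_sheaf A) := extension E F -> Prop.

Definition ext_iso (E F : mod_sheaf A) (X Y : extension E F) : Prop :=
  exists t : mor (xmid X) (xmid Y),
    hom_comp t (xin X) = xin Y /\ hom_comp (xout Y) t = xout X.

Definition Ext1_cl (E F : mod_sheaf A) (X : extension E F) : ext_class E F := ext_iso X.

Definition in_Ext1 (E F : mod_sheaf A) (c : ext_class E F) : Prop :=
  exists X : extension E F, c = Ext1_cl X.

(* Yoneda products with morphisms: pushout and pullback of extensions. *)
Definition yoneda_l (E F F' : mod_sheaf A) (f : mor F F') (c : ext_class E F) :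
    ext_class E F' := fun Y =>
  exists2 X : extension E F, c X & exists t : mor (xmid X) (xmid Y),
    hom_comp t (xin X) = hom_comp (xin Y) f /\ hom_comp (xout Y) t = xout X.

Definition yoneda_r (E E' F : mod_sheaf A) (c : ext_class E F) (f : mor E' E) :
    ext_class E' F := fun Y =>
  exists2 X : extension E F, c X & exists t : mor (xmid Y) (xmid X),
    hom_comp t (xin Y) = xin X /\ hom_comp (xout X) t = hom_comp f (xout Y).

(* Baer difference: Z is the pushout, along (u, v) |-> u - v from F + F to F, of
   the fibre product of X and Y over E, i.e. there is a linear map m from this
   fibre product to Z, over E, which is u - v on F + F. *)
Definition baer_diff (E F : mod_sheaf A) (X Y Z : extension E F) : Prop :=
  exists m : forall (U : opens M) (x : xmid X U) (y : xmid Y U),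
      mapp (xout X) x = mapp (xout Y) y -> xmid Z U,
    [/\ forall (U : opens M) (a : A U) x x' y y' h h' h'',
          m U (a *: x + x') (a *: y + y') h'' = a *: m U x y h + m U x' y' h',
        forall (U V : opens M) (hVU : V `<=` U) x y h h',
          mres (xmid Z) hVU (m U x y h) =
          m V (mres (xmid X) hVU x) (mres (xmid Y) hVU y) h',
        forall (U : opens M) x y h, mapp (xout Z) (m U x y h) = mapp (xout X) x &
        forall (U : opens M) (u v : F U) h,
          m U (mapp (xin X) u) (mapp (xin Y) v) h = mapp (xin Z) (u - v)].

Definition ext_sub (E F : mod_sheaf A) (c d : ext_class E F) : ext_class E F :=
  fun Z => exists X Y : extension E F, [/\ c X, d Y & baer_diff X Y Z].

(* Edge map H^1(M, Hom(E, F)) -> Ext^1(E, F) of the local-to-global spectral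
   sequence: the class of a cocycle (z_xy) is sent to the extensions having local
   splittings s_x with s_y - s_x = z_xy. *)
Definition ext_edge (E F : mod_sheaf A) (c : H1 (sheafHom E F)) : ext_class E F :=
  fun X => exists (z : cocycle1 (sheafHom E F))
      (s : forall x : M, hom_on E (xmid X) (nb z x)),
    [/\ H1cl z = c,
        forall x : M, hom_comp (mor_on (xout X) _) (s x) = hom_id E (nb z x) &
        forall (x y : M) (W : opens M) (hx : W `<=` nb z x) (hy : W `<=` nb z y)
          (hxy : W `<=` oI (nb z x) (nb z y)),
          hom_res hy (s y) - hom_res hx (s x) =
          hom_comp (mor_on (xin X) W) (hom_res hxy (cc z x y))].

Program Definition reg_mod : mod_sheaf A :=
  @ModSheaf M A (fun U => (A U)^o) (fun U V h => rres A h : {additive _ -> _}) _ _.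
Next Obligation. by move=> U V h a x /=; rewrite rmorphM. Qed.
Next Obligation. exact: rsheafP. Qed.

(* E is locally isomorphic to (A/J)^r, J being an ideal sheaf of A. *)
Definition loc_free (J : forall U : opens M, A U -> Prop) (E : mod_sheaf A) : Prop :=
  forall t : M, exists (U : opens M) (r : nat) (e : 'I_r -> E U),
  [/\ oset U t,
      forall (V : opens M) (h : V `<=` U) (f : 'I_r -> A V),
        \sum_i f i *: mres E h (e i) = 0 <-> forall i, J V (f i) &
      forall (V : opens M) (h : V `<=` U) (x : E V) (u : M), oset V u ->
        exists (W : opens M) (hWV : W `<=` V) (hWU : W `<=` U) (f : 'I_r -> A W),
          oset W u /\ mres E hWV x = \sum_i f i *: mres E hWU (e i)].

End HomTheory.

Section Algebras.
Variables (M : topologicalType) (K : fieldType) (A : ring_sheaf M).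

Record kalg := KAlg {
  kmap : forall U : opens M, {rmorphism K -> A U};
  kmap_nat : forall (U V : opens M) (h : V `<=` U) (c : K),
    rres A h (kmap U c) = kmap V c }.

(* K[[hbar]]-algebra structure; the series \sum_i a_i hbar^i is encoded by its
   sequence of coefficients a, multiplied by the Cauchy product. *)
Record psalg := PsAlg {
  ps : forall U : opens M, (nat -> K) -> A U;
  psD : forall (U : opens M) (a b : nat -> K), ps U (fun i => a i + b i) = ps U a + ps U b;
  psM : forall (U : opens M) (a b : nat -> K),
    ps U (fun i => \sum_(j < i.+1) a j * b (i - j)%N) = ps U a * ps U b;
  ps1 : forall U : opens M, ps U (fun i => (i == 0%N)%:R) = 1;
  ps_nat : forall (U V : opens M) (h : V `<=` U) (a : nat -> K),
    rres A h (ps U a) = ps V a;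
  ps_central : forall (U : opens M) (a : nat -> K) (x : A U), ps U a * x = x * ps U a }.

Definition hbar (P : psalg) (U : opens M) : A U := ps P U (fun i => (i == 1%N)%:R).

(* x is a section of the subsheaf hbar^m E of E. *)
Definition hdiv (P : psalg) (E : mod_sheaf A) (m : nat) (U : opens M) (x : E U) : Prop :=
  forall t : M, oset U t -> exists (V : opens M) (h : V `<=` U) (y : E V),
    oset V t /\ mres E h x = hbar P V ^+ m *: y.

(* p exhibits F as the quotient sheaf E / hbar^m E. *)
Definition reduction (P : psalg) (m : nat) (E F : mod_sheaf A) (p : mor E F) : Prop :=
  loc_surj p /\ forall (U : opens M) (x : E U), mapp p x = 0 <-> hdiv P m x.

End Algebras.

Section Shift.
Variables (M : topologicalType) (K : fieldType) (A : ring_sheaf M) (P : psalg K A).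
Hypothesis tf : forall (U : opens M) (x : A U), hbar P U * x = 0 -> x = 0.

Lemma hbarX_nat (U V : opens M) (hVU : V `<=` U) m :
  rres A hVU (hbar P U ^+ m) = hbar P V ^+ m.
Proof. by rewrite rmorphXn/= /hbar ps_nat. Qed.

Lemma hbarX_central (U : opens M) m (x : A U) : hbar P U ^+ m * x = x * hbar P U ^+ m.
Proof.
elim: m => [|m IH]; first by rewrite expr0 mul1r mulr1.
by rewrite exprS -mulrA IH !mulrA [hbar P U * x]ps_central.
Qed.

Lemma hbarX_scale (E : mod_sheaf A) (U : opens M) m (a : A U) (x : E U) :
  a *: (hbar P U ^+ m *: x) = hbar P U ^+ m *: (a *: x).
Proof. by rewrite !scalerA hbarX_central. Qed.

Lemma mres_hbarX (E : mod_sheaf A) (U V : opens M) (hVU : V `<=` U) m (x : E U) :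
  mres E hVU (hbar P U ^+ m *: x) = hbar P V ^+ m *: mres E hVU x.
Proof. by rewrite mresZ hbarX_nat. Qed.

Lemma hbarX_tf (U : opens M) m (x : A U) : hbar P U ^+ m * x = 0 -> x = 0.
Proof.
elim: m => [|m IH]; first by rewrite expr0 mul1r.
by rewrite exprS -mulrA => /tf.
Qed.

Variables (l m : nat) (L S : mod_sheaf A) (p : mor L S).
Hypothesis redp : reduction P l p.
Hypothesis killL : forall (U : opens M) (x : L U), hbar P U ^+ (m + l) *: x = 0.

Let rel (U : opens M) (x : S U) (y : L U) : Prop :=
  forall t : M, oset U t -> exists (V : opens M) (hV : V `<=` U) (z : L V),
    [/\ oset V t, mapp p z = mres S hV x & mres L hV y = hbar P V ^+ m *: z].

Let hbar_kill (U : opens M) (z : L U) : mapp p z = 0 -> hbar P U ^+ m *: z = 0.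
Proof.
move/(proj2 redp) => zP; apply: mres_sep_pt => t /zP[V [hV [y [Vt e]]]].
exists V, hV; split=> //; rewrite mres_hbarX e scalerA -exprD killL.
by rewrite raddf0.
Qed.

Let rel_uniq (U : opens M) (x : S U) (y y' : L U) : rel x y -> rel x y' -> y = y'.
Proof.
move=> xy xy'; apply: mres_sep_pt => t Ut.
have [V [hV [z [Vt e1 e2]]]] := xy t Ut; have [V' [hV' [z' [Vt' e1' e2']]]] := xy' t Ut.
have hVI : oI V V' `<=` U := subset_trans (@oIl _ V V') hV.
exists (oI V V'), hVI; split=> //.
rewrite -(mres_comp hV (@oIl _ V V') hVI) -(mres_comp hV' (@oIr _ V V') hVI) e2 e2'.
rewrite !mres_hbarX; apply/eqP; rewrite -subr_eq0 -scalerBr; apply/eqP/hbar_kill.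
rewrite mappB -!mapp_nat e1 e1' (mres_comp _ _ hVI) (mres_comp _ _ hVI).
by rewrite subrr.
Qed.

Let rel_lin (U : opens M) (a : A U) (x x' : S U) (y y' : L U) :
  rel x y -> rel x' y' -> rel (a *: x + x') (a *: y + y').
Proof.
move=> xy xy' t Ut.
have [V [hV [z [Vt e1 e2]]]] := xy t Ut; have [V' [hV' [z' [Vt' e1' e2']]]] := xy' t Ut.
have hVI : oI V V' `<=` U := subset_trans (@oIl _ V V') hV.
exists (oI V V'), hVI, (rres A hVI a *: mres L (@oIl _ V V') z + mres L (@oIr _ V V') z').
split=> //.
  rewrite mappD mappZ -!mapp_nat e1 e1' raddfD/= mresZ.
  by rewrite (mres_comp _ _ hVI) (mres_comp _ _ hVI).
rewrite raddfD/= mresZ -(mres_comp hV (@oIl _ V V') hVI) -(mres_comp hV' (@oIr _ V V') hVI).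
by rewrite e2 e2' !mres_hbarX scalerDr hbarX_scale.
Qed.

Let rel_nat (U V : opens M) (hVU : V `<=` U) (x : S U) (y : L U) :
  rel x y -> rel (mres S hVU x) (mres L hVU y).
Proof.
move=> xy t Vt; have [W [hW [z [Wt e1 e2]]]] := xy t (hVU _ Vt).
exists (oI V W), (@oIl _ V W), (mres L (@oIr _ V W) z).
have hI : oI V W `<=` U := subset_trans (@oIl _ V W) hVU.
split=> //; first by rewrite -mapp_nat e1 (mres_comp _ _ hI) (mres_comp _ _ hI).
by rewrite (mres_comp _ _ hI) -(mres_comp hW (@oIr _ V W) hI) e2 mres_hbarX.
Qed.

Let rel_ex (U : opens M) (x : S U) : exists y : L U, rel x y.
Proof.
pose I := {V : opens M & {z : L V | exists hV : V `<=` U, mapp p z = mres S hV x}}.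
pose V (i : I) := projT1 i; pose z (i : I) : L (V i) := sval (projT2 i).
have hV (i : I) : V i `<=` U by case: (svalP (projT2 i)).
have zP (i : I) : mapp p (z i) = mres S (hV i) x.
  by rewrite /z; case: (svalP (projT2 i)) => hVi; rewrite (Prop_irrelevance hVi (hV i)).
have cov : U `<=` \bigcup_i V i.
  move=> t Ut; have [W [hW [w [Wt e]]]] := proj1 redp U x t Ut.
  by exists (existT _ W (exist _ w (ex_intro _ hW e))).
have [|y yP] := mres_glue hV cov (s := fun i => hbar P (V i) ^+ m *: z i).
  move=> i j W hi hj; rewrite !mres_hbarX.
  apply/eqP; rewrite -subr_eq0 -scalerBr; apply/eqP/hbar_kill.
  rewrite mappB -!mapp_nat !zP.
  have hW := subset_trans hi (hV i).
  by rewrite (mres_comp _ _ hW) (mres_comp _ _ hW) subrr.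
exists y => t Ut; have [i _ Vt] := cov t Ut.
by exists (V i), (hV i), (z i); rewrite -yP.
Qed.

Let shift_fun (U : opens M) (x : S U) : L U := sval (cid (rel_ex x)).

Let shift_rel (U : opens M) (x : S U) : rel x (shift_fun x).
Proof. exact: svalP. Qed.

Program Definition hshift : mor S L :=
  @HomOn M A S L (oT M) (fun U _ x => shift_fun x) _ _.
Next Obligation.
move=> U _ a x y; apply: rel_uniq (@shift_rel _ _) _.
exact: rel_lin (@shift_rel _ _) (@shift_rel _ _).
Qed.
Next Obligation.
move=> U V hVU _ _ x /=; apply: rel_uniq (@shift_rel _ _).
exact: rel_nat (@shift_rel _ _).
Qed.

Lemma hshiftP (U : opens M) (z : L U) : mapp hshift (mapp p z) = hbar P U ^+ m *: z.
Proof.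
apply: rel_uniq (@shift_rel _ _) _ => t Ut.
by exists U, (@subset_refl _ U), z; rewrite !mres_id.
Qed.

Lemma hshift_inj :
  (forall (U : opens M) (z : L U), hbar P U ^+ m *: z = 0 -> hdiv P l z) ->
  forall U : opens M, injective (@mapp _ _ _ _ hshift U).
Proof.
move=> kerL U x y /eqP; rewrite -subr_eq0 -mappB => /eqP e.
apply/eqP; rewrite -subr_eq0; apply/eqP; set w := x - y in e *.
apply: mres_sep_pt => t Ut; have [V [hV [z [Vt e']]]] := proj1 redp U w t Ut.
exists V, hV; split=> //; rewrite raddf0 -e'; apply/(proj2 redp)/kerL.
by rewrite -hshiftP e' -mapp_nat e raddf0.
Qed.

Lemma hshift_exact (Q : mod_sheaf A) (q : mor L Q) : reduction P m q ->
  (forall (U : opens M) (z : L U), hbar P U ^+ m *: z = 0 -> hdiv P l z) ->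
  forall (U : opens M) (z : L U),
    mapp q z = 0 <-> exists y : S U, z = mapp hshift y.
Proof.
move=> redq kerL U z; split=> [/(proj2 redq) zP|[y ->]]; last first.
  apply: mres_sep_pt => t Ut; have [V [hV [x [Vt e]]]] := proj1 redp U y t Ut.
  exists V, hV; split=> //; rewrite !mapp_nat -e hshiftP raddf0.
  apply/(proj2 redq) => u Vu; exists V, (@subset_refl _ V), x; split=> //.
  by rewrite mres_id.
pose I := {V : opens M & {w : L V | exists hV : V `<=` U,
                            mres L hV z = hbar P V ^+ m *: w}}.
pose V (i : I) := projT1 i; pose w (i : I) : L (V i) := sval (projT2 i).
have hV (i : I) : V i `<=` U by case: (svalP (projT2 i)).
have wP (i : I) : mres L (hV i) z = hbar P (V i) ^+ m *: w i.
  by rewrite /w; case: (svalP (projT2 i)) => hVi; rewrite (Prop_irrelevance hVi (hV i)).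
have cov : U `<=` \bigcup_i V i.
  move=> t Ut; have [W [hW [x [Wt e]]]] := zP t Ut.
  by exists (existT _ W (exist _ x (ex_intro _ hW e))).
have [|y yP] := mres_glue hV cov (s := fun i => mapp p (w i)).
  move=> i j W hi hj; apply: (hshift_inj kerL); rewrite -!mapp_nat !hshiftP -!wP.
  by rewrite (mres_comp _ _ (subset_trans hi (hV i))) (mres_comp _ _ (subset_trans hi (hV i))).
exists y; apply: (@mres_sep _ _ L I U V hV cov) => i.
by rewrite wP mapp_nat yP hshiftP.
Qed.

End Shift.

Section FreeTorsion.
Variables (M : topologicalType) (K : fieldType) (A : ring_sheaf M) (P : psalg K A).
Hypothesis tf : forall (U : opens M) (x : A U), hbar P U * x = 0 -> x = 0.
Variables (l m : nat) (L : mod_sheaf A).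
Hypothesis freeL : loc_free (fun U (f : A U) => hdiv P (E := reg_mod A) (m + l) (U := U) f) L.

Lemma loc_free_kill (U : opens M) (x : L U) : hbar P U ^+ (m + l) *: x = 0.
Proof.
apply: mres_sep_pt => t Ut; have [V [r [e [Vt eI eG]]]] := freeL t.
have [W [hWV [hWU [f [Wt xE]]]]] :=
  eG (oI U V) (@oIr _ U V) (mres L (@oIl _ U V) x) t (conj Ut Vt).
have hW := subset_trans hWV (@oIl _ U V).
exists W, hW; split=> //; rewrite raddf0 mres_hbarX -(mres_comp (@oIl _ U V) hWV hW) xE.
rewrite scaler_sumr; under eq_bigr => i _ do rewrite scalerA.
apply/eI => i u Wu; exists W, (@subset_refl _ W), (f i); split=> //.
by rewrite mres_id.
Qed.

Lemma loc_free_ker (U : opens M) (x : L U) : hbar P U ^+ m *: x = 0 -> hdiv P l x.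
Proof.
move=> x0 t Ut; have [V [r [e [Vt eI eG]]]] := freeL t.
have [W [hWV [hWU [f [Wt xE]]]]] :=
  eG (oI U V) (@oIr _ U V) (mres L (@oIl _ U V) x) t (conj Ut Vt).
have hW := subset_trans hWV (@oIl _ U V).
have xE' : mres L hW x = \sum_i f i *: mres L hWU (e i).
  by rewrite -xE (mres_comp _ _ hW).
have : \sum_i (hbar P W ^+ m * f i) *: mres L hWU (e i) = 0.
  under eq_bigr => i _ do rewrite -scalerA.
  by rewrite -scaler_sumr -xE' -mres_hbarX x0 raddf0.
move/eI => fP.
have gP (i : 'I_r) : exists (X : opens M) (hX : X `<=` W) (g : A X),
    oset X t /\ rres A hX (f i) = hbar P X ^+ l * g.
  have [X [hX [g [Xt e']]]] := fP i t Wt; exists X, hX, g; split=> //.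
  apply/eqP; rewrite -subr_eq0; apply/eqP/(@hbarX_tf _ _ _ _ tf _ m).
  rewrite mulrBr mulrA -exprD; apply/eqP; rewrite subr_eq0; apply/eqP.
  rewrite -(hbarX_nat P hX m) -rmorphM; exact: e'.
have [X [hX [g [Xt gE]]]] : exists (X : opens M) (hX : X `<=` W) (g : 'I_r -> A X),
    oset X t /\ forall i, rres A hX (f i) = hbar P X ^+ l * g i.
  pose X i := sval (cid (gP i)).
  have XP i := svalP (cid (gP i)); rewrite -/(X _) in XP.
  pose X' (j : nat) : opens M := if insub j is Some i then X i else oT M.
  have oX : open (\bigcap_(j < r) X' j `&` W).
    apply: openI; last exact: oset_open.
    rewrite bigcap_mkord; elim/big_ind: _ => [|? ?|i _]; last exact: oset_open.
      exact: openT.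
    exact: openI.
  pose Y := Opens oX; have hYX i : Y `<=` X i.
    by move=> u [/(_ i (ltn_ord i))]; rewrite /X' valK.
  have hYW : Y `<=` W by move=> u [].
  have Yt : oset Y t.
    split=> // j _; rewrite /X'; case: insubP => // i _ _.
    by have [? [? []]] := XP i.
  have YP i : exists g : A Y, rres A hYW (f i) = hbar P Y ^+ l * g.
    have [hX [g [_ e']]] := XP i; exists (rres A (hYX i) g).
    rewrite -(hbarX_nat P (hYX i) l) -rmorphM/= -e'.
    by rewrite (sh_comp (rsheafP A)).
  exists Y, hYW, (fun i => sval (cid (YP i))); split=> // i.
  exact: svalP (cid (YP i)).
have hXU := subset_trans hX hW.
exists X, hXU, (\sum_i g i *: mres L (subset_trans hX hWU) (e i)); split=> //.
rewrite -(mres_comp hW hX hXU) xE' raddf_sum/= scaler_sumr; apply: eq_bigr => i _.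
by rewrite mresZ (mres_comp _ _ (subset_trans hX hWU)) gE scalerA.
Qed.

End FreeTorsion.

(* Vector fields are derivations of the structure sheaf O, and 2-forms are
   alternating O-bilinear forms on vector fields; for smooth varieties in
   characteristic 0 and for complex manifolds these are the usual notions. *)
Section Symplectic.
Variables (M : topologicalType) (K : fieldType) (O : ring_sheaf M) (KO : kalg K O).

Record vfield (U : opens M) := VField {
  vapp : forall V : opens M, V `<=` U -> O V -> O V;
  vappD : forall (V : opens M) (h : V `<=` U) (x y : O V),
    vapp h (x + y) = vapp h x + vapp h y;
  vapp_K : forall (V : opens M) (h : V `<=` U) (c : K), vapp h (kmap KO V c) = 0;
  vappM : forall (V : opens M) (h : V `<=` U) (x y : O V),
    vapp h (x * y) = vapp h x * y + x * vapp h y;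
  vapp_nat : forall (V W : opens M) (hWV : W `<=` V) (hV : V `<=` U) (hW : W `<=` U)
    (x : O V), rres O hWV (vapp hV x) = vapp hW (rres O hWV x) }.

Program Definition vf_res (U V : opens M) (h : V `<=` U) (D : vfield U) : vfield V :=
  @VField V (fun W hW x => vapp D (subset_trans hW h) x) _ _ _ _.
Next Obligation. by move=> U V h D W hW x y; apply: vappD. Qed.
Next Obligation. by move=> U V h D W hW c; apply: vapp_K. Qed.
Next Obligation. by move=> U V h D W hW x y; apply: vappM. Qed.
Next Obligation. by move=> U V h D W W' hWW hV hW x; apply: vapp_nat. Qed.

Definition vderiv (U : opens M) (D : vfield U) (f : O U) : O U :=
  vapp D (@subset_refl _ U) f.

(* D = a D1 + D2 *)
Definition vf_lincomb (U : opens M) (a : O U) (D1 D2 D : vfield U) : Prop :=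
  forall (V : opens M) (h : V `<=` U) (x : O V),
    vapp D h x = rres O h a * vapp D1 h x + vapp D2 h x.

(* D = [D1, D2] *)
Definition vf_bracket (U : opens M) (D1 D2 D : vfield U) : Prop :=
  forall (V : opens M) (h : V `<=` U) (x : O V),
    vapp D h x = vapp D1 h (vapp D2 h x) - vapp D2 h (vapp D1 h x).

Record two_form := TwoForm {
  tform :> forall U : opens M, vfield U -> vfield U -> O U;
  tform_lin : forall (U : opens M) (a : O U) (D1 D2 D E : vfield U),
    vf_lincomb a D1 D2 D -> tform D E = a * tform D1 E + tform D2 E;
  tform_alt : forall (U : opens M) (D : vfield U), tform D D = 0;
  tform_nat : forall (U V : opens M) (h : V `<=` U) (D E : vfield U),
    rres O h (tform D E) = tform (vf_res h D) (vf_res h E) }.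

Record covector (U : opens M) := Covector {
  cvapp : forall V : opens M, V `<=` U -> vfield V -> O V;
  cv_lin : forall (V : opens M) (h : V `<=` U) (a : O V) (D1 D2 D : vfield V),
    vf_lincomb a D1 D2 D -> cvapp h D = a * cvapp h D1 + cvapp h D2;
  cv_nat : forall (V W : opens M) (hWV : W `<=` V) (hV : V `<=` U) (hW : W `<=` U)
    (D : vfield V), rres O hWV (cvapp hV D) = cvapp hW (vf_res hWV D) }.

Definition closed_form (w : two_form) : Prop :=
  forall (U : opens M) (D1 D2 D3 D12 D13 D23 : vfield U),
    vf_bracket D1 D2 D12 -> vf_bracket D1 D3 D13 -> vf_bracket D2 D3 D23 ->
    vderiv D1 (w U D2 D3) - vderiv D2 (w U D1 D3) + vderiv D3 (w U D1 D2)
    - w U D12 D3 + w U D13 D2 - w U D23 D1 = 0.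

Definition nondegenerate (w : two_form) : Prop :=
  forall (U : opens M) (l : covector U), exists! D : vfield U,
    forall (V : opens M) (h : V `<=` U) (E : vfield V),
      w V (vf_res h D) E = cvapp l h E.

Definition symplectic (w : two_form) : Prop := closed_form w /\ nondegenerate w.

(* D is the Hamiltonian vector field of f: w(D, -) = df. *)
Definition hamiltonian (w : two_form) (U : opens M) (f : O U) (D : vfield U) : Prop :=
  forall (V : opens M) (h : V `<=` U) (E : vfield V),
    w V (vf_res h D) E = vderiv E (rres O h f).

(* c is the Poisson bracket {f, g}; the sign convention chosen for Hamiltonian
   vector fields does not affect it. *)
Definition poisson (w : two_form) (U : opens M) (f g c : O U) : Prop :=
  exists D E : vfield U, [/\ hamiltonian w f D, hamiltonian w g E & c = w U D E].

End Symplectic.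

Section Varieties.
Variables (M : topologicalType) (K : fieldType) (O : ring_sheaf M) (KO : kalg K O).

Definition commutative_sheaf : Prop := forall (U : opens M) (x y : O U), x * y = y * x.

(* The germ of f at t is invertible. *)
Definition inv_at (U : opens M) (f : O U) (t : M) : Prop :=
  exists (V : opens M) (h : V `<=` U) (g : O V), oset V t /\ rres O h f * g = 1.

Definition locally_ringed : Prop :=
  forall (U : opens M) (t : M), oset U t ->
    ~ inv_at (0 : O U) t /\
    forall f g : O U, inv_at (f + g) t -> inv_at f t \/ inv_at g t.

Definition prime_ideal (R : pzRingType) (I : R -> Prop) : Prop :=
  [/\ I 0, forall x y, I x -> I y -> I (x + y), forall a x, I x -> I (a * x),
      ~ I 1 & forall x y, I (x * y) -> I x \/ I y].

(* (U, O|U) is the spectrum of O(U): points of U are the prime ideals of O(U), the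
   non-vanishing loci D(f) form a basis of the topology of U, and O(D(f)) is the
   localization of O(U) at f. *)
Definition affine (U : opens M) : Prop :=
  [/\ forall I : O U -> Prop, prime_ideal I ->
        exists! t : M, oset U t /\ forall f : O U, I f <-> ~ inv_at f t,
      forall (V : opens M) (t : M), V `<=` U -> oset V t ->
        exists f : O U, inv_at f t /\ forall u : M, oset U u -> inv_at f u -> oset V u &
      forall (f : O U) (V : opens M) (h : V `<=` U),
        (forall u : M, oset V u <-> oset U u /\ inv_at f u) ->
        (forall a : O U, rres O h a = 0 -> exists m : nat, f ^+ m * a = 0) /\
        (forall b : O V, exists (m : nat) (a : O U), rres O h (f ^+ m) * b = rres O h a)].

Definition peval (U : opens M) (N : nat) (t : 'I_N -> O U) (p : mpoly.mpoly N K) : O U :=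
  \sum_(m <- mpoly.msupp p)
    kmap KO U (mpoly.mcoeff m p) * \prod_(i < N) t i ^+ mpoly.fun_of_multinom m i.

(* O(U) = K[x_1, ..., x_(c+d)] / (f_1, ..., f_c) with invertible Jacobian minor
   det (df_i / dx_j)_(i, j <= c): a standard smooth algebra of relative dimension d. *)
Definition standard_smooth (d : nat) (U : opens M) : Prop :=
  exists (c : nat) (f : 'I_c -> mpoly.mpoly (c + d) K) (t : 'I_(c + d) -> O U),
  [/\ forall a : O U, exists p, peval t p = a,
      forall p, peval t p = 0 <->
        exists g : 'I_c -> mpoly.mpoly (c + d) K, p = \sum_i g i * f i &
      exists a : O U,
        \det (\matrix_(i < c, j < c) peval t (mpoly.mderiv (lshift d j) (f i))) * a = 1].

Definition separated_scheme : Prop :=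
  forall U V : opens M, affine U -> affine V ->
    affine (oI U V) /\
    forall a : O (oI U V), exists (m : nat) (b : 'I_m -> O U) (c : 'I_m -> O V),
      a = \sum_i rres O (@oIl _ U V) (b i) * rres O (@oIr _ U V) (c i).

(* Separated scheme of finite type over K, smooth of dimension d. *)
Definition smooth_variety (d : nat) : Prop :=
  [/\ commutative_sheaf, locally_ringed,
      forall t : M, exists U : opens M, [/\ oset U t, affine U & standard_smooth d U],
      compact [set: M] & separated_scheme].

End Varieties.

Section ComplexManifolds.
Variables (M : topologicalType) (C : numFieldType) (O : ring_sheaf M) (KO : kalg C O).

(* phi is a chart on U: an open embedding of U in C^d, and val identifies O|U with
   the sheaf of functions that are holomorphic in this chart. *)
Definition holomorphic_chart (d : nat) (U : opens M) (phi : M -> 'rV[C]_d)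
    (val : forall W : opens M, W `<=` U -> O W -> M -> C) : Prop :=
  [/\ forall t u : M, oset U t -> oset U u -> phi t = phi u -> t = u,
      forall B : set 'rV[C]_d, open B -> open (U `&` phi @^-1` B) &
      forall W : opens M, W `<=` U -> open (phi @` W)] /\
  [/\ forall (W : opens M) (h : W `<=` U) (c : C) (t : M), oset W t ->
        val W h (kmap KO W c) t = c,
      forall (W : opens M) (h : W `<=` U) (a b : O W) (t : M), oset W t ->
        val W h (a + b) t = val W h a t + val W h b t /\
        val W h (a * b) t = val W h a t * val W h b t,
      forall (W W' : opens M) (hW : W' `<=` W) (h : W `<=` U) (h' : W' `<=` U) (a : O W)
        (t : M), oset W' t -> val W' h' (rres O hW a) t = val W h a t,
      forall (W : opens M) (h : W `<=` U) (a b : O W),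
        (forall t, oset W t -> val W h a t = val W h b t) -> a = b &
      forall (W : opens M) (h : W `<=` U) (g : M -> C),
        (exists a : O W, forall t, oset W t -> val W h a t = g t) <->
        exists G : 'rV[C]_d -> C, (forall t, oset W t -> g t = G (phi t)) /\
          forall z, (phi @` W) z -> differentiable G z].

Definition complex_manifold (d : nat) : Prop :=
  [/\ hausdorff_space M, @second_countable M &
      forall t : M, exists (U : opens M) (phi : M -> 'rV[C]_d)
        (val : forall W : opens M, W `<=` U -> O W -> M -> C),
        oset U t /\ holomorphic_chart phi val].

End ComplexManifolds.

(* The two geometric settings, in dimension d. *)
Inductive geometric (M : topologicalType) (d : nat) :
    forall (K : fieldType) (O : ring_sheaf M), kalg K O -> Prop :=
| Algebraic (K : fieldType) (O : ring_sheaf M) (KO : kalg K O) :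
    [pchar K] =i pred0 -> smooth_variety KO d -> geometric d KO
| Analytic (R : realType) (O : ring_sheaf M) (KO : kalg (R[i] : fieldType) O) :
    complex_manifold (C := R[i]) KO d -> geometric d KO.

Section Quantizations.
Variables (M : topologicalType) (K : fieldType) (O : ring_sheaf M) (KO : kalg K O).
Variable w : two_form KO.

Record def_quant := DefQuant {
  dq :> ring_sheaf M;
  dq_ps : psalg K dq;
  dq_tf : forall (U : opens M) (x : dq U), hbar dq_ps U * x = 0 -> x = 0;
  dq_separated : forall (U : opens M) (x : dq U),
    (forall m : nat, hdiv dq_ps (E := reg_mod dq) m x) -> x = 0;
  (* Surjectivity onto the inverse limit of the sheaves dq / hbar^m: the section of
     dq / hbar^m over U is given by local representatives a m t on N m t. *)
  dq_complete : forall (U : opens M) (N : nat -> M -> opens M)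
    (a : forall (m : nat) (t : M), dq (N m t)),
    (forall m t, N m t `<=` U) -> (forall m t, oset U t -> oset (N m t) t) ->
    (forall (m n : nat) (t u : M) (W : opens M) (ht : W `<=` N m t) (hu : W `<=` N n u),
       (m <= n)%N ->
       hdiv dq_ps (E := reg_mod dq) m (rres dq ht (a m t) - rres dq hu (a n u))) ->
    exists x : dq U, forall (m : nat) (t : M) (h : N m t `<=` U),
      hdiv dq_ps (E := reg_mod dq) m (rres dq h x - a m t);
  dq_red : forall U : opens M, {rmorphism dq U -> O U};
  dq_red_nat : forall (U V : opens M) (h : V `<=` U) (x : dq U),
    rres O h (dq_red U x) = dq_red V (rres dq h x);
  dq_red_ps : forall (U : opens M) (a : nat -> K),
    dq_red U (ps dq_ps U a) = kmap KO U (a 0%N);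
  dq_red_surj : forall (U : opens M) (y : O U) (t : M), oset U t ->
    exists (V : opens M) (h : V `<=` U) (x : dq V),
      oset V t /\ dq_red V x = rres O h y;
  dq_red_ker : forall (U : opens M) (x : dq U),
    dq_red U x = 0 <-> hdiv dq_ps (E := reg_mod dq) 1 x;
  dq_poisson : forall (U : opens M) (f g c : dq U),
    poisson w (dq_red U f) (dq_red U g) (dq_red U c) ->
    hdiv dq_ps (E := reg_mod dq) 2 (f * g - g * f - hbar dq_ps U * c) }.

Definition loc_free_O (E : mod_sheaf O) : Prop := loc_free (fun U (f : O U) => f = 0) E.

Variable A : def_quant.

Definition hdivA (m : nat) (U : opens M) (x : A U) : Prop :=
  hdiv (dq_ps A) (E := reg_mod A) m x.

(* Order n quantizations of E; being locally free over A / hbar^(n+1) entails being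
   annihilated by hbar^(n+1). *)
Record quantization (E : mod_sheaf O) (n : nat) := Quantization {
  qmod :> mod_sheaf A;
  q_free : loc_free (fun U (f : A U) => hdivA n.+1 f) qmod;
  q_red : forall U : opens M, {additive qmod U -> E U};
  q_red_nat : forall (U V : opens M) (h : V `<=` U) (x : qmod U),
    mres E h (q_red U x) = q_red V (mres qmod h x);
  q_redZ : forall (U : opens M) (a : A U) (x : qmod U),
    q_red U (a *: x) = dq_red A U a *: q_red U x;
  q_red_surj : forall (U : opens M) (y : E U) (t : M), oset U t ->
    exists (V : opens M) (h : V `<=` U) (x : qmod V),
      oset V t /\ q_red V x = mres E h y;
  q_red_ker : forall (U : opens M) (x : qmod U),
    q_red U x = 0 <-> hdiv (dq_ps A) 1 x }.

(* The order l quantization El extends the order n quantization En: an isomorphism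
   El / hbar^(n+1) El = En, compatible with the identifications with E modulo hbar. *)
Record extends (E : mod_sheaf O) (l n : nat) (El : quantization E l)
    (En : quantization E n) := Extends {
  ext_red :> mor El En;
  ext_redP : reduction (dq_ps A) n.+1 ext_red;
  ext_red_E : forall (U : opens M) (x : El U),
    q_red En U (mapp ext_red x) = q_red El U x }.

Section ExtensionClass.
Variables (E : mod_sheaf O) (l n s : nat).
Variables (El : quantization E l) (En : quantization E n) (Es : quantization E s).
Variables (pn : extends El En) (rs : extends En Es).

Definition red_comp : mor El Es := hom_comp (ext_red rs) (ext_red pn).

Lemma red_compP : (s <= n)%N -> reduction (dq_ps A) s.+1 red_comp.
Proof.
move=> sn; have [surjn kern] := ext_redP pn; have [surjs kers] := ext_redP rs.
split=> [U y t Ut|U x].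
  have [V [hV [z [Vt e]]]] := surjs U y t Ut.
  have [W [hW [x [Wt e']]]] := surjn V z t Vt.
  exists W, (subset_trans hW hV), x; split=> //.
  by rewrite -[LHS]/(mapp (ext_red rs) (mapp (ext_red pn) x)) e' -mapp_nat e (mres_comp _ _ (subset_trans hW hV)).
rewrite -[mapp red_comp x]/(mapp (ext_red rs) (mapp (ext_red pn) x)).
split=> [/kers xP t Ut|xP]; last first.
  apply/kers => t /xP[V [hV [y [Vt e]]]]; exists V, hV, (mapp (ext_red pn) y).
  by split=> //; rewrite mapp_nat e mappZ.
have [V [hV [y [Vt e]]]] := xP t Ut.
have [W [hW [z [Wt e']]]] := surjn V y t Vt.
have hWU := subset_trans hW hV.
have : mapp (ext_red pn) (mres El hWU x - hbar (dq_ps A) W ^+ s.+1 *: z) = 0.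
  rewrite mappB mappZ e' -mapp_nat -(mres_comp hV hW hWU) e mres_hbarX.
  by rewrite subrr.
move/kern => /(_ t Wt)[X [hX [u [Xt e'']]]].
have hXU := subset_trans hX hWU.
exists X, hXU, (mres El hX z + hbar (dq_ps A) X ^+ (n - s) *: u); split=> //.
rewrite scalerDr scalerA -exprD addSn subnKC// -e'' raddfB/= mres_hbarX.
by rewrite (mres_comp _ _ hXU) addrC subrK.
Qed.

Hypothesis hl : (n.+1 + s.+1 = l.+1)%N.
Hypothesis sn : (s <= n)%N.

Lemma q_free_shift :
  loc_free (fun U (f : A U) => hdiv (dq_ps A) (E := reg_mod A) (n.+1 + s.+1) f) El.
Proof. by rewrite hl; apply: q_free. Qed.

(* hbar^(n+1) : E_s -> E_l, the isomorphism onto hbar^(n+1) E_l. *)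
Definition hbar_incl : mor Es El :=
  hshift (red_compP sn) (loc_free_kill q_free_shift).

Lemma hbar_inclP (U : opens M) (x : El U) :
  mapp hbar_incl (mapp red_comp x) = hbar (dq_ps A) U ^+ n.+1 *: x.
Proof. exact: hshiftP. Qed.

Lemma hbar_incl_inj (U : opens M) : injective (@mapp _ _ _ _ hbar_incl U).
Proof.
move: U; apply: hshift_inj.
exact: (loc_free_ker (@dq_tf A) q_free_shift).
Qed.

Lemma hbar_incl_exact (U : opens M) (z : El U) :
  mapp (ext_red pn) z = 0 <-> exists y : Es U, z = mapp hbar_incl y.
Proof.
apply: hshift_exact (ext_redP pn) _ U z.
exact: (loc_free_ker (@dq_tf A) q_free_shift).
Qed.

(* 0 -> E_s -> E_l -> E_n -> 0 *)
Definition quant_extension : extension En Es :=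
  Extension hbar_incl_inj hbar_incl_exact (proj1 (ext_redP pn)).

End ExtensionClass.

End Quantizations.

Lemma order_eq (k l s : nat) : (k.+1 <= l <= (2 * k).+1)%N -> s = (l - k.+1)%N ->
  (k.+1 + s.+1 = l.+1)%N.
Proof. by move=> /andP[kl _] ->; rewrite addnS subnKC. Qed.

Lemma order_le (k l s : nat) : (k.+1 <= l <= (2 * k).+1)%N -> s = (l - k.+1)%N ->
  (s <= k)%N.
Proof. by move=> /andP[_ lk] ->; rewrite leq_subLR addSn addnn -mul2n. Qed.

(* Main.v *)
(* A lifting of phi_k exists locally because E_l is locally free; two local liftings g_t, g_u
   differ by a section c_tu of Hom(E_s, F_s), and the class of the cocycle c is the obstruction O.
   Indeed g_t identifies, over its domain, the pushout of e_l along phi_s with the pullback of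
   f_l along phi_k, and the Baer difference of two extensions identified locally, with gluing
   defect c, is the locally split extension defined by c.  If c = b phi_s - phi_s a + d(beta),
   then the maps g_t + beta_t glue to a morphism from E_l twisted by -a to F_l twisted by -b.
   All extensions needed are obtained from one construction: the sections of the pullback of an
   extension G of B by F along phi : E -> B, twisted by a cocycle c of Hom(E, F), are the pairs
   of e in E and of local sections v_t of G over phi(e) such that v_u - v_t = c_tu(e). *)
Require Import Defs.
From HB Require Import structures.
From mathcomp Require Import all_boot all_order all_algebra.
From mathcomp Require Import boolp classical_sets reals topology normedtype derive.

Set Implicit Arguments.
Unset Strict Implicit.
Unset Printing Implicit Defensive.
Import GRing.Theory.
Local Open Scope classical_set_scope.
Local Open Scope ring_scope.

(** * Gluing of sections and homomorphisms *)

(** Epimorphisms of sheaves are surjective only locally, and classes in Ext^1 are predicates on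
    actual extensions, so maps must come from local data and equalities of classes from explicit
    extensions. Maps are therefore mostly given by fragments of their graphs: a relation that is
    linear, stable under restriction, single-valued and locally total determines a homomorphism.
    Additive cocycles suffice for twisting: copies of the pullback are glued by (e, v) -> (e, v +
    i(c_tu(e))), and these automorphisms compose additively since they fix e. For E_l they are the
    identity modulo hbar^(k+1), so the twist is still locally E_l and still reduces to E_k. A
    cocycle of End(E_s) acts through the reduction E_k -> E_s, available as s <= k. A pushout would
    ordinarily be a quotient sheaf. Here the local liftings g_t realize it as a twist of the
    pullback, so no sheafification occurs. *)

Lemma subrACA (V : zmodType) (x y z t : V) : (x - y) - (z - t) = (x - z) - (y - t).
Proof. by rewrite !opprD !opprK addrACA. Qed.

Section Gluing.
Variables (M : topologicalType) (A : ring_sheaf M).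

(** The cover consists of all pairs of an open set and a related section, so none has to be chosen.
    As [R] need not be a local condition, only the restrictions of [y] are asserted, not [R U y]. *)
Lemma glue_rel (F : mod_sheaf A) (U : opens M) (R : forall V : opens M, F V -> Prop) :
  (forall (V W : opens M) (h : W `<=` V) (y : F V),
     V `<=` U -> R V y -> R W (mres F h y)) ->
  (forall (V : opens M) (y y' : F V), V `<=` U -> R V y -> R V y' -> y = y') ->
  (forall t, oset U t -> exists (V : opens M) (y : F V), [/\ V `<=` U, oset V t & R V y]) ->
  exists y : F U, forall (V : opens M) (h : V `<=` U) (z : F V), R V z -> mres F h y = z.
Proof.
move=> Rnat Runiq Rex.
pose I := {V : opens M & {y : F V | V `<=` U /\ R V y}}.
pose V (i : I) := projT1 i; pose s (i : I) : F (V i) := sval (projT2 i).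
have hV (i : I) : V i `<=` U by case: (svalP (projT2 i)).
have sP (i : I) : R (V i) (s i) by case: (svalP (projT2 i)).
have cov : U `<=` \bigcup_i V i.
  by move=> t /Rex[W [y [hW Wt Ry]]]; exists (existT _ W (exist _ y (conj hW Ry))).
have [|y yP] := mres_glue hV cov (s := s).
  by move=> i j W hi hj; apply: (Runiq W) (Rnat _ _ hi _ (hV i) (sP i))
    (Rnat _ _ hj _ (hV j) (sP j)); apply: subset_trans hi (hV i).
exists y => W hW z Rz.
have e := yP (existT _ W (exist _ z (conj hW Rz))).
by rewrite (Prop_irrelevance hW (hV (existT _ W (exist _ z (conj hW Rz))))).
Qed.

Lemma mor_onE (E F : mod_sheaf A) (f : mor E F) (W U : opens M) (h : U `<=` W) (x : E U) :
  happ (mor_on f W) h x = mapp f x.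
Proof. by rewrite /mapp /=; apply: happ_irr. Qed.

Lemma hom_resE (E F : mod_sheaf A) (W W' U : opens M) (hW : W' `<=` W) (h : U `<=` W')
  (f : hom_on E F W) (x : E U) : happ (hom_res hW f) h x = happ f (subset_trans h hW) x.
Proof. by []. Qed.

Lemma hom_compE (E F G : mod_sheaf A) (W U : opens M) (h : U `<=` W)
  (g : hom_on F G W) (f : hom_on E F W) (x : E U) :
  happ (hom_comp g f) h x = happ g h (happ f h x).
Proof. by []. Qed.

Lemma hom_subE (E F : mod_sheaf A) (W U : opens M) (h : U `<=` W)
  (f g : hom_on E F W) (x : E U) : happ (f - g) h x = happ f h x - happ g h x.
Proof. by []. Qed.

Lemma mapp_comp (E F G : mod_sheaf A) (U : opens M) (g : mor F G) (f : mor E F) (x : E U) :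
  mapp (hom_comp g f) x = mapp g (mapp f x).
Proof. by []. Qed.

Lemma mor_ext (E F : mod_sheaf A) (f g : mor E F) :
  (forall (U : opens M) x, @mapp _ _ _ _ f U x = mapp g x) -> f = g.
Proof.
move=> fg; apply: hom_ext => U h x.
by rewrite !(happ_irr _ h (@subsetT _ U)) -!/(mapp _ _) fg.
Qed.

Lemma mappN (E F : mod_sheaf A) (f : mor E F) (U : opens M) (x : E U) :
  mapp f (- x) = - mapp f x.
Proof. exact: happN. Qed.

Lemma happZ (E F : mod_sheaf A) (W U : opens M) (f : hom_on E F W) (h : U `<=` W)
  (a : A U) (x : E U) : happ f h (a *: x) = a *: happ f h x.
Proof.
have f0 : happ f h 0 = 0 by apply: (addrI (happ f h 0)); rewrite -happD !addr0.
by rewrite -[a *: x]addr0 hlin f0 addr0.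
Qed.

Lemma happ0 (E F : mod_sheaf A) (W U : opens M) (f : hom_on E F W) (h : U `<=` W) :
  happ f h 0 = 0.
Proof. by rewrite -[0 in LHS](scale0r 0) happZ scale0r. Qed.

Lemma happB (E F : mod_sheaf A) (W U : opens M) (f : hom_on E F W) (h : U `<=` W)
  (x y : E U) : happ f h (x - y) = happ f h x - happ f h y.
Proof. by rewrite happD happN. Qed.

(** Linearity reduces single-valuedness to the values at 0; the image of [x] is then glued from the
    sections related to its restrictions. Most maps below that are defined through local preimages
    are obtained in this way. *)
Lemma hom_of_rel (E F : mod_sheaf A) (W : opens M)
    (R : forall U : opens M, E U -> F U -> Prop) :
  (forall (U : opens M) (a : A U) x x' y y', U `<=` W ->
     R U x y -> R U x' y' -> R U (a *: x + x') (a *: y + y')) ->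
  (forall (U V : opens M) (h : V `<=` U) x y, U `<=` W ->
     R U x y -> R V (mres E h x) (mres F h y)) ->
  (forall (U : opens M) y, U `<=` W -> R U 0 y -> y = 0) ->
  (forall (U : opens M) (x : E U) t, U `<=` W -> oset U t ->
     exists (V : opens M) (h : V `<=` U) (y : F V), oset V t /\ R V (mres E h x) y) ->
  exists f : hom_on E F W, forall (U : opens M) (h : U `<=` W) x y,
    R U x y -> happ f h x = y.
Proof.
move=> Rlin Rnat R0 Rex.
have Runiq (U : opens M) x y y' : U `<=` W -> R U x y -> R U x y' -> y = y'.
  move=> hU xy xy'; apply/eqP; rewrite eq_sym -subr_eq0; apply/eqP/(R0 U) => //.
  have := Rlin U (-1) x x y y' hU xy xy'.
  by rewrite !scaleN1r addNr addrC.
have gl (U : opens M) (hU : U `<=` W) (x : E U) : {y : F U |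
    forall (V : opens M) (h : V `<=` U) z, R V (mres E h x) z -> mres F h y = z}.
  apply: cid.
  have [||t Ut|y yP] := @glue_rel F U (fun V z => exists h : V `<=` U, R V (mres E h x) z).
  - move=> V V' h z hV [h' xz]; have h'' : V' `<=` U := subset_trans h h'.
    exists h''; rewrite -(mres_comp h' h).
    by apply: Rnat => //; apply: subset_trans hU.
  - move=> V z z' _ [h xz] [h' xz']; apply: (Runiq V) xz _.
      exact: subset_trans hU.
    by rewrite (Prop_irrelevance h h').
  - have [V [h [y [Vt xy]]]] := Rex U x t hU Ut.
    by exists V, y; split=> //; exists h.
  - by exists y => V h z xz; apply: yP; exists h.
have glP (U : opens M) (hU : U `<=` W) x (V : opens M) (h : V `<=` U) z :
  R V (mres E h x) z -> mres F h (sval (gl U hU x)) = z := svalP (gl U hU x) V h z.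
have flin (U : opens M) (h : U `<=` W) : linear (fun x => sval (gl U h x)).
  move=> a x y; apply: mres_sep_pt => t Ut.
  have [V [hV [z [Vt xz]]]] := Rex U x t h Ut.
  have hVW := subset_trans hV h.
  have [V' [hV' [z' [Vt' yz]]]] := Rex V (mres E hV y) t hVW Vt.
  have hVU := subset_trans hV' hV.
  exists V', hVU; split=> //.
  have xz' : R V' (mres E hVU x) (mres F hV' z).
    by rewrite -(mres_comp hV hV'); apply: Rnat.
  have yz' : R V' (mres E hVU y) z' by rewrite -(mres_comp hV hV').
  rewrite raddfD/= mresZ (glP _ _ x _ _ _ xz') (glP _ _ y _ _ _ yz').
  apply: glP; rewrite raddfD/= mresZ; apply: Rlin => //.
  exact: subset_trans hVU h.
have fnat (U V : opens M) (hVU : V `<=` U) (hU : U `<=` W) (hV : V `<=` W) (x : E U) :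
    mres F hVU (sval (gl U hU x)) = sval (gl V hV (mres E hVU x)).
  apply: mres_sep_pt => t Vt.
  have [V' [hV' [z [Vt' xz]]]] := Rex V (mres E hVU x) t hV Vt.
  exists V', hV'; split=> //; rewrite (glP _ _ _ _ _ _ xz).
  have h := subset_trans hV' hVU.
  rewrite (mres_comp hVU hV' h).
  by apply: glP; rewrite -(mres_comp hVU hV').
exists (HomOn flin fnat) => U h x y xy /=.
by have := glP U h x U (@subset_refl _ U) y; rewrite !mres_id; apply.
Qed.

Lemma hom_glue (E F : mod_sheaf A) (N : M -> opens M) (f : forall t, hom_on E F (N t)) :
  (forall t, oset (N t) t) ->
  (forall t u (U : opens M) (ht : U `<=` N t) (hu : U `<=` N u) x,
     happ (f t) ht x = happ (f u) hu x) ->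
  exists g : mor E F, forall t (U : opens M) (h : U `<=` N t) x, mapp g x = happ (f t) h x.
Proof.
move=> Nt fC.
have cov : oT M `<=` \bigcup_t N t by move=> t _; exists t => //; apply: Nt.
have NT t : N t `<=` oT M by [].
have [|g gP] := sh_glue (hom_is_sheaf E F) NT cov (s := f).
  by move=> t u W ht hu; apply: hom_ext => U h x /=; apply: fC.
by exists g => t U h x; rewrite -(gP t) /mapp /=; apply: happ_irr.
Qed.

Lemma hom_factor (E F G : mod_sheaf A) (W : opens M) (i : mor F G) (f : hom_on E G W) :
  (forall U : opens M, injective (@mapp _ _ _ _ i U)) ->
  (forall (U : opens M) (h : U `<=` W) x, exists y, happ f h x = mapp i y) ->
  exists g : hom_on E F W, forall (U : opens M) (h : U `<=` W) x,
    happ f h x = mapp i (happ g h x).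
Proof.
move=> iI fi.
have [||U y _ [h]|U x t hU Ut|g gP] := @hom_of_rel E F W (fun U x y =>
   exists h : U `<=` W, happ f h x = mapp i y).
- move=> U a x x' y y' _ [h e] [h' e']; exists h.
  by rewrite hlin e mappD mappZ (happ_irr f h h') e'.
- move=> U V h x y _ [h' e]; exists (subset_trans h h').
  by rewrite -mapp_nat -e (hnat f h h' (subset_trans h h')).
- by rewrite happ0 => /esym e; apply: (iI U); rewrite e mapp0.
- have [y e] := fi U hU x; exists U, (@subset_refl _ U), y.
  by rewrite mres_id; split=> //; exists hU.
- by exists g => U h x; have [y e] := fi U h x; rewrite (gP U h x y) //; exists h.
Qed.

(** Preimages under [p] exist only locally and are unique only up to the kernel, which [f] kills. *)
Lemma hom_descend (E E' F : mod_sheaf A) (W : opens M) (p : mor E E') (f : hom_on E F W) :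
  loc_surj p ->
  (forall (U : opens M) (h : U `<=` W) x, mapp p x = 0 -> happ f h x = 0) ->
  exists g : hom_on E' F W, forall (U : opens M) (h : U `<=` W) x,
    happ g h (mapp p x) = happ f h x.
Proof.
move=> pS fp.
have [||U y _ [h [z e <-]]|U x t hU Ut|g gP] := @hom_of_rel E' F W (fun U x y =>
   exists h : U `<=` W, exists2 z, mapp p z = x & happ f h z = y).
- move=> U a x x' y y' _ [h [z <- <-]] [h' [z' <- <-]]; exists h, (a *: z + z').
    by rewrite mappD mappZ.
  by rewrite hlin (happ_irr f h' h).
- move=> U V h x y _ [h' [z <- <-]]; exists (subset_trans h h'), (mres E h z).
    by rewrite mapp_nat.
  by rewrite (hnat f h h' (subset_trans h h')).
- exact: fp.
- have [V [h [z [Vt e]]]] := pS U x t Ut.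
  have hV := subset_trans h hU.
  by exists V, h, (happ f hV z); split=> //; exists hV, z.
- by exists g => U h x; apply: gP; exists h, x.
Qed.

Lemma hom_ext_loc_surj (E E' F : mod_sheaf A) (W : opens M) (p : mor E E')
  (f g : hom_on E' F W) : loc_surj p ->
  (forall (U : opens M) (h : U `<=` W) x, happ f h (mapp p x) = happ g h (mapp p x)) ->
  f = g.
Proof.
move=> pS fg; apply: hom_ext => U h x; apply: mres_sep_pt => t Ut.
have [V [hV [z [Vt e]]]] := pS U x t Ut; have hVW := subset_trans hV h.
by exists V, hV; split=> //; rewrite !(hnat _ hV h hVW) -e fg.
Qed.

End Gluing.

(** * Twisted pullbacks of extensions *)

Section Twist.
Variables (M : topologicalType) (A : ring_sheaf M) (E F G B : mod_sheaf A).
Variables (i : mor F G) (o : mor G B) (phi : mor E B) (c : cocycle1 (sheafHom E F)).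
Hypothesis i_inj : forall U : opens M, injective (@mapp _ _ _ _ i U).
Hypothesis io_exact : forall (U : opens M) (z : G U),
  mapp o z = 0 <-> exists y : F U, z = mapp i y.
Hypothesis phi_lift : forall (U : opens M) (e : E U) t, oset U t ->
  exists (V : opens M) (h : V `<=` U) (g : G V), oset V t /\ mapp o g = mapp phi (mres E h e).

(** The sections v_t are recorded on every open subset of both [U] and [nb c t], not just on the
    intersection: restriction then merely composes inclusions, and its functoriality on the v_t is
    proof irrelevance. *)
Record twisted (U : opens M) := Twisted {
  tw_base : E U;
  tw_loc : forall (t : M) (V : opens M), V `<=` U -> V `<=` nb c t -> G V;
  tw_nat : forall (t : M) (V W : opens M) (hWV : W `<=` V) (hV : V `<=` U) (hW : W `<=` U)
    (hVt : V `<=` nb c t) (hWt : W `<=` nb c t),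
    mres G hWV (tw_loc hV hVt) = tw_loc hW hWt;
  tw_out : forall (t : M) (V : opens M) (hV : V `<=` U) (hVt : V `<=` nb c t),
    mapp o (tw_loc hV hVt) = mapp phi (mres E hV tw_base);
  tw_twist : forall (t u : M) (V : opens M) (hV : V `<=` U) (ht : V `<=` nb c t)
    (hu : V `<=` nb c u) (htu : V `<=` oI (nb c t) (nb c u)),
    tw_loc hV hu - tw_loc hV ht = mapp i (happ (cc c t u) htu (mres E hV tw_base)) }.

Lemma twisted_ext (U : opens M) (x y : twisted U) : tw_base x = tw_base y ->
  (forall (t : M) (V : opens M) (hV : V `<=` U) (ht : V `<=` nb c t),
     tw_loc x hV ht = tw_loc y hV ht) -> x = y.
Proof.
case: x => e v v1 v2 v3; case: y => e' v' v1' v2' v3' /= ee vv; subst e'.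
have evv : v = v' by do 4 apply: functional_extensionality_dep => ?; apply: vv.
by subst v'; congr Twisted; apply: Prop_irrelevance.
Qed.

Section Algebra.
Variable U : opens M.

HB.instance Definition _ := gen_eqMixin (twisted U).
HB.instance Definition _ := gen_choiceMixin (twisted U).

Program Definition tw0 : twisted U := @Twisted U 0 (fun _ _ _ _ => 0) _ _ _.
Next Obligation. by move=> *; rewrite raddf0. Qed.
Next Obligation. by move=> *; rewrite raddf0 !mapp0. Qed.
Next Obligation. by move=> *; rewrite raddf0 happ0 mapp0 subr0. Qed.

(** A single general linear combination, so that the three conditions on twisted sections are
    checked once for sums, opposites and multiples. *)
Program Definition tw_lin (a b : A U) (x y : twisted U) : twisted U :=
  @Twisted U (a *: tw_base x + b *: tw_base y)
    (fun t V hV ht => rres A hV a *: tw_loc x hV ht + rres A hV b *: tw_loc y hV ht) _ _ _.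
Next Obligation.
move=> a b x y t V W hWV hV hW ht hWt; rewrite raddfD/= !mresZ.
by rewrite !(tw_nat _ _ _ hW _ hWt) !(sh_comp (rsheafP A) _ _ hW).
Qed.
Next Obligation.
by move=> a b x y t V hV ht; rewrite raddfD/= !mresZ !mappD !mappZ !tw_out.
Qed.
Next Obligation.
move=> a b x y t u V hV ht hu htu.
rewrite (raddfD (mres E hV))/= !mresZ !happD !happZ !mappD !mappZ -!(tw_twist _ hV ht hu htu).
by rewrite !scalerBr opprD addrACA.
Qed.

Definition tw_add := tw_lin 1 1.
Definition tw_opp (x : twisted U) := tw_lin (-1) 0 x x.
Definition tw_scale (a : A U) (x : twisted U) := tw_lin a 0 x x.

Lemma tw_addA : associative tw_add.
Proof.
by move=> x y z; apply: twisted_ext => [|t V hV ht] /=; rewrite ?rmorph1 !scale1r addrA.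
Qed.
Lemma tw_addC : commutative tw_add.
Proof.
by move=> x y; apply: twisted_ext => [|t V hV ht] /=; rewrite ?rmorph1 !scale1r addrC.
Qed.
Lemma tw_add0 : left_id tw0 tw_add.
Proof.
by move=> x; apply: twisted_ext => [|t V hV ht] /=; rewrite ?rmorph1 !scale1r add0r.
Qed.
Lemma tw_addN : left_inverse tw0 tw_opp tw_add.
Proof.
by move=> x; apply: twisted_ext => [|t V hV ht] /=;
  rewrite ?rmorph1 ?rmorph0 ?rmorphN1 !scale1r !scale0r addr0 scaleN1r addNr.
Qed.

HB.instance Definition _ := GRing.isZmodule.Build (twisted U) tw_addA tw_addC tw_add0 tw_addN.

Lemma tw_scalerA (a b : A U) x : tw_scale a (tw_scale b x) = tw_scale (a * b) x.
Proof.
by apply: twisted_ext => [|t V hV ht] /=;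
  rewrite ?rmorph0 !scale0r !addr0 scalerA ?rmorphM.
Qed.
Lemma tw_scale1r : left_id 1 tw_scale.
Proof.
by move=> x; apply: twisted_ext => [|t V hV ht] /=;
  rewrite ?rmorph0 ?rmorph1 !scale0r addr0 scale1r.
Qed.
Lemma tw_scalerDr : right_distributive tw_scale +%R.
Proof.
by move=> a x y; apply: twisted_ext => [|t V hV ht] /=;
  rewrite ?rmorph0 ?rmorph1 !scale0r !addr0 !scale1r scalerDr.
Qed.
Lemma tw_scalerDl x : {morph tw_scale^~ x : a b / a + b}.
Proof.
by move=> a b; apply: twisted_ext => [|t V hV ht] /=;
  rewrite ?rmorph0 ?rmorphD ?rmorph1 !scale0r !addr0 !scale1r scalerDl.
Qed.

HB.instance Definition _ := GRing.Zmodule_isLmodule.Build (A U) (twisted U)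
  tw_scalerA tw_scale1r tw_scalerDr tw_scalerDl.

Lemma tw_baseD x y : tw_base (x + y : twisted U) = tw_base x + tw_base y.
Proof. by rewrite /= !scale1r. Qed.
Lemma tw_baseZ (a : A U) x : tw_base (a *: x : twisted U) = a *: tw_base x.
Proof. by rewrite /= scale0r addr0. Qed.
Lemma tw_locD x y t (V : opens M) (hV : V `<=` U) (ht : V `<=` nb c t) :
  tw_loc (x + y : twisted U) hV ht = tw_loc x hV ht + tw_loc y hV ht.
Proof. by rewrite /= rmorph1 !scale1r. Qed.
Lemma tw_locZ (a : A U) x t (V : opens M) (hV : V `<=` U) (ht : V `<=` nb c t) :
  tw_loc (a *: x : twisted U) hV ht = rres A hV a *: tw_loc x hV ht.
Proof. by rewrite /= rmorph0 scale0r addr0. Qed.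

End Algebra.

Lemma tw_loc_irr (U : opens M) (x : twisted U) t (V : opens M) (h h' : V `<=` U)
  (ht ht' : V `<=` nb c t) : tw_loc x h ht = tw_loc x h' ht'.
Proof. by rewrite (Prop_irrelevance h h') (Prop_irrelevance ht ht'). Qed.

Program Definition tw_res (U U' : opens M) (h : U' `<=` U) (x : twisted U) : twisted U' :=
  @Twisted U' (mres E h (tw_base x))
    (fun t V hV ht => tw_loc x (subset_trans hV h) ht) _ _ _.
Next Obligation. by move=> *; apply: tw_nat. Qed.
Next Obligation.
by move=> U U' h x t V hV ht; rewrite tw_out (mres_comp _ _ (subset_trans hV h)).
Qed.
Next Obligation.
move=> U U' h x t u V hV ht hu htu.
by rewrite (tw_twist _ _ _ _ htu) (mres_comp _ _ (subset_trans hV h)).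
Qed.

Lemma tw_res_is_zmod (U U' : opens M) (h : U' `<=` U) : zmod_morphism (@tw_res U U' h).
Proof.
move=> x y; apply: twisted_ext => [|t V hV ht] /=.
  by rewrite !scale1r raddfD/= !scaleN1r !scale0r !addr0 raddfN.
by rewrite !rmorph1 !rmorphN1 !rmorph0 !scale0r !scale1r.
Qed.

HB.instance Definition _ (U U' : opens M) (h : U' `<=` U) :=
  GRing.isZmodMorphism.Build _ _ (@tw_res U U' h) (@tw_res_is_zmod U U' h).

Lemma tw_resZ (U U' : opens M) (h : U' `<=` U) (a : A U) x :
  tw_res h (a *: x) = rres A h a *: tw_res h x.
Proof.
apply: twisted_ext => [|t V hV ht] /=.
  by rewrite !scale0r !addr0 mresZ.
by rewrite !rmorph0 !scale0r !addr0 (sh_comp (rsheafP A) _ _ (subset_trans hV h)).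
Qed.

Lemma tw_is_sheaf : is_sheaf tw_res.
Proof.
split.
- move=> U h x; apply: twisted_ext => [|t V hV ht] /=; first exact: mres_id.
  exact: tw_loc_irr.
- move=> U V W hVU hWV hWU x; apply: twisted_ext => [|t X hX ht] /=.
    exact: mres_comp.
  exact: tw_loc_irr.
- move=> I U V h cov x y xy; apply: twisted_ext => [|t W hW ht].
    by apply: (@mres_sep _ _ E I U V h cov) => j; have := congr1 (@tw_base _) (xy j).
  apply: mres_sep_pt => u Wu; have [j _ Vu] := cov u (hW u Wu).
  have hVW := @oIl _ W (V j); have hVV := @oIr _ W (V j).
  exists (oI W (V j)), hVW; split=> //.
  have hVt := subset_trans hVW ht; have hVU := subset_trans hVW hW.
  rewrite !(tw_nat _ hVW hW hVU ht hVt).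
  have := congr1 (fun z => tw_loc z hVV hVt) (xy j) => /=.
  by rewrite !(tw_loc_irr _ _ hVU _ hVt).
- move=> I U V h cov s sC.
  have [e eP] := mres_glue h cov (s := fun j => tw_base (s j))
    (fun j k W hj hk => congr1 (@tw_base W) (sC j k W hj hk)).
  have locC j k t (W : opens M) (hj : W `<=` V j) (hk : W `<=` V k) (ht : W `<=` nb c t) :
      tw_loc (s j) hj ht = tw_loc (s k) hk ht.
    have := congr1 (fun z => tw_loc z (@subset_refl _ W) ht) (sC j k W hj hk) => /=.
    by rewrite (tw_loc_irr _ _ hj _ ht) (tw_loc_irr (s k) _ hk _ ht).
  (* Over [W] the section v_t is recovered from the parts of [W] lying in some [V j]; by [locC] the
     choice of [j] does not matter. *)
  pose R t (W : opens M) (y : G W) :=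
    exists j (hj : W `<=` V j) (ht : W `<=` nb c t), y = tw_loc (s j) hj ht.
  have gl t (W : opens M) (hW : W `<=` U) (ht : W `<=` nb c t) : {y : G W |
      forall (X : opens M) (hX : X `<=` W) z, R t X z -> mres G hX y = z}.
    apply: cid; apply: glue_rel.
    - move=> X X' hX y _ [j [hj [hXt ->]]].
      exists j, (subset_trans hX hj), (subset_trans hX hXt); exact: tw_nat.
    - move=> X y y' _ [j [hj [hXt ->]]] [k [hk [hXt' ->]]].
      by rewrite (Prop_irrelevance hXt' hXt); apply: locC.
    - move=> u Wu; have [j _ Vu] := cov u (hW u Wu).
      have hj := @oIr _ W (V j); have hWt := subset_trans (@oIl _ W (V j)) ht.
      exists (oI W (V j)), (tw_loc (s j) hj hWt); split=> //; first exact: oIl.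
      by exists j, hj, hWt.
  have glP t (W : opens M) hW ht (X : opens M) (hX : X `<=` W) j (hj : X `<=` V j)
      (hXt : X `<=` nb c t) : mres G hX (sval (gl t W hW ht)) = tw_loc (s j) hj hXt.
    by apply: (svalP (gl t W hW ht)); exists j, hj, hXt.
  have sep (W : opens M) (hW : W `<=` U) (y y' : G W) :
      (forall j, mres G (@oIl _ W (V j)) y = mres G (@oIl _ W (V j)) y') -> y = y'.
    move=> yy; apply: mres_sep_pt => u Wu; have [j _ Vu] := cov u (hW u Wu).
    by exists (oI W (V j)), (@oIl _ W (V j)).
  have base (W : opens M) (hW : W `<=` U) j :
      mres E (@oIl _ W (V j)) (mres E hW e) = mres E (@oIr _ W (V j)) (tw_base (s j)).
    rewrite -eP.
    rewrite (mres_comp _ _ (subset_trans (@oIl _ W (V j)) hW)).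
    by rewrite (mres_comp _ _ (subset_trans (@oIl _ W (V j)) hW)).
  have gnat t (X W : opens M) (hWX : W `<=` X) (hX : X `<=` U) (hW : W `<=` U)
      (hXt : X `<=` nb c t) (hWt : W `<=` nb c t) :
      mres G hWX (sval (gl t X hX hXt)) = sval (gl t W hW hWt).
    apply: (sep W hW) => j.
    rewrite (mres_comp _ _ (subset_trans (@oIl _ W (V j)) hWX)).
    by rewrite !(glP _ _ _ _ _ _ j (@oIr _ W (V j)) (subset_trans (@oIl _ W (V j)) hWt)).
  have gout t (W : opens M) (hW : W `<=` U) (ht : W `<=` nb c t) :
      mapp o (sval (gl t W hW ht)) = mapp phi (mres E hW e).
    apply: mres_sep_pt => u Wu; have [j _ Vu] := cov u (hW u Wu).
    exists (oI W (V j)), (@oIl _ W (V j)); split=> //.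
    rewrite !mapp_nat base.
    rewrite (glP _ _ _ _ _ _ j (@oIr _ W (V j)) (subset_trans (@oIl _ W (V j)) ht)).
    exact: tw_out.
  have gtw t u (W : opens M) (hW : W `<=` U) (ht : W `<=` nb c t)
      (hu : W `<=` nb c u) (htu : W `<=` oI (nb c t) (nb c u)) :
      sval (gl u W hW hu) - sval (gl t W hW ht) =
      mapp i (happ (cc c t u) htu (mres E hW e)).
    apply: (sep W hW) => j.
    rewrite raddfB/= !(glP _ _ _ _ _ _ j (@oIr _ W (V j)) (subset_trans (@oIl _ W (V j)) _)).
    rewrite mapp_nat (hnat _ _ _ (subset_trans (@oIl _ W (V j)) htu)) base.
    exact: tw_twist.
  exists (Twisted gnat gout gtw) => j; apply: twisted_ext => [|t W hW ht] /=; first exact: eP.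
  by rewrite -[LHS](mres_id (@subset_refl _ W)) (glP _ _ _ _ _ _ j hW ht).
Qed.

Definition tw_sheaf : mod_sheaf A :=
  @ModSheaf M A (fun U => twisted U : lmodType (A U))
    (fun U V h => @tw_res U V h : {additive _ -> _}) tw_resZ tw_is_sheaf.

Program Definition tw_pr (t : M) : hom_on tw_sheaf G (nb c t) :=
  @HomOn M A tw_sheaf G (nb c t) (fun U h x => tw_loc x (@subset_refl _ U) h) _ _.
Next Obligation.
move=> t U h a x y; rewrite tw_locD tw_locZ; congr (_ *: _ + _).
exact: (sh_id (rsheafP A)).
Qed.
Next Obligation. by move=> t U V hVU hU hV x; apply: tw_nat. Qed.

Program Definition tw_proj : mor tw_sheaf E :=
  @HomOn M A tw_sheaf E (oT M) (fun U _ x => tw_base x) _ _.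
Next Obligation. by move=> U h a x y; rewrite tw_baseD tw_baseZ. Qed.
Next Obligation. by []. Qed.

(** Over the base section 0 the twist vanishes, so all v_t may equal i(y): the copy of [F] does not
    feel the cocycle. *)
Program Definition tw_const (U : opens M) (y : F U) : twisted U :=
  @Twisted U 0 (fun t V hV _ => mapp i (mres F hV y)) _ _ _.
Next Obligation. by move=> U y t V W hWV hV hW ? ?; rewrite mapp_nat (mres_comp _ _ hW). Qed.
Next Obligation.
by move=> U y t V hV ?; rewrite raddf0 mapp0; apply/io_exact; exists (mres F hV y).
Qed.
Next Obligation. by move=> U y t u V hV ? ? htu; rewrite raddf0 happ0 mapp0 subrr. Qed.

Program Definition tw_in : mor F tw_sheaf :=
  @HomOn M A F tw_sheaf (oT M) (fun U _ y => tw_const y) _ _.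
Next Obligation.
move=> U h a x y; apply: twisted_ext => [|t V hV ht].
  by rewrite tw_baseD tw_baseZ /= scaler0 addr0.
by rewrite tw_locD tw_locZ /= raddfD/= mresZ mappD mappZ.
Qed.
Next Obligation.
move=> U V hVU hU hV x; apply: twisted_ext => [|t W hW ht] /=; first exact: raddf0.
by rewrite (mres_comp _ _ (subset_trans hW hVU)).
Qed.

Lemma tw_pr_in t (U : opens M) (h : U `<=` nb c t) (y : F U) :
  happ (tw_pr t) h (mapp tw_in y) = mapp i y.
Proof. by rewrite /= mres_id. Qed.

Lemma tw_pr_out t (U : opens M) (h : U `<=` nb c t) (x : tw_sheaf U) :
  mapp o (happ (tw_pr t) h x) = mapp phi (mapp tw_proj x).
Proof. by rewrite /= tw_out mres_id. Qed.

Lemma tw_pr_twist t u (U : opens M) (ht : U `<=` nb c t) (hu : U `<=` nb c u)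
  (htu : U `<=` oI (nb c t) (nb c u)) (x : tw_sheaf U) :
  happ (tw_pr u) hu x - happ (tw_pr t) ht x =
  mapp i (happ (cc c t u) htu (mapp tw_proj x)).
Proof. by rewrite /= (tw_twist _ _ _ _ htu) mres_id. Qed.

Lemma tw_in_inj (U : opens M) : injective (@mapp _ _ _ _ tw_in U).
Proof.
move=> x y xy; apply: mres_sep_pt => t Ut.
have hU := @oIl _ U (nb c t); have ht := @oIr _ U (nb c t).
exists (oI U (nb c t)), hU; split; first by split=> //; apply: nbP.
by apply: i_inj; have := congr1 (fun z : twisted U => tw_loc z hU ht) xy.
Qed.

(** Over the base section 0 the v_t agree on overlaps, and each lies in the image of [i]; so they
    all come from one section of [F]. *)
Lemma tw_exact (U : opens M) (z : tw_sheaf U) :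
  mapp tw_proj z = 0 <-> exists y : F U, z = mapp tw_in y.
Proof.
split=> [z0|[y ->]] //; rewrite /mapp/= in z0.
have [|||y yP] := @glue_rel _ _ F U (fun V y => exists t (hV : V `<=` U) (ht : V `<=` nb c t),
    tw_loc z hV ht = mapp i y).
- move=> V W h y _ [t [hV [ht e]]]; exists t, (subset_trans h hV), (subset_trans h ht).
  by rewrite -mapp_nat -e; apply/esym/tw_nat.
- move=> V y y' _ [t [hV [ht e]]] [u [hV' [hu e']]]; apply: i_inj.
  have htu : V `<=` oI (nb c t) (nb c u) by rewrite subsetI.
  apply/eqP; rewrite eq_sym -subr_eq0 -e -e' (tw_loc_irr z hV' hV hu hu).
  by rewrite (tw_twist _ _ _ _ htu) z0 raddf0 happ0 mapp0.
- move=> t Ut; have hU := @oIl _ U (nb c t); have ht := @oIr _ U (nb c t).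
  have /io_exact[y e] : mapp o (tw_loc z hU ht) = 0 by rewrite tw_out z0 raddf0 mapp0.
  exists (oI U (nb c t)), y; split=> //; first by split=> //; apply: nbP.
  by exists t, hU, ht.
exists y; apply: twisted_ext => [|t V hV ht] /=; first exact: z0.
have /io_exact[y' e] : mapp o (tw_loc z hV ht) = 0 by rewrite tw_out z0 raddf0 mapp0.
by rewrite (yP V hV y') //; exists t, hV, ht.
Qed.

(** Near [t] a single lift g' of phi(e) is taken as reference, which forces v_u = g' + i(c_tu(e)).
    The twisting condition between v_u and v_w is then the cocycle identity for t, u, w. *)
Lemma tw_surj : loc_surj tw_proj.
Proof.
move=> U e t Ut; have [V [h [g [Vt gP]]]] := phi_lift e Ut.
pose W := oI V (nb c t); have hV : W `<=` V := @oIl _ _ _; have ht : W `<=` nb c t := @oIr _ _ _.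
have hU := subset_trans hV h; pose e' := mres E hU e; pose g' := mres G hV g.
have gP' : mapp o g' = mapp phi e'.
  by rewrite /g' /e' -mapp_nat gP mapp_nat (mres_comp _ _ hU).
have hI u (X : opens M) (hX : X `<=` W) (hu : X `<=` nb c u) : X `<=` oI (nb c t) (nb c u).
  by move=> v Xv; split; [apply/ht/hX|apply: hu].
pose v u (X : opens M) (hX : X `<=` W) (hu : X `<=` nb c u) : G X :=
  mres G hX g' + mapp i (happ (cc c t u) (hI u X hX hu) (mres E hX e')).
have vnat u (X Y : opens M) (hYX : Y `<=` X) (hX : X `<=` W) (hY : Y `<=` W)
    (hXu : X `<=` nb c u) (hYu : Y `<=` nb c u) : mres G hYX (v u X hX hXu) = v u Y hY hYu.
  rewrite /v raddfD/= (mres_comp _ _ hY) mapp_nat (hnat _ _ _ (hI u Y hY hYu)).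
  by rewrite (mres_comp _ _ hY).
have vout u (X : opens M) (hX : X `<=` W) (hu : X `<=` nb c u) :
    mapp o (v u X hX hu) = mapp phi (mres E hX e').
  rewrite /v mappD -mapp_nat gP' mapp_nat [X in _ + X](_ : _ = 0) ?addr0//.
  by apply/io_exact; eexists.
have vtw u w (X : opens M) (hX : X `<=` W) (hu : X `<=` nb c u) (hw : X `<=` nb c w)
    (huw : X `<=` oI (nb c u) (nb c w)) :
    v w X hX hw - v u X hX hu = mapp i (happ (cc c u w) huw (mres E hX e')).
  rewrite /v opprD addrACA subrr add0r -mappB; congr (mapp i _).
  have := congr1 (fun k : hom_on E F X => happ k (@subset_refl _ X) (mres E hX e'))
    (ccP (hI u X hX hu) huw (hI w X hX hw)) => /=.
  rewrite (happ_irr _ _ (hI u X hX hu)) (happ_irr _ _ huw) (happ_irr _ _ (hI w X hX hw)).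
  by move=> <-; rewrite addrC addKr.
exists W, hU, (Twisted vnat vout vtw : tw_sheaf W); split=> //.
by split=> //; apply: nbP.
Qed.

Definition tw_extension : extension E F := Extension tw_in_inj tw_exact tw_surj.

End Twist.

(** * Extensions with local splittings *)

Section Extensions.
Variables (M : topologicalType) (A : ring_sheaf M).

Lemma xout_in (E F : mod_sheaf A) (X : extension E F) (U : opens M) (y : F U) :
  mapp (xout X) (mapp (xin X) y) = 0.
Proof. by apply/x_exact; exists y. Qed.

Section Twists.
Variables (E F G B : mod_sheaf A) (i : mor F G) (o : mor G B) (phi : mor E B).
Variable c : cocycle1 (sheafHom E F).
Hypothesis i_inj : forall U : opens M, injective (@mapp _ _ _ _ i U).
Hypothesis io_exact : forall (U : opens M) (z : G U),
  mapp o z = 0 <-> exists y : F U, z = mapp i y.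

(* X is the pullback along phi of the extension G, twisted by c. *)
Definition is_twist (X : extension E F) (p : forall t, hom_on (xmid X) G (nb c t)) : Prop :=
  [/\ forall t (U : opens M) (h : U `<=` nb c t) y, happ (p t) h (mapp (xin X) y) = mapp i y,
      forall t (U : opens M) (h : U `<=` nb c t) x,
        mapp o (happ (p t) h x) = mapp phi (mapp (xout X) x) &
      forall t u (U : opens M) (ht : U `<=` nb c t) (hu : U `<=` nb c u)
        (htu : U `<=` oI (nb c t) (nb c u)) x,
        happ (p u) hu x - happ (p t) ht x =
        mapp i (happ (cc c t u) htu (mapp (xout X) x))].

Lemma twist_exists :
  (forall (U : opens M) (e : E U) t, oset U t -> exists (V : opens M) (h : V `<=` U) (g : G V),
     oset V t /\ mapp o g = mapp phi (mres E h e)) ->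
  exists X p, @is_twist X p.
Proof.
move=> lift; exists (tw_extension c i_inj io_exact lift), (@tw_pr _ _ _ _ _ _ i o phi c).
split=> *; [exact: tw_pr_in|exact: tw_pr_out|exact: tw_pr_twist].
Qed.

Variables (X : extension E F) (p : forall t, hom_on (xmid X) G (nb c t)).
Hypothesis Xp : is_twist p.

(** Two sections with the same image in [E] differ by a section of [F], on which [p t] is the
    injective map [i]. *)
Lemma twist_uniq t (U : opens M) (h : U `<=` nb c t) (x x' : xmid X U) :
  mapp (xout X) x = mapp (xout X) x' -> happ (p t) h x = happ (p t) h x' -> x = x'.
Proof.
have [p_in _ _] := Xp; move=> e e'; apply/eqP; rewrite -subr_eq0; apply/eqP.
have /x_exact[y xy] : mapp (xout X) (x - x') = 0 by rewrite mappB e subrr.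
rewrite xy -(mapp0 (xin X)); congr mapp; apply: (i_inj (U := U)).
by rewrite -(p_in t U h) -xy happB e' subrr mapp0.
Qed.

(** Over [nb c t] the twist is the fibre product of [E] and [G] over [B]. A local preimage in [X] of
    the first component is corrected by a section of [F] so as to get the right second component. *)
Lemma twist_lift_on (L : mod_sheaf A) t (W : opens M) (hW : W `<=` nb c t)
    (q : hom_on L E W) (r : hom_on L G W) :
  (forall (U : opens M) (h : U `<=` W) x, mapp o (happ r h x) = mapp phi (happ q h x)) ->
  exists f : hom_on L (xmid X) W,
    (forall (U : opens M) (h : U `<=` W) x, mapp (xout X) (happ f h x) = happ q h x) /\
    (forall (U : opens M) (h : U `<=` W) (h' : U `<=` nb c t) x,
       happ (p t) h' (happ f h x) = happ r h x).
Proof.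
have [p_in p_out _] := Xp; move=> qr.
pose R (U : opens M) (x : L U) (y : xmid X U) := exists (h : U `<=` W) (h' : U `<=` nb c t),
  mapp (xout X) y = happ q h x /\ happ (p t) h' y = happ r h x.
have Rnat (U V : opens M) (h : V `<=` U) x y : R U x y -> R V (mres L h x) (mres _ h y).
  move=> [hU [ht [e e']]]; exists (subset_trans h hU), (subset_trans h ht).
  rewrite -mapp_nat e -(hnat (p t) h ht) e'.
  by rewrite (hnat _ h hU (subset_trans h hU)) (hnat _ h hU (subset_trans h hU)).
have Rex (U : opens M) (x : L U) u : U `<=` W -> oset U u ->
    exists (V : opens M) (h : V `<=` U) y, oset V u /\ R V (mres L h x) y.
  move=> hU Uu; have [V [h [y [Vu ye]]]] := xout_surj X (happ q hU x) Uu.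
  have hV := subset_trans h hU; have hVt := subset_trans hV hW.
  have /io_exact[g gE] : mapp o (happ (p t) hVt y - happ r hV (mres L h x)) = 0.
    by rewrite mappB p_out ye qr (hnat q h hU hV) subrr.
  exists V, h, (y - mapp (xin X) g); split=> //; exists hV, hVt.
  rewrite mappB xout_in subr0 ye (hnat q h hU hV); split=> //.
  by rewrite happB p_in -gE subKr.
have [||U y _ [h [h' [e e']]]||f fP] := @hom_of_rel _ _ L (xmid X) W R.
- move=> U a x x' y y' hU [h [ht [e1 e2]]] [h' [ht' [e1' e2']]]; exists h, ht.
  rewrite mappD mappZ !hlin e1 e1' e2 (happ_irr _ ht ht') e2'.
  by rewrite !(happ_irr _ h h').
- by move=> U V h x y _; apply: Rnat.
- by apply: (twist_uniq (h := h')); rewrite ?e ?e' !happ0 ?mapp0.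
- exact: Rex.
have fE (U : opens M) (h : U `<=` W) x u : oset U u -> exists (V : opens M) (hV : V `<=` U),
    oset V u /\ R V (mres L hV x) (mres _ hV (happ f h x)).
  move=> Uu; have [V [hV [y [Vu xy]]]] := Rex U x u h Uu; exists V, hV; split=> //.
  by rewrite (hnat f hV h (subset_trans hV h)) (fP _ _ _ _ xy).
exists f; split=> [U h x|U h ht x]; apply: mres_sep_pt => u /(fE _ h x);
  move=> [V [hV [Vu [h1 [h2 [e e']]]]]]; exists V, hV; split=> //.
  by rewrite mapp_nat e (hnat q hV h h1).
by rewrite (hnat (p t) hV ht h2) e' (hnat r hV h h1).
Qed.

(** Global universal property of the twist: local maps to [G] that differ by the twist define one
    map to [X]. The domains [P t] are allowed to be smaller than those of the cocycle, since local
    liftings may exist only there. *)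
Lemma twist_lift (L : mod_sheaf A) (q : mor L E) (P : M -> opens M)
    (r : forall t, hom_on L G (P t)) :
  (forall t, oset (P t) t) -> (forall t, P t `<=` nb c t) ->
  (forall t (U : opens M) (h : U `<=` P t) x, mapp o (happ (r t) h x) = mapp phi (mapp q x)) ->
  (forall t u (U : opens M) (ht : U `<=` P t) (hu : U `<=` P u)
     (htu : U `<=` oI (nb c t) (nb c u)) x,
     happ (r u) hu x - happ (r t) ht x = mapp i (happ (cc c t u) htu (mapp q x))) ->
  exists f : mor L (xmid X), hom_comp (xout X) f = q /\
    forall t (U : opens M) (h : U `<=` P t) (h' : U `<=` nb c t) x,
      happ (p t) h' (mapp f x) = happ (r t) h x.
Proof.
move=> Pt hP rq r_tw; have [_ _ p_tw] := Xp.
have ex t := @twist_lift_on L t (P t) (hP t) (mor_on q (P t)) (r t).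
have {}ex t : {f : hom_on L (xmid X) (P t) |
    (forall (U : opens M) (h : U `<=` P t) x, mapp (xout X) (happ f h x) = mapp q x) /\
    (forall (U : opens M) (h : U `<=` P t) (h' : U `<=` nb c t) x,
       happ (p t) h' (happ f h x) = happ (r t) h x)}.
  apply: cid; have [|f [f1 f2]] := ex t; first by move=> U h x; rewrite mor_onE rq.
  by exists f; split=> // U h x; rewrite f1 mor_onE.
have f1 t : forall (U : opens M) (h : U `<=` P t) x, _ := (svalP (ex t)).1.
have f2 t : forall (U : opens M) (h : U `<=` P t) (h' : U `<=` nb c t) x, _ := (svalP (ex t)).2.
have [//|t u U ht hu x|f fP] := @hom_glue _ _ _ _ P (fun t => sval (ex t)).
  have hu' := subset_trans hu (hP u); have ht' := subset_trans ht (hP t).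
  have htu : U `<=` oI (nb c t) (nb c u) by rewrite subsetI.
  apply: (twist_uniq (t := u) (h := hu')); first by rewrite !f1.
  rewrite (f2 u U hu hu'); apply/eqP; rewrite -subr_eq0.
  by rewrite -(subrKA (happ (r t) ht x)) -(f2 t U ht ht')  (p_tw _ _ _ _ _ htu) f1 (f2 t U ht ht')
    -[X in _ + X]opprB (r_tw _ _ _ _ _ htu) subrr.
exists f; split; last by move=> t U h h' x; rewrite (fP t U h) f2.
apply: mor_ext => U x; apply: mres_sep_pt => t Ut.
have hU := @oIl _ U (P t); have hN := @oIr _ U (P t).
by exists (oI U (P t)), hU; split=> //; rewrite mapp_comp !mapp_nat (fP t _ hN) f1.
Qed.

End Twists.

Section Splittings.
Variables (E F : mod_sheaf A).
Implicit Types (X Y Z : extension E F) (z : cocycle1 (sheafHom E F)).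

(* Unlike in ext_edge, the domains P of the splittings may be smaller than those
   of the cocycle. *)
Definition splits z X (P : M -> opens M) (s : forall t, hom_on E (xmid X) (P t)) : Prop :=
  [/\ forall t, oset (P t) t, forall t, P t `<=` nb z t,
      forall t (U : opens M) (h : U `<=` P t) e, mapp (xout X) (happ (s t) h e) = e &
      forall t u (U : opens M) (ht : U `<=` P t) (hu : U `<=` P u)
        (htu : U `<=` oI (nb z t) (nb z u)) e,
        happ (s u) hu e - happ (s t) ht e = mapp (xin X) (happ (cc z t u) htu e)].

(** Another representative z' = z + d(b) of the class is absorbed by replacing the splitting s_t by
    s_t - b_t on the domain of b_t. *)
Lemma ext_edge_splits z X : ext_edge (H1cl z) X -> exists P s, @splits z X P s.
Proof.
move=> [z' [s [/H1clP[P [b [Pt hP zb]]] sS sz]]].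
have hP1 t : P t `<=` nb z' t by move=> v /hP[].
have hP2 t : P t `<=` nb z t by move=> v /hP[].
exists P, (fun t => hom_res (hP1 t) (s t) - hom_comp (mor_on (xin X) (P t)) (b t)).
split=> // [t U h e|t u U ht hu htu e].
  have := congr1 (fun k : hom_on E E (nb z' t) => happ k (subset_trans h (hP1 t)) e) (sS t).
  rewrite hom_compE mor_onE hom_subE mappB hom_compE mor_onE xout_in subr0 => sSe.
  by rewrite hom_resE sSe.
have htu' : U `<=` oI (nb z' t) (nb z' u).
  by rewrite subsetI; split; [apply: subset_trans ht _|apply: subset_trans hu _].
have := congr1 (fun k : hom_on E (xmid X) U => happ k (@subset_refl _ U) e)
  (sz t u U (subset_trans ht (hP1 t)) (subset_trans hu (hP1 u)) htu').
have := congr1 (fun k : hom_on E F U => happ k (@subset_refl _ U) e)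
  (zb t u U ht hu htu' htu).
rewrite !hom_subE hom_compE mor_onE !hom_resE !hom_compE !mor_onE.
rewrite (happ_irr (cc z' t u) _ htu') (happ_irr (cc z t u) _ htu).
rewrite (happ_irr (b t) _ ht) (happ_irr (b u) _ hu).
rewrite (happ_irr (s t) _ (subset_trans ht (hP1 t))).
rewrite (happ_irr (s u) _ (subset_trans hu (hP1 u))).
by move=> zb' sz'; rewrite subrACA sz' -!mappB -zb' subKr.
Qed.

(** [ext_edge] wants each splitting on the whole open set of the cocycle, so the cocycle is shrunk
    to the domains of the splittings. *)
Program Definition cc_restrict z (P : M -> opens M) (Pt : forall t, oset (P t) t)
    (hP : forall t, P t `<=` nb z t) : cocycle1 (sheafHom E F) :=
  @Cocycle1 M (sheafHom E F) P Pt
    (fun t u => ares (sheafHom E F)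
       (setISS (hP t) (hP u) : oI (P t) (P u) `<=` oI (nb z t) (nb z u)) (cc z t u)) _.
Next Obligation.
move=> z P Pt hP t u v W htu huv htv.
have h a b (h : W `<=` oI (P a) (P b)) : W `<=` oI (nb z a) (nb z b).
  exact: subset_trans h (setISS (hP a) (hP b)).
rewrite !(sh_comp (asheafP (sheafHom E F)) _ _ (h _ _ _)) //.
exact: ccP.
Qed.

Lemma splits_ext_edge z X P s : @splits z X P s -> ext_edge (H1cl z) X.
Proof.
move=> [Pt hP sS sz]; exists (cc_restrict Pt hP), s; split.
- apply/H1clP/coh_agree => t u W hc hd /=; apply: hom_ext => U h e.
  by rewrite !hom_resE; apply: happ_irr.
- by move=> t; apply: hom_ext => U h e; rewrite hom_compE mor_onE sS.
- move=> t u W ht hu htu; apply: hom_ext => U h e.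
  have htu' : U `<=` oI (nb z t) (nb z u).
    exact: subset_trans h (subset_trans htu (setISS (hP t) (hP u))).
  rewrite hom_subE hom_compE mor_onE !hom_resE.
  by rewrite (sz _ _ _ _ _ htu'); congr mapp; apply: happ_irr.
Qed.

(** The differences s_t - s'_t take values in [F] and form a cochain with coboundary z - z'.
    Injectivity of the edge map rests on this. *)
Lemma splits_coh z z' X P P' s s' : @splits z X P s -> @splits z' X P' s' -> H1cl z = H1cl z'.
Proof.
move=> [Pt hP sS sz] [Pt' hP' sS' sz']; apply/H1clP.
have hl t : oI (P t) (P' t) `<=` P t := @oIl _ _ _.
have hr t : oI (P t) (P' t) `<=` P' t := @oIr _ _ _.
have fac t : {b : hom_on E F (oI (P t) (P' t)) |
    forall (U : opens M) (h : U `<=` oI (P t) (P' t)) e,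
    happ (hom_res (hl t) (s t) - hom_res (hr t) (s' t)) h e = mapp (xin X) (happ b h e)}.
  apply: cid; apply: hom_factor; first exact: xin_inj.
  by move=> U h e; apply/x_exact; rewrite hom_subE mappB !hom_resE sS sS' subrr.
exists (fun t => oI (P t) (P' t)), (fun t => sval (fac t)); split; first by split.
  by move=> t; apply: setISS.
move=> t u W ht hu hz hz'; apply: hom_ext => U h e.
have htu : U `<=` oI (nb z t) (nb z u) := subset_trans h hz.
have htu' : U `<=` oI (nb z' t) (nb z' u) := subset_trans h hz'.
apply: (@xin_inj _ _ _ _ X); rewrite !hom_subE !mappB /= -!(svalP (fac _)).
rewrite !hom_subE !hom_resE subrACA.
rewrite (sz _ _ _ _ _ htu) (sz' _ _ _ _ _ htu').
by rewrite (happ_irr (cc z t u) _ htu) (happ_irr (cc z' t u) _ htu').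
Qed.

(** With x' the image of x in [E], the splitting of [X] gives x = s_t(x') + r_t(x), and tau_t
    replaces s_t by s'_t in this formula. In tau_t - tau_u the maps r contribute z and the
    splittings s' contribute -z'. *)
Lemma compare_splits z z' X Y P P' s s' : @splits z X P s -> @splits z' Y P' s' ->
  exists tau : forall t, hom_on (xmid X) (xmid Y) (oI (P t) (P' t)),
  [/\ forall t (U : opens M) (h : U `<=` oI (P t) (P' t)) y,
        happ (tau t) h (mapp (xin X) y) = mapp (xin Y) y,
      forall t (U : opens M) (h : U `<=` oI (P t) (P' t)) x,
        mapp (xout Y) (happ (tau t) h x) = mapp (xout X) x &
      forall t u (U : opens M) (ht : U `<=` oI (P t) (P' t)) (hu : U `<=` oI (P u) (P' u))
        (htu : U `<=` oI (nb z t) (nb z u)) (htu' : U `<=` oI (nb z' t) (nb z' u)) x,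
        happ (tau t) ht x - happ (tau u) hu x =
        mapp (xin Y) (happ (cc z t u) htu (mapp (xout X) x) -
                      happ (cc z' t u) htu' (mapp (xout X) x))].
Proof.
move=> [Pt hP sS sz] [Pt' hP' sS' sz'].
pose N t := oI (P t) (P' t).
have hl t : N t `<=` P t := @oIl _ _ _.
have hr t : N t `<=` P' t := @oIr _ _ _.
have fac t : {r : hom_on (xmid X) F (N t) | forall (U : opens M) (h : U `<=` N t) x,
    happ (hom_id (xmid X) (N t) - hom_comp (hom_res (hl t) (s t)) (mor_on (xout X) (N t))) h x
    = mapp (xin X) (happ r h x)}.
  apply: cid; apply: hom_factor; first exact: xin_inj.
  move=> U h x; apply/x_exact; rewrite hom_subE mappB hom_compE hom_resE sS mor_onE.
  exact: subrr.
pose r t := sval (fac t).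
have rP t (U : opens M) (h : U `<=` N t) x :
    x - happ (s t) (subset_trans h (hl t)) (mapp (xout X) x) = mapp (xin X) (happ (r t) h x).
  by rewrite -(svalP (fac t)) hom_subE hom_compE hom_resE mor_onE.
pose tau t : hom_on (xmid X) (xmid Y) (N t) :=
  hom_comp (hom_res (hr t) (s' t)) (mor_on (xout X) (N t)) + hom_comp (mor_on (xin Y) (N t)) (r t).
have tauE t (U : opens M) (h : U `<=` N t) x : happ (tau t) h x =
    happ (s' t) (subset_trans h (hr t)) (mapp (xout X) x) + mapp (xin Y) (happ (r t) h x).
  by rewrite -[LHS]/(happ _ h x + happ _ h x) !hom_compE hom_resE !mor_onE.
exists tau; split.
- move=> t U h y; rewrite tauE xout_in happ0 add0r; congr mapp.
  by apply: (@xin_inj _ _ _ _ X); rewrite -rP xout_in happ0 subr0.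
- by move=> t U h x; rewrite tauE mappD sS' xout_in addr0.
- move=> t u U ht hu htu htu' x; rewrite !tauE opprD addrACA -mappB.
  rewrite -[X in X + _]opprB (sz' _ _ _ _ _ htu') -mappN -mappD addrC; congr mapp.
  congr (_ - _); apply: (@xin_inj _ _ _ _ X).
  by rewrite mappB -!rP subrACA subrr sub0r opprB (sz _ _ _ _ _ htu).
Qed.

Lemma splits_iso z X Y P P' s s' : @splits z X P s -> @splits z Y P' s' -> ext_iso X Y.
Proof.
move=> sX sY; have [Pt hP _ _] := sX; have [Pt' _ _ _] := sY.
have [tau [tau_in tau_out tau_z]] := compare_splits sX sY.
have [//|t u U ht hu x|g gP] := @hom_glue _ _ _ _ (fun t => oI (P t) (P' t)) tau.
  have htu : U `<=` oI (nb z t) (nb z u).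
    by rewrite subsetI; split=> v; [move/ht => [/hP]|move/hu => [/hP]].
  by apply/eqP; rewrite -subr_eq0 (tau_z _ _ _ _ _ htu htu) subrr mapp0.
exists g; split; apply: mor_ext => U x; apply: mres_sep_pt => t Ut;
  have hU := @oIl _ U (oI (P t) (P' t)); have hN := @oIr _ U (oI (P t) (P' t));
  exists (oI U (oI (P t) (P' t))), hU; split=> //; rewrite !mapp_comp !mapp_nat.
  by rewrite (gP t _ hN) tau_in.
by rewrite (gP t _ hN) tau_out.
Qed.

Lemma splits_exists z : exists X P s, @splits z X P s.
Proof.
have idI U : injective (@mapp _ _ _ _ (hom_id F (oT M)) U) by move=> x y.
have idE (U : opens M) (y : F U) :
    mapp (0 : mor F F) y = 0 <-> exists x, y = mapp (hom_id F (oT M)) x.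
  by split=> // _; exists y.
(* The left exact sequence used is the identity of [F] followed by the zero map to [F], pulled back
   along 0, so that v_t is an arbitrary section of [F]. The splitting s_t(e) is the element over e
   with v_t = 0. Then s_u(e) has v_u = 0, hence v_t = z_tu(e) because the twist is by -z. *)
have [U e t Ut|X [p Xp]] := @twist_exists E F F F _ 0 0 (cc_opp z) idI idE.
  by exists U, (@subset_refl _ U), 0.
have [p_in _ p_z] := Xp.
have ex t := cid (@twist_lift_on _ _ _ _ _ _ _ _ idI idE X p Xp E t (nb z t)
  (@subset_refl _ _) (hom_id E (nb z t)) 0 (fun _ _ _ => erefl)).
pose s t := sval (ex t).
have sP t (U : opens M) (h : U `<=` nb z t) e :
    mapp (xout X) (happ (s t) h e) = e /\ happ (p t) h (happ (s t) h e) = 0.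
  by have [e1 e2] := svalP (ex t); split; [apply: e1|apply: e2].
exists X, (nb z), s; split; [exact: nbP|by move=> t; apply: subset_refl| |].
  by move=> t U h e; have [] := sP t U h e.
move=> t u U ht hu htu e.
have [st1 st2] := sP t U ht e; have [su1 su2] := sP u U hu e.
have /x_exact[y yE] : mapp (xout X) (happ (s u) hu e - happ (s t) ht e) = 0.
  by rewrite mappB su1 st1 subrr.
have yp : y = happ (p t) ht (happ (s u) hu e).
  by rewrite -[RHS]subr0 -st2 -happB yE p_in.
rewrite yE; congr mapp; have := p_z t u U ht hu htu (happ (s u) hu e).
by rewrite su1 su2 sub0r -yp => y_z; rewrite -[LHS]opprK y_z; apply: opprK.
Qed.

(** Isomorphisms carry splittings along, so the predicate [ext_edge] is a single isomorphism class,
    as an element of Ext^1 has to be. *)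
Lemma ext_edge_iso z X Y P s : @splits z X P s -> (ext_edge (H1cl z) Y <-> ext_iso X Y).
Proof.
move=> sX; split=> [/ext_edge_splits[Q [s' sY]]|[f [f_in f_out]]].
  exact: splits_iso sX sY.
have [Pt hP sS sz] := sX.
apply: (@splits_ext_edge z Y P (fun t => hom_comp (mor_on f (P t)) (s t))); split=> //.
  by move=> t U h e; rewrite hom_compE mor_onE -mapp_comp f_out sS.
move=> t u U ht hu htu e; rewrite !hom_compE !mor_onE -mappB (sz _ _ _ _ _ htu).
by rewrite -mapp_comp f_in.
Qed.

Lemma ext_edge_in_Ext1 (c : H1 (sheafHom E F)) : in_Ext1 (ext_edge c).
Proof.
rewrite -(H1cl_repr c); have [X [P [s sX]]] := splits_exists (repr c).
by exists X; apply: funext => Y; apply/propext; apply: ext_edge_iso sX.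
Qed.

Lemma ext_edge_inj : injective (@ext_edge M A E F).
Proof.
move=> c d; rewrite -(H1cl_repr c) -(H1cl_repr d) => cd.
have [X [P [s sX]]] := splits_exists (repr c).
have := splits_ext_edge sX; rewrite cd => /ext_edge_splits[P' [s' sX']].
exact: splits_coh sX sX'.
Qed.

End Splittings.
End Extensions.

(** * Baer differences and the obstruction class *)

Section Baer.
Variables (M : topologicalType) (A : ring_sheaf M).

Lemma hom_compA (G1 G2 G3 G4 : mod_sheaf A) (W : opens M) (a : hom_on G3 G4 W)
  (b : hom_on G2 G3 W) (c : hom_on G1 G2 W) :
  hom_comp a (hom_comp b c) = hom_comp (hom_comp a b) c.
Proof. exact: hom_ext. Qed.

(** The five lemma: [v] is injective and locally surjective, so its inverse relation is the graph of
    a morphism. *)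
Lemma ext_iso_sym (E F : mod_sheaf A) (X Y : extension E F) : ext_iso X Y -> ext_iso Y X.
Proof.
move=> [v [v_in v_out]].
have {}v_in U y : mapp v (mapp (xin X) y) = mapp (xin Y) (y : F U).
  by rewrite -!mapp_comp v_in.
have {}v_out U x : mapp (xout Y) (mapp v x) = mapp (xout X) (x : xmid X U).
  by rewrite -!mapp_comp v_out.
have v_inj U (x : xmid X U) : mapp v x = 0 -> x = 0.
  move=> vx; have /x_exact[y xy] : mapp (xout X) x = 0 by rewrite -v_out vx mapp0.
  rewrite xy -(mapp0 (xin X)); congr mapp; apply: (@xin_inj _ _ _ _ Y).
  by rewrite -v_in -xy vx mapp0.
have Rex (U : opens M) (y : xmid Y U) t : oset U t ->
    exists (V : opens M) (h : V `<=` U) x, oset V t /\ mapp v x = mres _ h y.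
  move=> Ut; have [V [h [x [Vt xy]]]] := xout_surj X (mapp (xout Y) y) Ut.
  have /x_exact[f fE] : mapp (xout Y) (mapp v x - mres _ h y) = 0.
    by rewrite mappB v_out xy mapp_nat subrr.
  by exists V, h, (x - mapp (xin X) f); rewrite mappB v_in -fE subKr.
have [||||w wP] := @hom_of_rel _ _ (xmid Y) (xmid X) (oT M) (fun U y x => mapp v x = y).
- by move=> U a y y' x x' _ <- <-; rewrite mappD mappZ.
- by move=> U V h y x _ <-; rewrite mapp_nat.
- by move=> U x _; apply: v_inj.
- by move=> U y t _; apply: Rex.
exists w; split; apply: mor_ext => U y; rewrite mapp_comp.
  by apply: wP; rewrite v_in.
apply: mres_sep_pt => t Ut; have [V [h [x [Vt xy]]]] := Rex U y t Ut.
exists V, h; split=> //; rewrite !mapp_nat -xy; rewrite v_out; congr mapp.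
exact: wP.
Qed.

Section Comparison.
Variables (E F : mod_sheaf A).
Implicit Types (X Y Z : extension E F) (z : cocycle1 (sheafHom E F)).

(* X and Y are locally isomorphic, and X - Y is the class of z. *)
Definition compares z X Y (P : M -> opens M)
    (tau : forall t, hom_on (xmid X) (xmid Y) (P t)) : Prop :=
  [/\ forall t, oset (P t) t, forall t, P t `<=` nb z t,
      forall t (U : opens M) (h : U `<=` P t) y,
        happ (tau t) h (mapp (xin X) y) = mapp (xin Y) y,
      forall t (U : opens M) (h : U `<=` P t) x,
        mapp (xout Y) (happ (tau t) h x) = mapp (xout X) x &
      forall t u (U : opens M) (ht : U `<=` P t) (hu : U `<=` P u)
        (htu : U `<=` oI (nb z t) (nb z u)) x,
        happ (tau t) ht x - happ (tau u) hu x =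
        mapp (xin Y) (happ (cc z t u) htu (mapp (xout X) x))].

(** The splitting of [Z] over [P t] sends the image of x in [E] to m(x, tau_t(x)); this is
    independent of x because m(u, u) = 0 for u in [F]. From t to u it changes by m(0, tau_u(x) -
    tau_t(x)), which is the value of the cocycle since m is u - v on F + F. *)
Lemma compares_baer_edge z X Y Z P tau : @compares z X Y P tau ->
  baer_diff X Y Z -> ext_edge (H1cl z) Z.
Proof.
move=> [Pt hP tau_in tau_out tau_z] [m [m_lin m_nat m_out m_in]].
(* The last argument of [m] is a proof that the two images agree, which blocks direct rewriting of
   the sections. *)
have mC (U : opens M) x x' y y' h h' : x = x' -> y = y' -> m U x y h = m U x' y' h'.
  by move=> e e'; subst; congr m; apply: Prop_irrelevance.
have mB (U : opens M) x x' y y' h h' h'' :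
    m U (x - x') (y - y') h'' = m U x y h - m U x' y' h'.
  have h0 : mapp (xout X) (-1 *: x' + x) = mapp (xout Y) (-1 *: y' + y).
    by rewrite !mappD !mappZ h h'.
  rewrite [RHS]addrC -[in RHS]scaleN1r -(m_lin _ _ _ _ _ _ _ _ h0).
  by apply: mC; rewrite scaleN1r addrC.
have ht' t (U : opens M) (h : U `<=` P t) x :
  mapp (xout X) x = mapp (xout Y) (happ (tau t) h x) by rewrite tau_out.
have ex t : {s : hom_on E (xmid Z) (P t) | forall (U : opens M) (h : U `<=` P t) x,
    happ s h (mapp (xout X) x) = m U x (happ (tau t) h x) (ht' t U h x)}.
  apply: cid; have [||U w _ [h [x [x0 <-]]]|U e u hU Uu|s sP] := @hom_of_rel _ _ E (xmid Z) (P t)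
    (fun U e w => exists (h : U `<=` P t) x, mapp (xout X) x = e /\
       m U x (happ (tau t) h x) (ht' t U h x) = w).
  - move=> U a e e' w w' _ [h [x [<- <-]]] [h' [x' [<- <-]]]; exists h, (a *: x + x').
    rewrite mappD mappZ; split=> //.
    rewrite -m_lin; first by rewrite mappD mappZ mappD mappZ -!ht'.
    by move=> h0; apply: mC => //; rewrite hlin (happ_irr (tau t) h' h).
  - move=> U V h e w _ [h' [x [<- <-]]]; exists (subset_trans h h'), (mres _ h x).
    rewrite mapp_nat; split=> //.
    rewrite m_nat; first by rewrite -!mapp_nat -ht'.
    by move=> h0; apply: mC => //; apply/esym/hnat.
  - move/x_exact: x0 => [y xy].
    have h0 : mapp (xout X) (mapp (xin X) y) = mapp (xout Y) (mapp (xin Y) y).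
      by rewrite !xout_in.
    by rewrite (mC _ _ _ _ _ _ h0 xy) ?xy ?tau_in // m_in subrr mapp0.
  - have [V [h [x [Vu xe]]]] := xout_surj X e Uu.
    have hV := subset_trans h hU.
    by exists V, h, (m V x (happ (tau t) hV x) (ht' t V hV x)); split=> //; exists hV, x.
  - by exists s => U h x; apply: sP; exists h, x.
have sE t (U : opens M) (h : U `<=` P t) x := svalP (ex t) U h x.
apply: (@splits_ext_edge _ _ _ _ z Z P (fun t => sval (ex t))); split=> //.
  move=> t U h e; apply: mres_sep_pt => u Uu.
  have [V [hV [x [Vu xe]]]] := xout_surj X e Uu; exists V, hV; split=> //.
  by rewrite mapp_nat (hnat _ hV h (subset_trans hV h)) -xe sE m_out.
move=> t u U ht hu htu e; apply: mres_sep_pt => v Uv.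
have [V [hV [x [Vu xe]]]] := xout_surj X e Uv; exists V, hV; split=> //.
have hVt := subset_trans hV ht; have hVu := subset_trans hV hu.
have hVtu := subset_trans hV htu.
rewrite raddfB/= !mapp_nat (hnat _ hV ht hVt) (hnat _ hV hu hVu).
rewrite (hnat (cc z t u) hV htu hVtu) -xe !sE.
have h1 : mapp (xout X) (x - x) =
    mapp (xout Y) (happ (tau u) hVu x - happ (tau t) hVt x) by rewrite !mappB -!ht'.
rewrite -(mB _ _ _ _ _ _ _ h1).
set f := happ (cc z t u) hVtu _.
have h2 : mapp (xout X) (mapp (xin X) 0) = mapp (xout Y) (mapp (xin Y) (- f)).
  by rewrite !xout_in.
rewrite (mC _ _ _ _ _ h1 h2) ?subrr ?mapp0 //; first by rewrite m_in sub0r opprK.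
by rewrite -opprB (tau_z _ _ _ _ _ hVtu) mappN.
Qed.

(** Locally m(x, y) is s_t(x') + f, where x' is the image of x in [E] and f in [F] is the difference
    tau_t(x) - y. Replacing t by u changes the two terms by opposite values of the cocycle, so the
    local formulas agree. *)
Lemma compares_edge_baer z X Y Z P tau : @compares z X Y P tau ->
  ext_edge (H1cl z) Z -> baer_diff X Y Z.
Proof.
move=> [Pt hP tau_in tau_out tau_z] /ext_edge_splits[Q [s [Qt hQ sS sz]]].
pose R (U : opens M) (x : xmid X U) (y : xmid Y U) (w : xmid Z U) :=
  exists t (h : U `<=` P t) (h' : U `<=` Q t) f, happ (tau t) h x - y = mapp (xin Y) f /\
    w = happ (s t) h' (mapp (xout X) x) + mapp (xin Z) f.
have Rnat (U V : opens M) (h : V `<=` U) x y w :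
    R U x y w -> R V (mres _ h x) (mres _ h y) (mres _ h w).
  move=> [t [hU [hU' [f [e ->]]]]].
  exists t, (subset_trans h hU), (subset_trans h hU'), (mres _ h f).
  rewrite -!mapp_nat -e raddfB/= raddfD/= (hnat (tau t) h hU (subset_trans h hU)).
  by rewrite (hnat (s t) h hU' (subset_trans h hU')).
have Runiq (U : opens M) x y w w' : R U x y w -> R U x y w' -> w = w'.
  move=> [t [ht [ht' [f [e ->]]]]] [u [hu [hu' [f' [e' ->]]]]].
  have htu : U `<=` oI (nb z t) (nb z u).
    by rewrite subsetI; split; [exact: subset_trans ht (hP t)|exact: subset_trans hu (hP u)].
  have ff : f - f' = happ (cc z t u) htu (mapp (xout X) x).
    by apply: (@xin_inj _ _ _ _ Y); rewrite mappB -e -e' subrACA subrr subr0 (tau_z _ _ _ _ _ htu).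
  apply/eqP; rewrite -subr_eq0 opprD addrACA -mappB ff -(sz _ _ _ ht' hu' htu).
  by rewrite subrKA subrr.
have gl (U : opens M) x y : mapp (xout X) x = mapp (xout Y) y -> {w : xmid Z U |
    forall (V : opens M) (h : V `<=` U) w', R V (mres _ h x) (mres _ h y) w' ->
      mres (xmid Z) h w = w'}.
  move=> xy; apply: cid.
  have [V W h w hV [h' xyw]|V w w' _ [h xyw] [h' xyw']|t Ut|w wP] := @glue_rel _ _ (xmid Z) U
    (fun V w => exists h : V `<=` U, R V (mres _ h x) (mres _ h y) w).
  - have hWU := subset_trans h h'; exists hWU.
    by rewrite -!(mres_comp h' h hWU); apply: Rnat.
  - by apply: Runiq xyw _; rewrite (Prop_irrelevance h h').
  - pose V := oI U (oI (P t) (Q t)).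
    have hU : V `<=` U := @oIl _ _ _.
    have hVP : V `<=` P t by move=> v [_ []].
    have hVQ : V `<=` Q t by move=> v [_ []].
    have /x_exact[f fE] : mapp (xout Y) (happ (tau t) hVP (mres _ hU x) - mres _ hU y) = 0.
      by rewrite mappB tau_out -!mapp_nat xy subrr.
    exists V, (happ (s t) hVQ (mapp (xout X) (mres _ hU x)) + mapp (xin Z) f).
    by split=> //; exists hU, t, hVP, hVQ, f.
  - by exists w => V h w' xyw; apply: wP; exists h.
pose m U x y h := sval (gl U x y h).
have mE U x y h w : R U x y w -> m U x y h = w.
  by have := svalP (gl U x y h) U (@subset_refl _ U) w; rewrite !mres_id.
have mP (U : opens M) x y h v : oset U v -> exists (V : opens M) (hV : V `<=` U),
    oset V v /\ R V (mres _ hV x) (mres _ hV y) (mres _ hV (m U x y h)).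
  move=> Uv; pose V := oI U (oI (P v) (Q v)).
  have hU : V `<=` U := @oIl _ _ _.
  have hVP : V `<=` P v by move=> ? [_ []].
  have hVQ : V `<=` Q v by move=> ? [_ []].
  have /x_exact[f fE] : mapp (xout Y) (happ (tau v) hVP (mres _ hU x) - mres _ hU y) = 0.
    by rewrite mappB tau_out -!mapp_nat h subrr.
  have xyw : R V (mres _ hU x) (mres _ hU y)
      (happ (s v) hVQ (mapp (xout X) (mres _ hU x)) + mapp (xin Z) f).
    by exists v, hVP, hVQ, f.
  by exists V, hU; split=> //; rewrite (svalP (gl U x y h) V hU _ xyw).
have Rlin (U : opens M) t (hP' : U `<=` P t) (hQ' : U `<=` Q t) (a : A U) x x' y y' w w' :
    R U x y w -> R U x' y' w' -> R U (a *: x + x') (a *: y + y') (a *: w + w').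
  move=> xyw xyw'.
  (* The two summands may be described with different indices; a description with index u becomes
     one with index t when the cocycle is added to f. *)
  have norm x0 y0 w0 : R U x0 y0 w0 -> exists f, happ (tau t) hP' x0 - y0 = mapp (xin Y) f /\
      w0 = happ (s t) hQ' (mapp (xout X) x0) + mapp (xin Z) f.
    move=> [u [hu [hu' [f [e we]]]]].
    have htu : U `<=` oI (nb z t) (nb z u).
      by rewrite subsetI; split; [exact: subset_trans hP' (hP t)|exact: subset_trans hu (hP u)].
    exists (f + happ (cc z t u) htu (mapp (xout X) x0)).
    rewrite !mappD -e -(tau_z _ _ _ hP' hu htu) we -(sz _ _ _ hQ' hu' htu).
    split; first by rewrite [RHS]addrC subrKA.
    by rewrite [RHS]addrCA [X in _ = _ + X]addrC subrK addrC.
  have [f [e1 e2]] := norm _ _ _ xyw; have [f' [e1' e2']] := norm _ _ _ xyw'.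
  exists t, hP', hQ', (a *: f + f'); split.
    by rewrite hlin opprD addrACA -scalerBr e1 e1' mappD mappZ.
  by rewrite e2 e2' !mappD !mappZ hlin scalerDr addrACA.
exists m; split.
- move=> U a x x' y y' h h' h''; apply: mres_sep_pt => v Uv.
  have [V [hV [Vv r]]] := mP U x y h v Uv.
  have [V' [hV' [Vv' r']]] := mP U x' y' h' v Uv.
  pose W := oI (oI V V') (oI (P v) (Q v)).
  have hWV : W `<=` V by move=> ? [[]].
  have hWV' : W `<=` V' by move=> ? [[]].
  have hWP : W `<=` P v by move=> ? [_ []].
  have hWQ : W `<=` Q v by move=> ? [_ []].
  have hW := subset_trans hWV hV.
  exists W, hW; split=> //; apply: (svalP (gl U _ _ h'')).
  rewrite !raddfD/= !mresZ; apply: (Rlin W v hWP hWQ).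
    by rewrite -!(mres_comp hV hWV hW); apply: Rnat.
  by rewrite -!(mres_comp hV' hWV' hW); apply: Rnat.
- move=> U V hVU x y h h'; apply: mres_sep_pt => v Vv.
  have [W [hW [Wv r]]] := mP V _ _ h' v Vv.
  exists W, hW; split=> //; have hWU := subset_trans hW hVU.
  rewrite (mres_comp hVU hW hWU); apply: (svalP (gl U _ _ h)).
  by rewrite -!(mres_comp hVU hW hWU).
- move=> U x y h; apply: mres_sep_pt => v Uv.
  have [V [hV [Vv [t [ht [ht' [f [_ e]]]]]]]] := mP U x y h v Uv.
  by exists V, hV; split=> //; rewrite !mapp_nat e mappD sS xout_in addr0.
- move=> U f g h; apply: mres_sep_pt => v Uv.
  have hV := @oIl _ U (oI (P v) (Q v)).
  have hVP : oI U (oI (P v) (Q v)) `<=` P v by move=> ? [_ []].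
  have hVQ : oI U (oI (P v) (Q v)) `<=` Q v by move=> ? [_ []].
  exists (oI U (oI (P v) (Q v))), hV; split=> //; apply: (svalP (gl U _ _ h)).
  exists v, hVP, hVQ, (mres _ hV (f - g)).
  by rewrite !mapp_nat tau_in xout_in happ0 add0r raddfB/= !mappB.
Qed.

(** Locally split representatives of the two classes are locally isomorphic with defect z - z', so
    both directions reduce to the comparison of Baer differences with the edge map. *)
Lemma ext_edge_sub (c d : H1 (sheafHom E F)) :
  ext_edge (c - d) = ext_sub (ext_edge c) (ext_edge d).
Proof.
rewrite -(H1cl_repr c) -(H1cl_repr d); set z := repr c; set z' := repr d.
have -> : H1cl z - H1cl z' = H1cl (cc_add z (cc_opp z')).
  by rewrite -H1_addE -H1_oppE.
have cmp X Y P P' s s' : @splits _ _ _ _ z X P s -> @splits _ _ _ _ z' Y P' s' ->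
    exists tau, @compares (cc_add z (cc_opp z')) X Y (fun t => oI (P t) (P' t)) tau.
  move=> sX sY; have [Pt hP _ _] := sX; have [Pt' hP' _ _] := sY.
  have [tau [tau_in tau_out tau_z]] := compare_splits sX sY; exists tau; split=> //.
    by move=> t; apply: setISS.
  move=> t u U ht hu htu x.
  have h : U `<=` oI (nb z t) (nb z u) := subset_trans htu (@oI_sub4 _ _ _ _ _).
  have h' : U `<=` oI (nb z' t) (nb z' u) := subset_trans htu (@oI_sub4' _ _ _ _ _).
  rewrite (tau_z _ _ _ _ _ h h'); congr mapp.
  by congr (_ - _); apply: happ_irr.
apply: funext => Z; apply: propext; split=> [cdZ|[X [Y [cX dY XYZ]]]].
  have [X [P [s sX]]] := splits_exists z; have [Y [P' [s' sY]]] := splits_exists z'.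
  have [tau XY] := cmp _ _ _ _ _ _ sX sY; exists X, Y; split.
  - exact: splits_ext_edge sX.
  - exact: splits_ext_edge sY.
  - exact: compares_edge_baer XY cdZ.
have [P [s sX]] := ext_edge_splits cX; have [P' [s' sY]] := ext_edge_splits dY.
have [tau XY] := cmp _ _ _ _ _ _ sX sY.
exact: compares_baer_edge XY XYZ.
Qed.

End Comparison.

Section Obstruction.
Variables (E E' F F' : mod_sheaf A) (XE : extension E E') (XF : extension F F').
Variables (f : mor E F) (f' : mor E' F').
Variables (z : cocycle1 (sheafHom E F')) (P : M -> opens M).
Variable g : forall t, hom_on (xmid XE) (xmid XF) (P t).
Hypothesis Pt : forall t, oset (P t) t.
Hypothesis hP : forall t, P t `<=` nb z t.
Hypothesis g_in : forall t (U : opens M) (h : U `<=` P t) y,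
  happ (g t) h (mapp (xin XE) y) = mapp (xin XF) (mapp f' y).
Hypothesis g_out : forall t (U : opens M) (h : U `<=` P t) x,
  mapp (xout XF) (happ (g t) h x) = mapp f (mapp (xout XE) x).
Hypothesis g_z : forall t u (U : opens M) (ht : U `<=` P t) (hu : U `<=` P u)
  (htu : U `<=` oI (nb z t) (nb z u)) x,
  happ (g t) ht x - happ (g u) hu x = mapp (xin XF) (happ (cc z t u) htu (mapp (xout XE) x)).

Let lift (U : opens M) (e : E U) t : oset U t ->
  exists (V : opens M) (h : V `<=` U) (x : xmid XF V),
    oset V t /\ mapp (xout XF) x = mapp f (mres E h e).
Proof.
move=> Ut; have [V [h [x [Vt xe]]]] := xout_surj XF (mapp f e) Ut.
by exists V, h, x; split=> //; rewrite xe mapp_nat.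
Qed.

(** For the zero cocycle the local projections of the twist agree, hence glue. *)
Lemma pullback_exists : exists (Y : extension E F') (q : mor (xmid Y) (xmid XF)),
  hom_comp q (xin Y) = xin XF /\ hom_comp (xout XF) q = hom_comp f (xout Y).
Proof.
have [Y [p [p_in p_out p_tw]]] :=
  twist_exists (cc0 (sheafHom E F')) (@xin_inj _ _ _ _ XF) (@x_exact _ _ _ _ XF) lift.
have [//|t u U ht hu x|q qP] := @hom_glue _ _ _ _ _ p.
  have htu : U `<=` oI (nb (cc0 (sheafHom E F')) t) (nb (cc0 (sheafHom E F')) u) by [].
  by apply/eqP; rewrite -subr_eq0 (p_tw u t U hu ht htu) /= mapp0.
exists Y, q; split; apply: mor_ext => U x; apply: mres_sep_pt => t Ut;
  have hU : U `<=` oT M by [];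
  exists U, (@subset_refl _ U); split=> //; rewrite !mapp_comp (qP t U hU).
  by rewrite p_in.
by rewrite p_out.
Qed.

(** The pushout along f' is locally the pullback along f, by means of the g_t, with gluing defect z.
    Accordingly the twist of the pullback by -z receives a map from [XE]: since g_u - g_t = -z_tu,
    the universal property of the twist applies to the g_t. *)
Lemma pushout_exists : exists (X : extension E F') (q : mor (xmid XE) (xmid X)),
  hom_comp q (xin XE) = hom_comp (xin X) f' /\ hom_comp (xout X) q = xout XE.
Proof.
have [X [p Xp]] :=
  twist_exists (cc_opp z) (@xin_inj _ _ _ _ XF) (@x_exact _ _ _ _ XF) lift.
have [p_in p_out _] := Xp.
have [||q [q_out q_p]] :=
  twist_lift (@xin_inj _ _ _ _ XF) (@x_exact _ _ _ _ XF) Xp (q := xout XE) (r := g) Pt hP.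
- by move=> t U h x; rewrite g_out.
- by move=> t u U ht hu htu x; rewrite -opprB (g_z _ _ htu) -mappN.
exists X, q; split=> //; apply: mor_ext => U y; apply: mres_sep_pt => t Ut.
have hU := @oIl _ U (P t); have hN := @oIr _ U (P t); have hz := subset_trans hN (@hP t).
exists (oI U (P t)), hU; split=> //; rewrite !mapp_comp !mapp_nat.
apply: (twist_uniq (@xin_inj _ _ _ _ XF) Xp (h := hz)).
  by rewrite -mapp_comp q_out !xout_in.
by rewrite (q_p t _ hN) g_in p_in.
Qed.

(** Sections of [X] are locally sums q(e) + k with k in F'; tau_t sends such a sum to the y with the
    same image in [E] and q'(y) = g_t(e) + k. Arbitrary [X] and [Y] are treated because the Yoneda
    products contain all representatives. *)
Lemma compares_pushout_pullback (X Y : extension E F') (q : mor (xmid XE) (xmid X))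
    (q' : mor (xmid Y) (xmid XF)) :
  hom_comp q (xin XE) = hom_comp (xin X) f' -> hom_comp (xout X) q = xout XE ->
  hom_comp q' (xin Y) = xin XF -> hom_comp (xout XF) q' = hom_comp f (xout Y) ->
  exists tau, @compares _ _ z X Y P tau.
Proof.
move=> q_in q_out q'_in q'_out.
have {}q_in U y : mapp q (mapp (xin XE) y) = mapp (xin X) (mapp f' (y : E' U)).
  by rewrite -!mapp_comp q_in.
have {}q_out U x : mapp (xout X) (mapp q x) = mapp (xout XE) (x : xmid XE U).
  by rewrite -!mapp_comp q_out.
have {}q'_in U y : mapp q' (mapp (xin Y) y) = mapp (xin XF) (y : F' U).
  by rewrite -!mapp_comp q'_in.
have {}q'_out U x : mapp (xout XF) (mapp q' x) = mapp f (mapp (xout Y) (x : xmid Y U)).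
  by rewrite -!mapp_comp q'_out.
have q'_inj U (x x' : xmid Y U) :
    mapp (xout Y) x = mapp (xout Y) x' -> mapp q' x = mapp q' x' -> x = x'.
  move=> e e'; apply/eqP; rewrite -subr_eq0; apply/eqP.
  have /x_exact[y xy] : mapp (xout Y) (x - x') = 0 by rewrite mappB e subrr.
  rewrite xy -(mapp0 (xin Y)); congr mapp; apply: (@xin_inj _ _ _ _ XF).
  by rewrite -q'_in -xy mappB e' subrr mapp0.
(* Two ways of writing a sum q(e) + k differ by a section v of E' with f'(v) = k0 - k, and g_t is f'
   on E'. *)
have gwd t (U : opens M) (h : U `<=` P t) e e0 k k0 :
    mapp q e + mapp (xin X) k = mapp q e0 + mapp (xin X) k0 ->
    happ (g t) h e + mapp (xin XF) k = happ (g t) h e0 + mapp (xin XF) k0.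
  move=> ek.
  have d : mapp q (e - e0) = mapp (xin X) (k0 - k).
    rewrite !mappB -[mapp q e](addrK (mapp (xin X) k)) ek.
    by rewrite addrAC [mapp q e0 + _]addrC addrK.
  have /x_exact[v ev] : mapp (xout XE) (e - e0) = 0 by rewrite -q_out d xout_in.
  have fv : mapp f' v = k0 - k by apply: (@xin_inj _ _ _ _ X); rewrite -q_in -ev d.
  rewrite -(subrK (happ (g t) h e0) (happ (g t) h e)) -happB ev g_in fv mappB.
  by rewrite addrAC subrK addrC.
pose R t (U : opens M) (x : xmid X U) (y : xmid Y U) := exists (h : U `<=` P t) e k,
  [/\ x = mapp q e + mapp (xin X) k, mapp (xout Y) y = mapp (xout X) x &
      mapp q' y = happ (g t) h e + mapp (xin XF) k].
have Rnat t (U V : opens M) (h : V `<=` U) x y :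
    R t U x y -> R t V (mres _ h x) (mres _ h y).
  move=> [hU [e [k [xe yx qy]]]].
  exists (subset_trans h hU), (mres _ h e), (mres _ h k); split.
  - by rewrite -!mapp_nat -raddfD -xe.
  - by rewrite -!mapp_nat yx.
  - by rewrite -!mapp_nat -(hnat (g t) h hU) -raddfD qy.
have Rex t (U : opens M) x u : U `<=` P t -> oset U u ->
    exists (V : opens M) (h : V `<=` U) y, oset V u /\ R t V (mres _ h x) y.
  move=> hU Uu; have [V [h [e [Vu ex]]]] := xout_surj XE (mapp (xout X) x) Uu.
  have hV := subset_trans h hU.
  have /x_exact[k xk] : mapp (xout X) (mres _ h x - mapp q e) = 0.
    by rewrite mappB q_out ex -mapp_nat subrr.
  have [V' [h' [y [Vu' yx]]]] := xout_surj Y (mapp (xout X) (mres _ h x)) Vu.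
  have hV' := subset_trans h' hV.
  pose e' := mres _ h' e; pose k' := mres _ h' k.
  have /x_exact[v vE] :
      mapp (xout XF) (happ (g t) hV' e' + mapp (xin XF) k' - mapp q' y) = 0.
    by rewrite mappB mappD g_out xout_in addr0 q'_out yx /e' -[mapp (xout XE) _]mapp_nat ex
      mapp_nat subrr.
  have hU' := subset_trans h' h.
  exists V', hU', (y + mapp (xin Y) v); split=> //; exists hV', e', k'; split.
  - rewrite -(mres_comp h h' hU') -(subrK (mapp q e) (mres _ h x)) xk raddfD/= !mapp_nat.
    by rewrite addrC.
  - by rewrite mappD xout_in addr0 yx mapp_nat (mres_comp h h' hU').
  - by rewrite mappD q'_in -vE addrC subrK.
have ex t : {tau : hom_on (xmid X) (xmid Y) (P t) |
    forall (U : opens M) (h : U `<=` P t) x y, R t U x y -> happ tau h x = y}.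
  apply: cid; apply: hom_of_rel.
  - move=> U a x x' y y' _ [h [e [k [-> yx qy]]]] [h' [e' [k' [-> yx' qy']]]].
    exists h, (a *: e + e'), (a *: k + k'); split.
    + by rewrite !mappD !mappZ scalerDr addrACA.
    + by rewrite mappD mappZ yx yx' [in RHS]mappD mappZ.
    + by rewrite mappD mappZ qy qy' hlin (happ_irr (g t) h' h) mappD mappZ scalerDr addrACA.
  - by move=> U V h x y _; apply: Rnat.
  - move=> U y _ [h [e [k [xe yx qy]]]].
    apply: q'_inj; first by rewrite yx !mapp0.
    rewrite qy (gwd t U h e 0 k 0) ?happ0 ?mapp0 ?addr0 //.
  - by move=> U x u; apply: Rex.
have loc t (U : opens M) (h : U `<=` P t) x u : oset U u ->
    exists (V : opens M) (hV : V `<=` U), oset V u /\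
      R t V (mres _ hV x) (mres _ hV (happ (sval (ex t)) h x)).
  move=> Uu; have [V [hV [y [Vu xy]]]] := Rex t U x u h Uu; exists V, hV; split=> //.
  by rewrite (hnat _ hV h (subset_trans hV h)) (svalP (ex t) _ _ _ _ xy).
have tau_out t (U : opens M) (h : U `<=` P t) x :
    mapp (xout Y) (happ (sval (ex t)) h x) = mapp (xout X) x.
  apply: mres_sep_pt => u Uu; have [V [hV [Vu [_ [_ [_ [_ e _]]]]]]] := loc t U h x u Uu.
  by exists V, hV; split=> //; rewrite !mapp_nat.
have tauq t (U : opens M) (h : U `<=` P t) x e k : x = mapp q e + mapp (xin X) k ->
    mapp q' (happ (sval (ex t)) h x) = happ (g t) h e + mapp (xin XF) k.
  move=> xek; apply: mres_sep_pt => u Uu.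
  have [V [hV [Vu [hVt [e0 [k0 [xe0 _ qe0]]]]]]] := loc t U h x u Uu; exists V, hV; split=> //.
  rewrite mapp_nat qe0 raddfD/= mapp_nat (hnat _ hV h hVt); apply: gwd.
  by rewrite -xe0 xek raddfD/= !mapp_nat.
exists (fun t => sval (ex t)); split=> //.
- move=> t U h y; apply: (svalP (ex t)); exists h, 0, y.
  by rewrite mapp0 add0r !xout_in q'_in happ0 add0r.
- move=> t u U ht hu htu x; apply: q'_inj; first by rewrite mappB !tau_out subrr xout_in.
  rewrite mappB q'_in; apply: mres_sep_pt => v Uv.
  have [V [hV [Vv [hVt [e [k [xe _ qe]]]]]]] := loc t U ht x v Uv.
  have hVu := subset_trans hV hu; have hVtu := subset_trans hV htu.
  exists V, hV; split=> //; rewrite raddfB/= !mapp_nat qe (hnat _ hV hu hVu).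
  have -> : mapp q' (happ (sval (ex u)) hVu (mres _ hV x)) = happ (g u) hVu e + mapp (xin XF) k.
    exact: tauq.
  rewrite opprD addrACA subrr addr0 (g_z _ _ hVtu) (hnat _ hV htu hVtu).
  by rewrite mapp_nat xe !mappD q_out xout_in addr0.
Qed.

Lemma obstruction_edge :
  ext_sub (yoneda_l f' (Ext1_cl XE)) (yoneda_r (Ext1_cl XF) f) = ext_edge (H1cl z).
Proof.
apply: funext => Z; apply: propext; split=> [[X [Y [cX cY XYZ]]]|cZ].
  have [XE' [u [u_in u_out]] [q [q_in q_out]]] := cX.
  have [XF' [v [v_in v_out]] [q' [q'_in q'_out]]] := cY.
  (* The isomorphism given by the class goes from [XF] to XF', whereas the map out of [Y] has to be
     brought back to [XF]. *)
  have [v' [v'_in v'_out]] := ext_iso_sym (ex_intro _ v (conj v_in v_out)).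
  have [|||| tau XY] := @compares_pushout_pullback X Y (hom_comp q u) (hom_comp v' q').
  - by rewrite -hom_compA u_in.
  - by rewrite hom_compA q_out.
  - by rewrite -hom_compA q'_in.
  - by rewrite hom_compA v'_out.
  exact: compares_baer_edge XY XYZ.
have [X [q [q_in q_out]]] := pushout_exists.
have [Y [q' [q'_in q'_out]]] := pullback_exists.
have [tau XY] := compares_pushout_pullback q_in q_out q'_in q'_out.
have refl (G G' : mod_sheaf A) (T : extension G G') : ext_iso T T.
  by exists (hom_id (xmid T) (oT M)); split; apply: mor_ext.
exists X, Y; split.
- by exists XE; [apply: refl|exists q].
- by exists XF; [apply: refl|exists q'].
- exact: compares_edge_baer XY cZ.
Qed.

End Obstruction.
End Baer.

(** * Local constructions *)

Section FirstCohomology.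
Variables (M : topologicalType) (G H : ab_sheaf M) (f : ab_mor G H).

Lemma cc_map_coh (c d : cocycle1 G) :
  cohomologous c d -> cohomologous (cc_map f c) (cc_map f d).
Proof.
move=> [P [b [Pt hP cd]]]; exists P, (fun t => f _ (b t)); split=> //.
by move=> t u W ht hu hc hd; rewrite !amap_nat -!raddfB (cd t u W ht hu hc hd).
Qed.

Lemma H1_mapE (c : cocycle1 G) : H1_map f (H1cl c) = H1cl (cc_map f c).
Proof. by apply/H1clP/cc_map_coh/H1clP; rewrite H1cl_repr. Qed.

Lemma H1_mapB (u v : H1 G) : H1_map f (u - v) = H1_map f u - H1_map f v.
Proof.
have subE (A : ab_sheaf M) (c d : cocycle1 A) :
  H1cl c - H1cl d = H1cl (cc_add c (cc_opp d)) by rewrite -H1_addE -H1_oppE.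
rewrite -(H1cl_repr u) -(H1cl_repr v) subE !H1_mapE subE.
apply/H1clP/coh_agree => x y W hc hd /=.
by rewrite (Prop_irrelevance hc hd) !(raddfD, raddfN)/= !amap_nat.
Qed.

(** Surjectivity on sections lifts the bounding cochain, and injectivity shows that the lift still
    bounds. *)
Lemma H1_map_inj :
  (forall U : opens M, injective (f U)) -> (forall (U : opens M) (y : H U), exists x, f U x = y) ->
  injective (H1_map f).
Proof.
move=> fI fS u v; rewrite -(H1cl_repr u) -(H1cl_repr v) !H1_mapE.
move=> /H1clP[P [b [Pt hP cd]]]; apply/H1clP.
exists P, (fun t => sval (cid (fS _ (b t)))); split=> // t u' W ht hu hc hd.
by apply: fI; rewrite !raddfB/= -!amap_nat !(svalP (cid (fS _ _))); apply: cd.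
Qed.

End FirstCohomology.

Section LocalLifting.
Variables (M : topologicalType) (A : ring_sheaf M).

Lemma near_forall_ord (t : M) (r : nat) (Q : 'I_r -> opens M -> Prop) :
  (forall i (U V : opens M), V `<=` U -> Q i U -> Q i V) ->
  (forall i, exists U : opens M, oset U t /\ Q i U) ->
  exists U : opens M, oset U t /\ forall i, Q i U.
Proof.
move=> Qmono Qex.
suff [U [Ut QU]] : exists U : opens M, oset U t /\ forall i, i \in enum 'I_r -> Q i U.
  by exists U; split=> // i; apply: QU; rewrite mem_enum.
elim: (enum _) => [|i s [U [Ut QU]]]; first by exists (oT M).
have [V [Vt QV]] := Qex i; exists (oI U V); split=> // j.
rewrite inE => /orP[/eqP ->|js]; first exact: Qmono (@oIr _ U V) QV.
exact: Qmono (@oIl _ U V) (QU j js).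
Qed.

(** Lifts of the images of a local basis are extended linearly. Relations among the basis sections
    have coefficients in [J], which kills [G], so the extension is well defined. *)
Lemma loc_free_lift (J : forall U : opens M, A U -> Prop) (L G B : mod_sheaf A)
    (p : mor G B) (f : mor L B) :
  loc_free J L -> loc_surj p ->
  (forall (U : opens M) (a : A U) (x : G U), J U a -> a *: x = 0) ->
  forall t, exists (N : opens M) (g : hom_on L G N), oset N t /\
    forall (U : opens M) (h : U `<=` N) x, mapp p (happ g h x) = mapp f x.
Proof.
move=> Lfree pS Jkill t; have [U [r [e [Ut eI eG]]]] := Lfree t.
have [i V W hWV [hV [x xe]]|i|N [Nt NP]] := @near_forall_ord t r
  (fun i V => exists (h : V `<=` U) (x : G V), mapp p x = mapp f (mres L h (e i))).
- exists (subset_trans hWV hV), (mres G hWV x).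
  by rewrite -mapp_nat xe mapp_nat (mres_comp _ _ (subset_trans hWV hV)).
- have [V [h [x [Vt xe]]]] := pS U (mapp f (e i)) t Ut.
  by exists V; split=> //; exists h, x; rewrite xe mapp_nat.
pose W := oI N U; have hWN : W `<=` N := @oIl _ _ _; have hWU : W `<=` U := @oIr _ _ _.
have {}NP i : {x : G W | mapp p x = mapp f (mres L hWU (e i))}.
  apply: cid; have [h [x xe]] := NP i; exists (mres G hWN x).
  by rewrite -mapp_nat xe mapp_nat (mres_comp _ _ hWU).
pose g i := sval (NP i).
have [||V y _ [h [c [c0 ->]]]|V x u hV Vu|q qP] := @hom_of_rel _ _ L G W (fun V x y =>
    exists (h : V `<=` W) (c : 'I_r -> A V),
      x = \sum_i c i *: mres L (subset_trans h hWU) (e i) /\ y = \sum_i c i *: mres G h (g i)).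
- move=> V a x x' y y' _ [h [c [-> ->]]] [h' [c' [-> ->]]].
  exists h, (fun i => a * c i + c' i).
  rewrite !scaler_sumr -!big_split /= (Prop_irrelevance h' h).
  by split; apply: eq_bigr => i _; rewrite scalerDl scalerA.
- move=> V V' h x y _ [hV [c [-> ->]]].
  exists (subset_trans h hV), (fun i => rres A h (c i)); rewrite !raddf_sum/=.
  split; apply: eq_bigr => i _; rewrite mresZ; congr (_ *: _); exact: mres_comp.
- rewrite big1 // => i _; apply: Jkill.
  by have/eI := esym c0; apply.
- have [V' [hV' [hU [c [Vu' xE]]]]] := eG V (subset_trans hV hWU) x u Vu.
  have hW := subset_trans hV' hV.
  exists V', hV', (\sum_i c i *: mres G hW (g i)); split=> //; exists hW, c; split=> //.
  by rewrite xE; apply: eq_bigr => i _; congr (_ *: mres _ _ _); apply: Prop_irrelevance.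
exists W, q; split; first by split.
move=> V h x; apply: mres_sep_pt => u Vu.
have [V' [hV' [hU [c [Vu' xE]]]]] := eG V (subset_trans h hWU) x u Vu.
have hW := subset_trans hV' h; exists V', hV'; split=> //.
rewrite !mapp_nat (hnat q hV' h hW) (qP _ hW _ (\sum_i c i *: mres G hW (g i))); last first.
  exists hW, c; split=> //.
  by rewrite xE; apply: eq_bigr => i _; congr (_ *: mres _ _ _); apply: Prop_irrelevance.
have mapp_sum (X X' : mod_sheaf A) (k : mor X X') (v : 'I_r -> X V') :
    mapp k (\sum_i v i) = \sum_i mapp k (v i).
  exact: (big_morph (fun x => mapp k x) (fun x y => mappD k x y) (mapp0 k V')).
rewrite xE !mapp_sum; apply: eq_bigr => i _; rewrite !mappZ -mapp_nat (svalP (NP i)).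
by rewrite mapp_nat (mres_comp _ _ hU).
Qed.

Section LocalIso.
Variables (L' L : mod_sheaf A) (N : M -> opens M) (p : forall t, hom_on L' L (N t)).
Hypothesis Nt : forall t, oset (N t) t.
Hypothesis p_inj : forall t (U : opens M) (h : U `<=` N t), injective (happ (p t) h).
Hypothesis p_surj : forall t (U : opens M) (h : U `<=` N t) y, exists x, happ (p t) h x = y.

Lemma loc_free_local_iso (J : forall U : opens M, A U -> Prop) :
  loc_free J L -> loc_free J L'.
Proof.
move=> Lfree t; have [U [r [e [Ut eI eG]]]] := Lfree t.
pose W := oI U (N t); have hU : W `<=` U := @oIl _ _ _; have hN : W `<=` N t := @oIr _ _ _.
have e'P i := cid (p_surj hN (mres L hU (e i))).
have pe (V : opens M) (h : V `<=` W) (hV : V `<=` N t) (hVU : V `<=` U) (c : 'I_r -> A V) :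
    happ (p t) hV (\sum_i c i *: mres L' h (sval (e'P i))) = \sum_i c i *: mres L hVU (e i).
  rewrite (big_morph _ (happD (p t) hV) (happ0 (p t) hV)); apply: eq_bigr => i _.
  by rewrite happZ -(hnat (p t) h hN) (svalP (e'P i)) (mres_comp _ _ hVU).
exists W, r, (fun i => sval (e'P i)); split=> //.
- move=> V h c; have hV := subset_trans h hN; have hVU := subset_trans h hU.
  rewrite -(eI V hVU) -(pe V h hV); split=> [->|c0]; first exact: happ0.
  by apply: (p_inj (h := hV)); rewrite c0 happ0.
- move=> V h x u Vu; have hV := subset_trans h hN; have hVU := subset_trans h hU.
  have [V' [h' [h'' [c [Vu' xE]]]]] := eG V hVU (happ (p t) hV x) u Vu.
  have hW := subset_trans h' h; have hVN := subset_trans hW hN.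
  exists V', h', hW, c; split=> //; apply: (p_inj (h := hVN)).
  by rewrite -(hnat (p t) h' hV) xE (pe V' hW hVN h'').
Qed.

Variables (K : fieldType) (P : psalg K A).

Lemma hdiv_local (E : mod_sheaf A) m (U : opens M) (x : E U) :
  (forall t, oset U t -> exists (V : opens M) (h : V `<=` U), oset V t /\ hdiv P m (mres E h x)) ->
  hdiv P m x.
Proof.
move=> xloc t Ut; have [V [h [Vt /(_ t Vt)[W [hW [y [Wt yE]]]]]]] := xloc t Ut.
by exists W, (subset_trans hW h), y; split=> //; rewrite -(mres_comp h hW).
Qed.

Lemma hdiv_res (E : mod_sheaf A) m (U V : opens M) (h : V `<=` U) (x : E U) :
  hdiv P m x -> hdiv P m (mres E h x).
Proof.
move=> xm t Vt; have [W [hW [y [Wt yE]]]] := xm t (h t Vt).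
have hI : oI V W `<=` U := subset_trans (@oIr _ V W) hW.
exists (oI V W), (@oIl _ V W), (mres E (@oIr _ V W) y); split=> //.
by rewrite (mres_comp _ _ hI) -(mres_comp hW (@oIr _ V W) hI) yE mres_hbarX.
Qed.

Lemma hdiv_hom t m (U : opens M) (h : U `<=` N t) (x : L' U) :
  hdiv P m (happ (p t) h x) <-> hdiv P m x.
Proof.
split=> xm u Uu; have [V [hV [y [Vu yE]]]] := xm u Uu; have hVt := subset_trans hV h.
  have [z zE] := p_surj hVt y; exists V, hV, z; split=> //; apply: (p_inj (h := hVt)).
  by rewrite -(hnat (p t) hV h) yE happZ zE.
by exists V, hV, (happ (p t) hVt y); rewrite (hnat (p t) hV h hVt) yE happZ.
Qed.

(** Divisibility by hbar^m is local, so it can be tested through the local isomorphisms. In this way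
    the kernels of reductions of a twist are computed. *)
Lemma hdiv_local_iso m (U : opens M) (x : L' U) :
  hdiv P m x <-> forall t (V : opens M) (h : V `<=` U) (ht : V `<=` N t),
    hdiv P m (happ (p t) ht (mres L' h x)).
Proof.
split=> [xm t V h ht|xm]; first by apply/hdiv_hom/hdiv_res.
apply: hdiv_local => t Ut; exists (oI U (N t)), (@oIl _ _ _); split=> //.
by apply/(hdiv_hom _ (@oIr _ U (N t))).
Qed.

End LocalIso.

End LocalLifting.

(** * Twists of quantizations *)

(** A linear map to a module killed by hbar^m vanishes on hbar^m L. This is what identifies Hom(E_k,
    F_s) with Hom(E_s, F_s). *)
Lemma reduction_descend (M : topologicalType) (K : fieldType) (A : ring_sheaf M)
    (P : psalg K A) m (L L' G : mod_sheaf A) (p : mor L L') (W : opens M) (f : hom_on L G W) :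
  reduction P m p -> (forall (U : opens M) (x : G U), hbar P U ^+ m *: x = 0) ->
  exists g : hom_on L' G W, forall (U : opens M) (h : U `<=` W) x,
    happ g h (mapp p x) = happ f h x.
Proof.
move=> [pS pker] Gkill; apply: hom_descend => // U h x /pker xm.
apply: mres_sep_pt => t Ut; have [V [hV [y [Vt yE]]]] := xm t Ut; exists V, hV; split=> //.
by rewrite (hnat f hV h (subset_trans hV h)) yE happZ Gkill raddf0.
Qed.

Section Quantizations.
Variables (M : topologicalType) (K : fieldType) (O : ring_sheaf M) (KO : kalg K O).
Variables (w : two_form KO) (A : def_quant w).

Lemma quant_kill (E : mod_sheaf O) n (Q : quantization A E n) (U : opens M) (x : Q U) :
  hbar (dq_ps A) U ^+ n.+1 *: x = 0.
(* The exponent is split as 0 + (n+1), which computes to n+1. *)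
Proof. by apply: (@loc_free_kill _ _ _ _ n.+1 0); apply: q_free. Qed.

Lemma hdivA_kill (E : mod_sheaf O) n (Q : quantization A E n) (U : opens M) (a : A U) (x : Q U) :
  hdivA n.+1 a -> a *: x = 0.
Proof.
move=> an; apply: mres_sep_pt => t Ut; have [V [hV [b [Vt bE]]]] := an t Ut.
exists V, hV; split=> //; rewrite mresZ raddf0.
by have -> : rres A hV a = hbar (dq_ps A) V ^+ n.+1 * b by []; rewrite -scalerA quant_kill.
Qed.

Lemma quant_lift (E F : mod_sheaf O) l k (El : quantization A E l) (Ek : quantization A E k)
    (Fl : quantization A F l) (Fk : quantization A F k) (pE : extends El Ek) (pF : extends Fl Fk)
    (f : mor Ek Fk) t :
  exists (N : opens M) (g : hom_on El Fl N), oset N t /\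
    forall (U : opens M) (h : U `<=` N) x,
      mapp (ext_red pF) (happ g h x) = mapp f (mapp (ext_red pE) x).
Proof.
have [N [g [Nt gP]]] := loc_free_lift (hom_comp f (ext_red pE)) (q_free El)
  (proj1 (ext_redP pF)) (fun U a x => @hdivA_kill _ _ Fl U a x) t.
by exists N, g; split=> // U h x; rewrite gP.
Qed.

Section Extension.
Variables (E : mod_sheaf O) (l k s : nat).
Variables (El : quantization A E l) (Ek : quantization A E k) (Es : quantization A E s).
Variables (pE : extends El Ek) (rE : extends Ek Es).
Hypothesis hl : (k.+1 + s.+1 = l.+1)%N.
Hypothesis sk : (s <= k)%N.

Let i := hbar_incl pE rE hl sk.
Let p := ext_red pE.

Lemma twist_lift_id (U : opens M) (e : Ek U) t : oset U t ->
  exists (V : opens M) (h : V `<=` U) (g : El V),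
    oset V t /\ mapp p g = mapp (hom_id Ek (oT M)) (mres Ek h e).
Proof. exact: (proj1 (ext_redP pE)). Qed.

Variables (c : cocycle1 (sheafHom Ek Es)) (X : extension Ek Es).
Variable pi : forall t, hom_on (xmid X) El (nb c t).
Hypothesis Xpi : is_twist i p (hom_id Ek (oT M)) pi.

Let i_inj (U : opens M) : injective (@mapp _ _ _ _ i U).
Proof. exact: hbar_incl_inj. Qed.

Let ip_exact (U : opens M) (z : El U) : mapp p z = 0 <-> exists y : Es U, z = mapp i y.
Proof. exact: hbar_incl_exact. Qed.

Let pi_out t (U : opens M) (h : U `<=` nb c t) x :
  mapp p (happ (pi t) h x) = mapp (xout X) x.
Proof. by have [_ e _] := Xpi; rewrite e. Qed.

Let pi_inj t (U : opens M) (h : U `<=` nb c t) : injective (happ (pi t) h).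
Proof. by move=> x y xy; apply: (twist_uniq i_inj Xpi (h := h)) => //; rewrite -!(pi_out h) xy. Qed.

(** Along the identity of [Ek] the pullback is [El] itself: the inverse of [pi t] is the map to the
    fibre product with components [p] and the identity. *)
Let pi_surj t (U : opens M) (h : U `<=` nb c t) y : exists x, happ (pi t) h x = y.
Proof.
have [|f [_ fP]] := twist_lift_on i_inj ip_exact Xpi (@subset_refl _ (nb c t))
  (q := mor_on p (nb c t)) (r := hom_id El (nb c t)).
  by move=> V hV x; rewrite mor_onE.
by exists (happ f h y); rewrite fP.
Qed.

Definition twist_red (U : opens M) (x : xmid X U) : E U := q_red Ek U (mapp (xout X) x).

Lemma twist_red_is_zmod (U : opens M) : zmod_morphism (@twist_red U).
Proof. by move=> x y; rewrite /twist_red mappB raddfB. Qed.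

HB.instance Definition _ (U : opens M) :=
  GRing.isZmodMorphism.Build _ _ (@twist_red U) (@twist_red_is_zmod U).

Let twist_redE t (U : opens M) (h : U `<=` nb c t) x :
  twist_red x = q_red El U (happ (pi t) h x).
Proof. by rewrite /twist_red -(ext_red_E pE) pi_out. Qed.

Let twist_red_nat (U V : opens M) (h : V `<=` U) (x : xmid X U) :
  mres E h (twist_red x) = twist_red (mres (xmid X) h x).
Proof. by rewrite /twist_red q_red_nat mapp_nat. Qed.

Let twist_redZ (U : opens M) (a : A U) (x : xmid X U) :
  twist_red (a *: x) = dq_red A U a *: twist_red x.
Proof. by rewrite /twist_red mappZ q_redZ. Qed.

Let twist_red_surj (U : opens M) (y : E U) (t : M) : oset U t ->
  exists (V : opens M) (h : V `<=` U) (x : xmid X V),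
    oset V t /\ twist_red x = mres E h y.
Proof.
move=> Ut; have [V [h [e [Vt eE]]]] := q_red_surj Ek y Ut.
have [V' [h' [x [Vt' xE]]]] := xout_surj X e Vt.
exists V', (subset_trans h' h), x; split=> //.
by rewrite /twist_red xE -q_red_nat eE (mres_comp _ _ (subset_trans h' h)).
Qed.

Let twist_red_ker (U : opens M) (x : xmid X U) :
  twist_red x = 0 <-> hdiv (dq_ps A) 1 x.
Proof.
split=> [x0|/(hdiv_local_iso (nbP c) pi_inj pi_surj) xm].
  apply/(hdiv_local_iso (nbP c) pi_inj pi_surj) => t V h ht; apply/q_red_ker.
  by rewrite -twist_redE -twist_red_nat x0 raddf0.
apply: mres_sep_pt => t Ut; have h := @oIl _ U (nb c t); have ht := @oIr _ U (nb c t).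
exists (oI U (nb c t)), h; split; first by split=> //; apply: nbP.
by rewrite twist_red_nat (twist_redE ht) raddf0; apply/q_red_ker/xm.
Qed.

(** Local freeness and the kernel of the reduction are local matters, and over [nb c t] the map
    [pi t] identifies the twist with [El], compatibly with the reductions to [Ek] and [E]. *)
Definition twist_quantization : quantization A E l :=
  @Quantization _ _ _ _ w A E l (xmid X)
    (loc_free_local_iso (nbP c) pi_inj pi_surj (q_free El))
    (fun U => @twist_red U : {additive _ -> _})
    twist_red_nat twist_redZ twist_red_surj twist_red_ker.

Lemma twist_reduction : reduction (dq_ps A) k.+1 (xout X : mor twist_quantization Ek).
Proof.
have [pS pker] := ext_redP pE; split=> [U y t Ut|U x]; first exact: (xout_surj X).
split=> [x0|/(hdiv_local_iso (nbP c) pi_inj pi_surj) xm].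
  apply/(hdiv_local_iso (nbP c) pi_inj pi_surj) => t V h ht; apply/pker.
  by rewrite -/p pi_out -mapp_nat x0 raddf0.
apply: mres_sep_pt => t Ut; have h := @oIl _ U (nb c t); have ht := @oIr _ U (nb c t).
exists (oI U (nb c t)), h; split; first by split=> //; apply: nbP.
by rewrite mapp_nat -(pi_out ht) raddf0; apply/pker/xm.
Qed.

Definition twist_extends : extends twist_quantization Ek :=
  Extends twist_reduction (fun U x => erefl).

End Extension.
End Quantizations.

(** * Liftings *)

Section Lifting.
Variables (M : topologicalType) (K : fieldType) (O : ring_sheaf M) (KO : kalg K O).
Variables (w : two_form KO) (A : def_quant w) (E F : mod_sheaf O) (k l s : nat).
Variables (Ek : quantization A E k) (Es : quantization A E s).
Variables (Fk : quantization A F k) (Fs : quantization A F s).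
Variables (rE : extends Ek Es) (rF : extends Fk Fs).
Hypothesis hl : (k.+1 + s.+1 = l.+1)%N.
Hypothesis sk : (s <= k)%N.

Lemma precomp_red_inj (U : opens M) : injective (precomp Fs (ext_red rE) U).
Proof.
move=> f g fg; apply: (hom_ext_loc_surj (proj1 (ext_redP rE))) => V h x.
have : happ f h (happ (mor_on (ext_red rE) U) h x) = happ g h (happ (mor_on (ext_red rE) U) h x).
  exact: (congr1 (fun q : hom_on Ek Fs U => happ q h x) fg).
by rewrite mor_onE.
Qed.

Lemma precomp_red_surj (U : opens M) (g : sheafHom Ek Fs U) :
  exists f, precomp Fs (ext_red rE) U f = g.
Proof.
have [f fP] := reduction_descend g (ext_redP rE) (@quant_kill _ _ _ _ _ _ _ _ Fs).
exists f; apply: hom_ext => V h x.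
by rewrite -[LHS]/(happ f h (happ (mor_on (ext_red rE) U) h x)) mor_onE fP.
Qed.

(** As [Fs] is killed by hbar^(s+1), composition with [Ek] -> [Es] is bijective on sections of the
    Hom sheaves, hence injective on H^1; the edge map itself is injective. *)
Lemma edge_red_inj :
  injective (fun c => ext_edge (H1_map (precomp Fs (ext_red rE)) c)).
Proof.
move=> c d /ext_edge_inj; apply: H1_map_inj.
  exact: precomp_red_inj.
exact: precomp_red_surj.
Qed.

Section Differences.
Variables (El : quantization A E l) (Fl : quantization A F l).
Variables (pE : extends El Ek) (pF : extends Fl Fk).
Notation iE := (hbar_incl pE rE hl sk).
Notation iF := (hbar_incl pF rF hl sk).

Lemma red_comp_surj : loc_surj (red_comp pE rE).
Proof. exact: (proj1 (red_compP pE rE sk)). Qed.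

(** The difference takes values in hbar^(k+1) Fl, a copy of [Fs], and a map to [Fs] kills hbar^(s+1)
    El; so it factors through [Es]. *)
Lemma hom_diff (W : opens M) (g g' : hom_on El Fl W) :
  (forall (U : opens M) (h : U `<=` W) x,
     mapp (ext_red pF) (happ g h x) = mapp (ext_red pF) (happ g' h x)) ->
  exists psi : hom_on Es Fs W, forall (U : opens M) (h : U `<=` W) x,
    happ g h x - happ g' h x = mapp iF (happ psi h (mapp (red_comp pE rE) x)).
Proof.
move=> gg'.
have [||d dP] := @hom_factor _ _ _ _ _ W iF (g - g').
- exact: hbar_incl_inj.
- by move=> U h x; apply/hbar_incl_exact; rewrite hom_subE mappB gg' subrr.
have [psi psiP] := reduction_descend d (red_compP pE rE sk)
  (@quant_kill _ _ _ _ _ _ _ _ Fs).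
by exists psi => U h x; rewrite psiP -dP.
Qed.

(** Both inclusions multiply a local lift by hbar^(k+1), and [g] is linear. Thus every local lifting
    is a local morphism of extensions inducing [phis] on the submodules. *)
Lemma hom_hbar_incl (phik : mor Ek Fk) (phis : mor Es Fs) (W : opens M) (g : hom_on El Fl W) :
  hom_comp phis (ext_red rE) = hom_comp (ext_red rF) phik ->
  (forall (U : opens M) (h : U `<=` W) x,
     mapp (ext_red pF) (happ g h x) = mapp phik (mapp (ext_red pE) x)) ->
  forall (U : opens M) (h : U `<=` W) y,
    happ g h (mapp iE y) = mapp iF (mapp phis y).
Proof.
move=> hphi g_out U h y; apply: mres_sep_pt => t Ut.
have [V [hV [x [Vt xy]]]] := red_comp_surj y Ut; have hVW := subset_trans hV h.
exists V, hV; split=> //; rewrite (hnat g hV h hVW) !mapp_nat -xy hbar_inclP happZ.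
rewrite -(hbar_inclP pF rF hl sk); congr mapp.
by rewrite mapp_comp g_out -mapp_comp -hphi.
Qed.

(** Existence of psi is the factorization of g' - g over all of M; uniqueness holds because [iF] is
    injective and [El] -> [Es] is an epimorphism. *)
Lemma lifts_torsor (phik : mor Ek Fk) (g g' : mor El Fl) :
  hom_comp (ext_red pF) g = hom_comp phik (ext_red pE) ->
  hom_comp (ext_red pF) g' = hom_comp phik (ext_red pE) <->
  exists! psi : mor Es Fs, g' = g + hom_comp iF (hom_comp psi (red_comp pE rE)).
Proof.
move=> g_out; split=> [g'_out|[psi0 [-> _]]]; last first.
  rewrite -g_out; apply: mor_ext => U x; rewrite !mapp_comp.
  rewrite -[mapp (_ + _) x]/(mapp g x + mapp iF _) mappD [X in _ + X](_ : _ = 0) ?addr0 //.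
  by apply: (proj2 (hbar_incl_exact pF rF hl sk _)); eexists.
have [psi psiP] : exists psi : mor Es Fs, forall (U : opens M) (h : U `<=` oT M) x,
    happ g' h x - happ g h x = mapp iF (happ psi h (mapp (red_comp pE rE) x)).
  apply: hom_diff => U h x; rewrite !(happ_irr _ h (@subsetT _ U)).
  by rewrite -!/(mapp _ _) -!mapp_comp g_out g'_out.
exists psi; split=> [|psi' g'E].
  by apply: hom_ext => U h x; rewrite -[LHS](subrK (happ g h x)) psiP addrC
    (Prop_irrelevance h (@subsetT _ U)).
apply: (hom_ext_loc_surj red_comp_surj) => U h x.
apply: (@hbar_incl_inj _ _ _ _ _ _ _ _ _ _ _ _ _ pF rF hl sk).
rewrite -psiP g'E (Prop_irrelevance h (@subsetT _ U)).
by rewrite -[happ (_ + _) _ x]/(mapp g x + mapp iF _) addrC addKr.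
Qed.

(** The cocycle identity can be checked after applying [iF] and on sections coming from [El], where
    it is a telescoping sum of differences of the g_t. *)
Lemma lifts_cocycle (N : M -> opens M) (g : forall t, hom_on El Fl (N t)) (phik : mor Ek Fk) :
  (forall t, oset (N t) t) ->
  (forall t (U : opens M) (h : U `<=` N t) x,
     mapp (ext_red pF) (happ (g t) h x) = mapp phik (mapp (ext_red pE) x)) ->
  exists c : cocycle1 (sheafHom Es Fs), (forall t, N t `<=` nb c t) /\
    forall t u (U : opens M) (ht : U `<=` N t) (hu : U `<=` N u)
      (htu : U `<=` oI (nb c t) (nb c u)) x,
      happ (g t) ht x - happ (g u) hu x =
      mapp iF (happ (cc c t u) htu (mapp (red_comp pE rE) x)).
Proof.
move=> Nt g_out.
have dP t u : {d : hom_on Es Fs (oI (N t) (N u)) |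
    forall (U : opens M) (ht : U `<=` N t) (hu : U `<=` N u) (htu : U `<=` oI (N t) (N u)) x,
    happ (g t) ht x - happ (g u) hu x =
    mapp iF (happ d htu (mapp (red_comp pE rE) x))}.
  apply: cid.
  have [|d dP] := @hom_diff (oI (N t) (N u)) (hom_res (@oIl _ _ _) (g t))
    (hom_res (@oIr _ _ _) (g u)).
    by move=> U h x; rewrite !hom_resE !g_out.
  exists d => U ht hu htu x; rewrite -dP !hom_resE.
  by rewrite (happ_irr (g t) ht (subset_trans htu (@oIl _ _ _)))
    (happ_irr (g u) hu (subset_trans htu (@oIr _ _ _))).
have coc t u v (W : opens M) (htu : W `<=` oI (N t) (N u)) (huv : W `<=` oI (N u) (N v))
    (htv : W `<=` oI (N t) (N v)) :
  ares (sheafHom Es Fs) htu (sval (dP t u)) + ares (sheafHom Es Fs) huv (sval (dP u v)) =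
  ares (sheafHom Es Fs) htv (sval (dP t v)).
  apply: (hom_ext_loc_surj red_comp_surj) => U h x.
  apply: (@hbar_incl_inj _ _ _ _ _ _ _ _ _ _ _ _ _ pF rF hl sk).
  rewrite -[happ (_ + _) _ _]/(happ (sval (dP t u)) (subset_trans h htu) _ +
    happ (sval (dP u v)) (subset_trans h huv) _) mappD.
  have ht : U `<=` N t by move=> a /h/htu[].
  have hu : U `<=` N u by move=> a /h/htu[].
  have hv : U `<=` N v by move=> a /h/huv[].
  rewrite -(svalP (dP t u) U ht hu) -(svalP (dP u v) U hu hv) subrKA.
  by rewrite (svalP (dP t v) U ht hv (subset_trans h htv)).
exists (@Cocycle1 M (sheafHom Es Fs) N Nt (fun t u => sval (dP t u)) coc).
by split=> [t|t u U ht hu htu x]; [apply: subset_refl|apply: (svalP (dP t u))].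
Qed.

End Differences.
End Lifting.

Section Twisting.
Variables (M : topologicalType) (K : fieldType) (O : ring_sheaf M) (KO : kalg K O).
Variables (w : two_form KO) (A : def_quant w) (E F : mod_sheaf O) (k l s : nat).
Variables (Ek : quantization A E k) (Es : quantization A E s).
Variables (Fk : quantization A F k) (Fs : quantization A F s).
Variables (rE : extends Ek Es) (rF : extends Fk Fs).
Hypothesis hl : (k.+1 + s.+1 = l.+1)%N.
Hypothesis sk : (s <= k)%N.
Variables (El : quantization A E l) (Fl : quantization A F l).
Variables (pE : extends El Ek) (pF : extends Fl Fk).
Notation iE := (hbar_incl pE rE hl sk).
Notation iF := (hbar_incl pF rF hl sk).

(* If g_t are local liftings of phik with g_t - g_u = c_tu and c = b phis - phis a + d(beta),
   then the maps g_t + beta_t glue to a morphism from the twist of El by -a to the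
   twist of Fl by -b. *)
Lemma twisted_lift_exists (phik : mor Ek Fk) (phis : mor Es Fs)
    (N : M -> opens M) (g : forall t, hom_on El Fl (N t)) (c : cocycle1 (sheafHom Es Fs))
    (a : cocycle1 (sheafHom Es Es)) (b : cocycle1 (sheafHom Fs Fs)) :
  hom_comp phis (ext_red rE) = hom_comp (ext_red rF) phik ->
  (forall t, oset (N t) t) ->
  (forall t (U : opens M) (h : U `<=` N t) x,
     mapp (ext_red pF) (happ (g t) h x) = mapp phik (mapp (ext_red pE) x)) ->
  (forall t u (U : opens M) (ht : U `<=` N t) (hu : U `<=` N u)
     (htu : U `<=` oI (nb c t) (nb c u)) x,
     happ (g t) ht x - happ (g u) hu x =
     mapp iF (happ (cc c t u) htu (mapp (red_comp pE rE) x))) ->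
  cohomologous c (cc_add (cc_map (precomp Fs phis) b) (cc_opp (cc_map (postcomp Es phis) a))) ->
  exists (El' : quantization A E l) (Fl' : quantization A F l)
    (pE' : extends El' Ek) (pF' : extends Fl' Fk) (phil : mor El' Fl'),
    hom_comp (ext_red pF') phil = hom_comp phik (ext_red pE').
Proof.
move=> hphi Nt g_out g_c [P [beta [Pt hP cbeta]]].
(* A twist of [El] requires a cocycle with values in Hom(Ek, Es), so a is first composed with the
   reduction [Ek] -> [Es]; similarly for b below. *)
have [X [p Xp]] := twist_exists (cc_opp (cc_map (precomp Es (ext_red rE)) a))
  (@hbar_incl_inj _ _ _ _ _ _ _ _ _ _ _ _ _ pE rE hl sk)
  (@hbar_incl_exact _ _ _ _ _ _ _ _ _ _ _ _ _ pE rE hl sk) (twist_lift_id pE).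
have [Y [q Yq]] := twist_exists (cc_opp (cc_map (precomp Fs (ext_red rF)) b))
  (@hbar_incl_inj _ _ _ _ _ _ _ _ _ _ _ _ _ pF rF hl sk)
  (@hbar_incl_exact _ _ _ _ _ _ _ _ _ _ _ _ _ pF rF hl sk) (twist_lift_id pF).
have [p_in p_out p_a] := Xp.
have hc t : P t `<=` nb c t by move=> v /hP[].
have hb t : P t `<=` nb b t by move=> v /hP[_ []].
have ha t : P t `<=` nb a t by move=> v /hP[_ []].
pose Q t := oI (N t) (P t).
have hQN t : Q t `<=` N t := @oIl _ _ _.
have hQP t : Q t `<=` P t := @oIr _ _ _.
have hQa t : Q t `<=` nb a t := subset_trans (hQP t) (ha t).
(* The correction beta_t makes the defect psi_t - psi_u equal to b phis - phis a exactly, and it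
   does not change the reduction because [iF] lands in its kernel. *)
pose psi t : hom_on El Fl (Q t) := hom_res (hQN t) (g t) +
  hom_comp (mor_on iF (Q t)) (hom_comp (hom_res (hQP t) (beta t)) (mor_on (red_comp pE rE) (Q t))).
have psiE t (U : opens M) (h : U `<=` Q t) (hN : U `<=` N t) (hU : U `<=` P t) x :
    happ (psi t) h x =
    happ (g t) hN x + mapp iF (happ (beta t) hU (mapp (red_comp pE rE) x)).
  have -> : happ (psi t) h x = happ (g t) (subset_trans h (hQN t)) x +
    happ (mor_on iF (Q t)) h (happ (beta t) (subset_trans h (hQP t))
      (happ (mor_on (red_comp pE rE) (Q t)) h x)) by [].
  by rewrite !mor_onE (happ_irr (g t) _ hN) (happ_irr (beta t) _ hU).
pose r t : hom_on (xmid X) Fl (Q t) := hom_comp (psi t) (hom_res (hQa t) (p t)).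
have [|t U h x|t u U ht hu htu x|phil [phil_out _]] :=
  twist_lift (@hbar_incl_inj _ _ _ _ _ _ _ _ _ _ _ _ _ pF rF hl sk)
    (@hbar_incl_exact _ _ _ _ _ _ _ _ _ _ _ _ _ pF rF hl sk) Yq
    (q := hom_comp phik (xout X)) (r := r) (P := Q) _ (fun t => subset_trans (hQP t) (hb t)).
- by move=> t; split.
- rewrite hom_compE hom_resE (psiE _ _ _ (subset_trans h (hQN t)) (subset_trans h (hQP t))).
  rewrite mappD g_out p_out [X in _ + X](_ : _ = 0) ?addr0 //.
  by apply: (proj2 (hbar_incl_exact pF rF hl sk _)); eexists.
- have hNt := subset_trans ht (hQN t); have hNu := subset_trans hu (hQN u).
  have hPt := subset_trans ht (hQP t); have hPu := subset_trans hu (hQP u).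
  have hat := subset_trans ht (hQa t); have hau := subset_trans hu (hQa u).
  have hatu : U `<=` oI (nb a t) (nb a u) by rewrite subsetI.
  have hctu : U `<=` oI (nb c t) (nb c u).
    by rewrite subsetI; split; [exact: subset_trans hPt (hc t)|exact: subset_trans hPu (hc u)].
  have hbtu : U `<=` oI (nb b t) (nb b u) := htu.
  (* In r_u(x) - r_t(x), up to [iF], the twist p_u(x) = p_t(x) - iE(a(e)) contributes -phis(a(e)),
     the difference g_u - g_t contributes -c(e), and beta_u - beta_t contributes c(e) - b(phis(e)) +
     phis(a(e)). The sum is -b(phis(e)), the twist of the target. *)
  pose e := mapp (ext_red rE) (mapp (xout X) x).
  have red_p v (h : U `<=` nb a v) : mapp (red_comp pE rE) (happ (p v) h x) = e.
    by rewrite mapp_comp p_out.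
  have p_u : happ (p u) hau x = happ (p t) hat x + mapp iE (- happ (cc a t u) hatu e).
    rewrite -[LHS](subrK (happ (p t) hat x)) (p_a _ _ _ hat hau hatu) addrC; congr (_ + mapp _ _).
    rewrite -[LHS]/(- happ (cc a t u) hatu (happ (mor_on (ext_red rE) _) hatu (mapp (xout X) x))).
    by rewrite mor_onE.
  have hd : U `<=` oI (oI (nb b t) (nb a t)) (oI (nb b u) (nb a u)).
    by move=> v Uv; have [? ?] := hbtu v Uv; have [? ?] := hatu v Uv.
  have : happ (cc c t u) _ e - (happ (cc b t u) _ (happ (mor_on phis _) _ e) -
           happ (mor_on phis _) _ (happ (cc a t u) _ e)) =
         happ (beta u) _ e - happ (beta t) _ e :=
    congr1 (fun f : hom_on Es Fs U => happ f (@subset_refl _ U) e) (cbeta t u U hPt hPu hctu hd).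
  rewrite !mor_onE (happ_irr (cc c t u) _ hctu) (happ_irr (cc b t u) _ hbtu).
  rewrite (happ_irr (cc a t u) _ hatu) (happ_irr (beta t) _ hPt) (happ_irr (beta u) _ hPu) => cb.
  rewrite !hom_compE !hom_resE (psiE _ _ _ hNt hPt) (psiE _ _ _ hNu hPu).
  rewrite (happ_irr (p t) _ hat) (happ_irr (p u) _ hau) !red_p.
  rewrite opprD addrACA -mappB -cb p_u happD (hom_hbar_incl hl sk hphi (g_out u)).
  rewrite [happ (g u) _ _ + _ - _]addrAC -[_ - happ (g t) _ _]opprB (g_c _ _ _ hNt hNu hctu).
  rewrite red_p -[- mapp iF _]mappN -!mappD.
  rewrite mappN opprB addrACA addNr add0r addKr; congr mapp.
  rewrite -[RHS]/(- happ (cc b t u) htu (happ (mor_on (ext_red rF) _) htu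
    (mapp (hom_comp phik (xout X)) x))).
  by rewrite mor_onE mapp_comp -[mapp (ext_red rF) _]mapp_comp -hphi mapp_comp
    (happ_irr (cc b t u) _ htu).
by exists (twist_quantization Xp), (twist_quantization Yq), (twist_extends Xp),
  (twist_extends Yq), phil.
Qed.

End Twisting.

Theorem proposition13
  (M : topologicalType) (n : nat) (K : fieldType)
  (O : ring_sheaf M) (KO : kalg K O) (Mgeom : geometric (2 * n)%N KO)
  (w : two_form KO) (wsympl : symplectic w) (Oh : def_quant w)
  (E F : mod_sheaf O) (Efree : loc_free_O E) (Ffree : loc_free_O F)
  (k l s : nat) (hkl : (k.+1 <= l <= (2 * k).+1)%N) (hs : s = (l - k.+1)%N)
  (El : quantization Oh E l) (Ek : quantization Oh E k) (Es : quantization Oh E s)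
  (Fl : quantization Oh F l) (Fk : quantization Oh F k) (Fs : quantization Oh F s)
  (pE : extends El Ek) (rE : extends Ek Es)
  (pF : extends Fl Fk) (rF : extends Fk Fs)
  (phik : mor Ek Fk) (phis : mor Es Fs)
  (hphi : hom_comp phis (ext_red rE) = hom_comp (ext_red rF) phik) :
  let hl := order_eq hkl hs in
  let hsk := order_le hkl hs in
  let el : ext_class Ek Es := Ext1_cl (quant_extension pE rE hl hsk) in
  let fl : ext_class Fk Fs := Ext1_cl (quant_extension pF rF hl hsk) in
  let Ob : ext_class Ek Fs := ext_sub (yoneda_l phis el) (yoneda_r fl phik) in
  let edge (c : H1 (sheafHom Es Fs)) : ext_class Ek Fs :=
    ext_edge (H1_map (precomp Fs (ext_red rE)) c) in
  (* Ob lies in the image of edge, which is a subgroup isomorphic to H^1 *)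
  ([/\ in_Ext1 Ob,
       forall c, in_Ext1 (edge c),
       injective edge,
       forall c d, edge (c - d) = ext_sub (edge c) (edge d) &
       exists c, Ob = edge c]) /\
  (forall (a : H1 (sheafHom Es Es)) (b : H1 (sheafHom Fs Fs)),
    Ob = edge (H1_map (precomp Fs phis) b - H1_map (postcomp Es phis) a) ->
    (exists (El' : quantization Oh E l) (Fl' : quantization Oh F l)
       (pE' : extends El' Ek) (pF' : extends Fl' Fk) (phil : mor El' Fl'),
       hom_comp (ext_red pF') phil = hom_comp phik (ext_red pE')) /\
    (* the liftings of phik form a torsor under Hom(Es, Fs) *)
    (forall (El' : quantization Oh E l) (Fl' : quantization Oh F l)
       (pE' : extends El' Ek) (pF' : extends Fl' Fk) (phil : mor El' Fl'),
       hom_comp (ext_red pF') phil = hom_comp phik (ext_red pE') ->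
       forall phil' : mor El' Fl',
         hom_comp (ext_red pF') phil' = hom_comp phik (ext_red pE') <->
         exists! psi : mor Es Fs,
           phil' = phil + hom_comp (hbar_incl pF' rF hl hsk)
                            (hom_comp psi (red_comp pE' rE)))).
Proof.
move=> hl hsk el fl Ob edge.
(* One local lifting is chosen at each point, since the coverings of Cech cocycles are indexed by
   points. *)
have lifts t := cid (quant_lift pE pF phik t).
pose N t := sval (lifts t).
have lifts' t : {g : hom_on El Fl (N t) | oset (N t) t /\
    forall (U : opens M) (h : U `<=` N t) x,
      mapp (ext_red pF) (happ g h x) = mapp phik (mapp (ext_red pE) x)}.
  exact: cid (svalP (lifts t)).
pose g t := sval (lifts' t).
have Nt t : oset (N t) t by case: (svalP (lifts' t)).
have g_out t := proj2 (svalP (lifts' t)).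
have [c [hN g_c]] := lifts_cocycle rE rF hl hsk Nt g_out.
(* Read through [Ek] -> [Es], the cocycle c is the gluing defect of the g_t as local morphisms
   between the two quantization extensions. *)
have ObE : Ob = edge (H1cl c).
  rewrite /Ob /edge H1_mapE.
  apply: (@obstruction_edge _ _ _ _ _ _ (quant_extension pE rE hl hsk)
    (quant_extension pF rF hl hsk) _ _ _ N g) => //.
  - move=> t U h y; apply: (hom_hbar_incl hl hsk hphi (g_out t)).
  - move=> t u U ht hu htu x; rewrite (g_c _ _ _ _ _ htu); congr mapp.
    rewrite -[RHS]/(happ (cc c t u) htu (happ (mor_on (ext_red rE) _) htu
      (mapp (ext_red pE) x))).
    by rewrite mor_onE.
have edgeI : injective edge by exact: edge_red_inj.
split.
  split=> //.
  - by rewrite ObE; apply: ext_edge_in_Ext1.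
  - by move=> d; apply: ext_edge_in_Ext1.
  - by move=> d d'; rewrite /edge H1_mapB ext_edge_sub.
  - by exists (H1cl c).
(* Injectivity of the edge map turns the equality of extension classes into an equality in H^1, that
   is, into a cochain beta on actual open sets. *)
move=> a b; rewrite -(H1cl_repr a) -(H1cl_repr b) !H1_mapE ObE => /edgeI cab.
split; last by move=> El' Fl' pE' pF' phil hphil phil'; apply: lifts_torsor hphil.
apply: (twisted_lift_exists hphi Nt g_out g_c).
apply/H1clP; rewrite cab.
by rewrite -H1_addE -H1_oppE.
Qed.
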